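(* (ZFC) Let $\kappa$ be a limit of measurable cardinals and let $D$ be a subset of $\mathcal{P}(\kappa)$ that is definable by a $\Sigma_1$-formula with parameters in $H(\kappa)\cup\{\kappa\}$. If $D$ has cardinality greater than $\kappa$, then there is a perfect embedding $\iota:{}^{\mathrm{cof}(\kappa)}\kappa\to\mathcal{P}(\kappa)$ with $\mathrm{ran}(\iota)\subseteq D$.
   Context: $\Sigma_1$ refers to the Levy hierarchy of formulas of set theory. $H(\kappa)$ is the set of all sets of hereditary cardinality less than $\kappa$. A class $D$ is definable by a $\Sigma_1$-formula with parameters in a set $P$ if $D=\{x\mid\varphi(x,p_0,\ldots,p_{n-1})\}$ (evaluated in $V$) for some $\Sigma_1$-formula $\varphi$ and $p_0,\ldots,p_{n-1}\in P$. For a cardinal $\kappa>0$ and an infinite cardinal $\mu$, the set ${}^\mu\kappa$ of all functions from $\mu$ to $\kappa$ carries the topology whose basic open sets consist of all functions in ${}^\mu\kappa$ extending a given function $s:\xi\to\kappa$ with $\xi<\mu$. For an infinite cardinal $\nu$, the power set $\mathcal{P}(\nu)$ carries the topology whose basic open sets consist of all subsets of $\nu$ whose intersection with a given ordinal $\eta<\nu$ equals a fixed subset of $\eta$. An injection $\iota:{}^\mu\kappa\to\mathcal{P}(\nu)$ is a perfect embedding if it induces a homeomorphism between ${}^\mu\kappa$ and the subspace $\mathrm{ran}(\iota)$ of $\mathcal{P}(\nu)$. *)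

(* Defs.v *)
(* A statement proved in ZFC is rendered as a statement about every first-order
   model of ZFC, of any size and not necessarily well-founded.  "Set" below
   always means an element of the model; the classes defined by formulas with
   parameters are Rocq predicates on the model. *)

Structure set_structure : Type := SetStructure {
  carrier :> Type;
  mem : carrier -> carrier -> Prop
}.

Arguments mem {s} x y.

Declare Scope set_scope.
Notation "x ∈ y" := (mem x y) (at level 70, no associativity) : set_scope.
Open Scope set_scope.

Definition subset {M : set_structure} (x y : M) : Prop :=
  forall z, z ∈ x -> z ∈ y.
Notation "x ⊆ y" := (subset x y) (at level 70, no associativity) : set_scope.

(* Variables are de Bruijn indices: index 0 is bound by the innermost
   quantifier. *)
Inductive formula : Type :=
| FMem (i j : nat)
| FEq (i j : nat)
| FNot (f : formula)
| FAnd (f g : formula)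
| FOr (f g : formula)
| FImp (f g : formula)
| FAll (f : formula)
| FEx (f : formula).

Definition scons {T : Type} (x : T) (e : nat -> T) (i : nat) : T :=
  match i with 0 => x | S j => e j end.

Fixpoint sat {M : set_structure} (e : nat -> M) (f : formula) : Prop :=
  match f with
  | FMem i j => e i ∈ e j
  | FEq i j => e i = e j
  | FNot g => ~ sat e g
  | FAnd g h => sat e g /\ sat e h
  | FOr g h => sat e g \/ sat e h
  | FImp g h => sat e g -> sat e h
  | FAll g => forall x, sat (scons x e) g
  | FEx g => exists x, sat (scons x e) g
  end.

(* In the bounded quantifiers the bound is the variable [i] of the ambient
   context, hence [S i] under the binder. *)
Inductive delta0 : formula -> Prop :=
| delta0_mem i j : delta0 (FMem i j)
| delta0_eq i j : delta0 (FEq i j)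
| delta0_not f : delta0 f -> delta0 (FNot f)
| delta0_and f g : delta0 f -> delta0 g -> delta0 (FAnd f g)
| delta0_or f g : delta0 f -> delta0 g -> delta0 (FOr f g)
| delta0_imp f g : delta0 f -> delta0 g -> delta0 (FImp f g)
| delta0_ball i f : delta0 f -> delta0 (FAll (FImp (FMem 0 (S i)) f))
| delta0_bex i f : delta0 f -> delta0 (FEx (FAnd (FMem 0 (S i)) f)).

(* A block of unbounded existential quantifiers before a [delta0] formula. *)
Inductive sigma1 : formula -> Prop :=
| sigma1_delta0 f : delta0 f -> sigma1 f
| sigma1_ex f : sigma1 f -> sigma1 (FEx f).

(* The parameters are given by a sequence [p] all of whose terms lie in [P];
   since [f] has finitely many free variables, only finitely many of them are
   used. *)
Definition sigma1_definable {M : set_structure} (P C : M -> Prop) : Prop :=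
  exists (f : formula) (p : nat -> M),
    sigma1 f /\ (forall i, P (p i)) /\
    (forall x, C x <-> sat (scons x p) f).

Definition is_empty {M : set_structure} (x : M) : Prop :=
  forall z, ~ z ∈ x.

Definition is_succ {M : set_structure} (x y : M) : Prop :=
  forall z, z ∈ y <-> z ∈ x \/ z = x.

Definition is_upair {M : set_structure} (x y p : M) : Prop :=
  forall z, z ∈ p <-> z = x \/ z = y.

Definition is_powerset {M : set_structure} (x p : M) : Prop :=
  forall z, z ∈ p <-> z ⊆ x.

Record ZFC (M : set_structure) : Prop := {
  zfc_extensionality : forall x y : M, (forall z, z ∈ x <-> z ∈ y) -> x = y;
  zfc_foundation : forall x : M, ~ is_empty x ->
    exists y, y ∈ x /\ forall z, z ∈ y -> ~ z ∈ x;
  zfc_pairing : forall x y : M, exists p, is_upair x y p;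
  zfc_union : forall x : M,
    exists u, forall z, z ∈ u <-> exists y, y ∈ x /\ z ∈ y;
  zfc_powerset : forall x : M, exists p, is_powerset x p;
  zfc_infinity : exists w : M,
    (exists x, x ∈ w /\ is_empty x) /\
    (forall x, x ∈ w -> exists y, y ∈ w /\ is_succ x y);
  zfc_separation : forall (f : formula) (e : nat -> M) (a : M),
    exists b, forall x, x ∈ b <-> x ∈ a /\ sat (scons x e) f;
  zfc_replacement : forall (f : formula) (e : nat -> M) (a : M),
    (forall x, x ∈ a -> forall y y',
       sat (scons y (scons x e)) f -> sat (scons y' (scons x e)) f -> y = y') ->
    exists b, forall y,
      y ∈ b <-> exists x, x ∈ a /\ sat (scons y (scons x e)) f;
  zfc_choice : forall a : M,
    (forall x, x ∈ a -> ~ is_empty x) ->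
    (forall x y z, x ∈ a -> y ∈ a -> z ∈ x -> z ∈ y -> x = y) ->
    exists c, forall x, x ∈ a -> exists! z, z ∈ x /\ z ∈ c
}.

(* Kuratowski pairs: [p] is {{x}, {x, y}}. *)
Definition is_pair {M : set_structure} (x y p : M) : Prop :=
  forall z, z ∈ p <-> is_upair x x z \/ is_upair x y z.

Definition app {M : set_structure} (f x y : M) : Prop :=
  exists p, is_pair x y p /\ p ∈ f.

Definition is_function {M : set_structure} (f a b : M) : Prop :=
  (forall p, p ∈ f -> exists x y, x ∈ a /\ y ∈ b /\ is_pair x y p) /\
  (forall x, x ∈ a -> exists! y, app f x y).

Definition is_injection {M : set_structure} (f a b : M) : Prop :=
  is_function f a b /\
  (forall x x' y, app f x y -> app f x' y -> x = x').

Definition is_bijection {M : set_structure} (f a b : M) : Prop :=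
  is_injection f a b /\ (forall y, y ∈ b -> exists x, app f x y).

Definition is_range {M : set_structure} (f r : M) : Prop :=
  forall y, y ∈ r <-> exists x, app f x y.

Definition is_funspace {M : set_structure} (a b s : M) : Prop :=
  forall f, f ∈ s <-> is_function f a b.

Definition transitive {M : set_structure} (x : M) : Prop :=
  forall y, y ∈ x -> y ⊆ x.

Definition ordinal {M : set_structure} (a : M) : Prop :=
  transitive a /\
  (forall x y, x ∈ a -> y ∈ a -> x ∈ y \/ x = y \/ y ∈ x).

Definition limit_ordinal {M : set_structure} (a : M) : Prop :=
  ordinal a /\ ~ is_empty a /\
  (forall x, x ∈ a -> exists y, y ∈ a /\ x ∈ y).

Definition is_omega {M : set_structure} (w : M) : Prop :=
  limit_ordinal w /\ (forall n, n ∈ w -> ~ limit_ordinal n).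

Definition equinumerous {M : set_structure} (x y : M) : Prop :=
  exists f, is_bijection f x y.

Definition cardinal {M : set_structure} (k : M) : Prop :=
  ordinal k /\ (forall a, a ∈ k -> ~ equinumerous a k).

Definition is_cardinality {M : set_structure} (x k : M) : Prop :=
  cardinal k /\ equinumerous x k.

Definition card_lt {M : set_structure} (x k : M) : Prop :=
  exists l, is_cardinality x l /\ l ∈ k.

Definition card_gt {M : set_structure} (x k : M) : Prop :=
  exists l, is_cardinality x l /\ k ∈ l.

Definition is_transitive_closure {M : set_structure} (x t : M) : Prop :=
  transitive t /\ x ⊆ t /\
  (forall s, transitive s -> x ⊆ s -> t ⊆ s).

Definition in_H {M : set_structure} (k x : M) : Prop :=
  exists t, is_transitive_closure x t /\ card_lt t k.

Definition has_cofinal_map {M : set_structure} (m k : M) : Prop :=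
  exists f, is_function f m k /\
    (forall a, a ∈ k -> exists x b, app f x b /\ a ⊆ b).

Definition is_cofinality {M : set_structure} (k m : M) : Prop :=
  ordinal m /\ has_cofinal_map m k /\
  (forall n, n ∈ m -> ~ has_cofinal_map n k).

Definition is_complement {M : set_structure} (k x y : M) : Prop :=
  forall z, z ∈ y <-> z ∈ k /\ ~ z ∈ x.

Definition ultrafilter {M : set_structure} (k u : M) : Prop :=
  (forall x, x ∈ u -> x ⊆ k) /\
  k ∈ u /\
  (forall x, x ∈ u -> ~ is_empty x) /\
  (forall x y, x ∈ u -> x ⊆ y -> y ⊆ k -> y ∈ u) /\
  (forall x y i, x ∈ u -> y ∈ u ->
     (forall z, z ∈ i <-> z ∈ x /\ z ∈ y) -> i ∈ u) /\
  (forall x y, x ⊆ k -> is_complement k x y -> x ∈ u \/ y ∈ u).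

Definition nonprincipal {M : set_structure} (k u : M) : Prop :=
  forall x s, x ∈ k -> is_upair x x s -> ~ s ∈ u.

Definition complete {M : set_structure} (k u : M) : Prop :=
  forall a i, a ⊆ u -> ~ is_empty a -> card_lt a k ->
    (forall z, z ∈ i <-> forall x, x ∈ a -> z ∈ x) -> i ∈ u.

Definition measurable {M : set_structure} (k : M) : Prop :=
  cardinal k /\
  (exists w, is_omega w /\ w ∈ k) /\
  (exists u, ultrafilter k u /\ nonprincipal k u /\ complete k u).

Definition limit_of_measurables {M : set_structure} (k : M) : Prop :=
  ordinal k /\ ~ is_empty k /\
  (forall a, a ∈ k -> exists m, m ∈ k /\ a ∈ m /\ measurable m).

(* A topology on a set of the model is given by its class of open sets. *)

Definition open_from_base {M : set_structure} (B : M -> Prop) (o : M) : Prop :=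
  forall x, x ∈ o -> exists b, B b /\ x ∈ b /\ b ⊆ o.

Definition subspace_open {M : set_structure} (O : M -> Prop) (s w : M) : Prop :=
  exists o, O o /\ (forall x, x ∈ w <-> x ∈ o /\ x ∈ s).

Definition homeomorphism {M : set_structure} (OX OY : M -> Prop) (f X Y : M)
  : Prop :=
  is_bijection f X Y /\
  (forall o a, OY o ->
     (forall x, x ∈ a <-> exists y, y ∈ o /\ app f x y) -> OX a) /\
  (forall o b, OX o ->
     (forall y, y ∈ b <-> exists x, x ∈ o /\ app f x y) -> OY b).

Definition funspace_basic {M : set_structure} (m k b : M) : Prop :=
  exists xi s, xi ∈ m /\ is_function s xi k /\
    (forall f, f ∈ b <-> is_function f m k /\ s ⊆ f).

Definition powerset_basic {M : set_structure} (n b : M) : Prop :=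
  exists eta a, eta ∈ n /\ a ⊆ eta /\
    (forall x, x ∈ b <-> x ⊆ n /\ (forall z, z ∈ x /\ z ∈ eta <-> z ∈ a)).

Definition perfect_embedding {M : set_structure} (m k n i : M) : Prop :=
  exists F P R,
    is_funspace m k F /\ is_powerset n P /\ is_range i R /\
    is_injection i F P /\
    homeomorphism
      (open_from_base (funspace_basic m k))
      (subspace_open (open_from_base (powerset_basic n)) R)
      i F R.

(* Main.v *)
(* For a measurable cardinal d < kappa with measure u_d, iterating ultrapowers by
   these measures along indices (d,b), ordered lexicographically, is a reduced
   product: the elements of the iterate are functions of finite support on the
   product Pi of the cardinals d, one factor for each (d,b), modulo one filter [ae].
   Its members are the sets containing all points that follow some strategy
   choosing, for each coordinate, a measure one set from the earlier coordinates.
   The filter is countably complete and decides sets of finite support, so the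
   product collapses to a transitive set and Łoś's theorem holds for bounded
   quantifiers.  If only few indices have their first entry below any given bound,
   if every d lies above the given parameters and differs from cof(kappa), then the
   embedding fixes kappa and the parameters, and upward absoluteness of Sigma_1
   formulas yields that the image [img I x] of x ∈ D belongs to D again.

   Iterating the measure on d r times, for r < kappa, after a bounded set J of
   indices below d, gives sets y_r ⊆ kappa which converge, as r tends to kappa, to
   a set E depending only on x ∩ d.  Suppose that the least elements of the
   symmetric differences of y_r and E take fewer than kappa values, for x and for
   some x' with x' ∩ d = x ∩ d.  The iterates send the first difference of x and x'
   beyond all these values for some r, which forces x = x'.  Hence at most kappa
   many subsets x of kappa are bad for some (J,d), and since D has more than kappa
   elements it contains an x that is good for all (J,d).

   For this x, every node of a tree of height cof(kappa) can be given kappa many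
   successors, by iterating the next measure long enough to produce different first
   places at which E is left.  The later iterations do not change the sets below
   the cardinals reached, so that sending a branch f to the image of x under the
   iteration it describes is a perfect embedding into D. *)

From Stdlib Require Import ssreflect PeanoNat Lia.
From Stdlib Require Import ClassicalEpsilon FunctionalExtensionality PropExtensionality.
Require Import Defs.

Set Implicit Arguments.
Unset Strict Implicit.
Unset Printing Implicit Defensive.

(** * Definability with parameters *)

(** Separation and replacement hold in a model for definable classes only, so the predicates and
    operations to which they are applied carry proofs of definability with parameters, found by
    instance search. Iterations are not built as directed systems. One product over all indices is
    fixed, and an iteration is given by the set in which supports may lie; comparing two iterations
    means eliminating coordinates in which a function with few values is almost constant. The filter
    decides only properties of finite support, and V is not a set. Hence ultrapowers are taken of
    transitive sets N containing the witnesses of the Sigma_1 formula, for which Łoś's theorem for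
    bounded formulas suffices. A measure on cof(kappa) is avoided because its ultrapower is
    discontinuous at kappa. The limit E exists because r iterations push the image of d up to r at
    least, and below that image only x ∩ d matters. The bad sets are counted by the codes (J, d, x ∩
    d), at most kappa many because a limit of measurables is a strong limit. *)

Structure zfc_model : Type := ZFCModel { base :> set_structure; zfc_ax : ZFC base }.

Fixpoint ren (r : nat -> nat) (f : formula) : formula :=
  match f with
  | FMem i j => FMem (r i) (r j)
  | FEq i j => FEq (r i) (r j)
  | FNot g => FNot (ren r g)
  | FAnd g h => FAnd (ren r g) (ren r h)
  | FOr g h => FOr (ren r g) (ren r h)
  | FImp g h => FImp (ren r g) (ren r h)
  | FAll g => FAll (ren (fun i => match i with 0 => 0 | S j => S (r j) end) g)
  | FEx g => FEx (ren (fun i => match i with 0 => 0 | S j => S (r j) end) g)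
  end.

Section Definability.
Context {M : set_structure}.

Lemma scons_ren (x : M) e r :
  (fun i => scons x e (match i with 0 => 0 | S j => S (r j) end))
  = scons x (fun i => e (r i)).
Proof. by apply: functional_extensionality; case. Qed.

Lemma sat_ren (f : formula) : forall (r : nat -> nat) (e : nat -> M),
  sat e (ren r f) <-> sat (fun i => e (r i)) f.
Proof.
  elim: f => //=.
  - by move=> f IH r e; rewrite IH.
  - by move=> f IHf g IHg r e; rewrite IHf IHg.
  - by move=> f IHf g IHg r e; rewrite IHf IHg.
  - by move=> f IHf g IHg r e; rewrite IHf IHg.
  - by move=> f IH r e; split=> H x; move: (H x); rewrite IH scons_ren.
  - by move=> f IH r e; split=> -[x H]; exists x; move: H; rewrite IH scons_ren.
Qed.

(** Each variable of a formula is sent either to a position of the environment or to a fixed element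
    of the model, so formulas read through [val s e] are formulas with parameters. *)
Definition val (s : nat -> nat + M) (e : nat -> M) (i : nat) : M :=
  match s i with inl j => e j | inr c => c end.

Class Def (P : (nat -> M) -> Prop) : Prop :=
  def_formula : exists f s, forall e, P e <-> sat (val s e) f.

(** A term counts as definable when its graph is; position 0 of the environment holds the value and
    the arguments are shifted by one. *)
Class DefT (t : (nat -> M) -> M) : Prop :=
  def_graph : Def (fun e => e 0 = t (fun i => e (S i))).

(** Merges two parameter assignments: the first formula is moved to the even variables and the
    second to the odd ones. *)
Lemma def_joint P Q : Def P -> Def Q -> exists f g s,
  (forall e, P e <-> sat (val s e) f) /\ (forall e, Q e <-> sat (val s e) g).
Proof.
  move=> [f [s Hf]] [g [t Hg]].
  exists (ren (fun i => 2 * i) f), (ren (fun i => S (2 * i)) g),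
    (fun i => if Nat.even i then s (Nat.div2 i) else t (Nat.div2 i)).
  split=> e; rewrite sat_ren; [rewrite Hf | rewrite Hg].
  - suff -> : (fun i => val (fun i0 => if Nat.even i0 then s (Nat.div2 i0)
        else t (Nat.div2 i0)) e (2 * i)) = val s e by [].
    by apply: functional_extensionality => i; rewrite /val Nat.even_even Nat.div2_double.
  - suff -> : (fun i => val (fun i0 => if Nat.even i0 then s (Nat.div2 i0)
        else t (Nat.div2 i0)) e (S (2 * i))) = val t e by [].
    apply: functional_extensionality => i.
    by rewrite /val Nat.div2_succ_double -Nat.add_1_r Nat.even_odd.
Qed.

Lemma def_constP (P : Prop) : Def (fun _ => P).
Proof.
  case: (classic P) => H.
  - by exists (FEq 0 0), (fun _ => inl 0) => e /=; split.
  - by exists (FNot (FEq 0 0)), (fun _ => inl 0) => e /=; split=> // H'; case: H'.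
Qed.

Lemma def_and P Q : Def P -> Def Q -> Def (fun e => P e /\ Q e).
Proof.
  move=> HP HQ; have [f [g [s [Hf Hg]]]] := def_joint HP HQ.
  by exists (FAnd f g), s => e /=; rewrite Hf Hg.
Qed.
Lemma def_or P Q : Def P -> Def Q -> Def (fun e => P e \/ Q e).
Proof.
  move=> HP HQ; have [f [g [s [Hf Hg]]]] := def_joint HP HQ.
  by exists (FOr f g), s => e /=; rewrite Hf Hg.
Qed.
Lemma def_imp P Q : Def P -> Def Q -> Def (fun e => P e -> Q e).
Proof.
  move=> HP HQ; have [f [g [s [Hf Hg]]]] := def_joint HP HQ.
  by exists (FImp f g), s => e /=; rewrite Hf Hg.
Qed.
Lemma def_iff P Q : Def P -> Def Q -> Def (fun e => P e <-> Q e).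
Proof. by move=> HP HQ; apply: def_and; apply: def_imp. Qed.
Lemma def_not P : Def P -> Def (fun e => ~ P e).
Proof. by move=> [f [s Hf]]; exists (FNot f), s => e /=; rewrite Hf. Qed.

(** Weakening below one binder: variable 0 stays and the others make room for a new variable 1. *)
Definition skip1 (i : nat) : nat := match i with 0 => 0 | S j => S (S j) end.

Lemma def_ren P (r : nat -> nat) : Def P -> Def (fun e => P (fun i => e (r i))).
Proof.
  move=> [f [s Hf]].
  exists f, (fun i => match s i with inl j => inl (r j) | inr c => inr c end) => e.
  rewrite Hf; suff -> : val s (fun i => e (r i)) =
    val (fun i => match s i with inl j => inl (r j) | inr c => inr c end) e by [].
  by apply: functional_extensionality => i; rewrite /val; case: (s i).
Qed.

(** Several variables of a formula may point to position 0 of the environment. When that position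
    gets quantified, all of them are renamed to the bound variable. *)
Lemma scons_val (s : nat -> nat + M) x e :
  (fun i => scons x (val (fun i => match s i with
     | inl (S j) => inl j | inl 0 => inl 0 | inr c => inr c end) e)
     (match s i with inl 0 => 0 | _ => S i end)) = val s (scons x e).
Proof.
  apply: functional_extensionality => i; rewrite /val.
  by case E : (s i) => [[|j]|c] //=; rewrite E.
Qed.

Lemma def_all (P : M -> (nat -> M) -> Prop) :
  Def (fun e => P (e 0) (fun i => e (S i))) -> Def (fun e => forall x, P x e).
Proof.
  move=> [f [s Hf]].
  exists (FAll (ren (fun i => match s i with inl 0 => 0 | _ => S i end) f)),
    (fun i => match s i with inl (S j) => inl j | inl 0 => inl 0 | inr c => inr c end) => e /=.
  split=> H x; move: (H x).
  - by rewrite sat_ren scons_val -Hf.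
  - by rewrite sat_ren scons_val -Hf.
Qed.
Lemma def_ex (P : M -> (nat -> M) -> Prop) :
  Def (fun e => P (e 0) (fun i => e (S i))) -> Def (fun e => exists x, P x e).
Proof.
  move=> [f [s Hf]].
  exists (FEx (ren (fun i => match s i with inl 0 => 0 | _ => S i end) f)),
    (fun i => match s i with inl (S j) => inl j | inl 0 => inl 0 | inr c => inr c end) => e /=.
  split=> -[x H]; exists x; move: H.
  - by rewrite sat_ren scons_val -Hf.
  - by rewrite sat_ren scons_val -Hf.
Qed.

Lemma def_ext P Q : (forall e, P e <-> Q e) -> Def P -> Def Q.
Proof. by move=> E [f [s H]]; exists f, s => e; rewrite -E. Qed.

(** Terms are eliminated by quantifying over their values, which needs only that their graphs are
    definable. *)
Lemma def_atom (R : M -> M -> Prop) t u :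
  Def (fun e => R (e 0) (e 1)) -> DefT t -> DefT u -> Def (fun e => R (t e) (u e)).
Proof.
  move=> HR Ht Hu.
  apply: (def_ext (P := fun e => exists a, exists b, a = t e /\ b = u e /\ R a b)) => [e|].
    by split=> [[a [b [-> [-> ]]]] //|H]; exists (t e), (u e).
  apply: def_ex; apply: def_ex; apply: def_and; [|apply: def_and].
  - exact: (def_ren (fun i => match i with 0 => 1 | S j => S (S j) end) Ht).
  - exact: (def_ren skip1 Hu).
  - exact: (def_ren (fun i => match i with 0 => 1 | _ => 0 end) HR).
Qed.

Lemma def_mem t u : DefT t -> DefT u -> Def (fun e => t e ∈ u e).
Proof.
  by apply: (def_atom (R := mem)); exists (FMem 0 1), (fun i => inl i).
Qed.
Lemma def_eq t u : DefT t -> DefT u -> Def (fun e => t e = u e).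
Proof.
  by apply: (def_atom (R := eq)); exists (FEq 0 1), (fun i => inl i).
Qed.

Lemma def_const (c : M) : DefT (fun _ => c).
Proof. by exists (FEq 0 1), (fun i => match i with 0 => inl 0 | _ => inr c end). Qed.
Lemma def_var n : DefT (fun e => e n).
Proof. by exists (FEq 0 (S n)), (fun i => inl i). Qed.

Lemma def_exu (P : M -> (nat -> M) -> Prop) :
  Def (fun e => P (e 0) (fun i => e (S i))) -> Def (fun e => exists! x, P x e).
Proof.
  move=> H; apply: (def_ex (P := fun x e => unique (fun x => P x e) x)).
  apply: def_and => //; apply: def_all; cbv beta; apply: def_imp.
  - exact: (def_ren skip1 H).
  - exact (def_eq (def_var 1) (def_var 0)).
Qed.

Lemma def_sat (f : formula) : forall t : nat -> (nat -> M) -> M,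
  (forall i, DefT (t i)) -> Def (fun e => sat (fun i => t i e) f).
Proof.
  elim: f => /=.
  - by move=> i j t H; apply: def_mem.
  - by move=> i j t H; apply: def_eq.
  - by move=> f IH t H; apply: def_not; apply: IH.
  - by move=> f IHf g IHg t H; apply: def_and; (apply: IHf || apply: IHg).
  - by move=> f IHf g IHg t H; apply: def_or; (apply: IHf || apply: IHg).
  - by move=> f IHf g IHg t H; apply: def_imp; (apply: IHf || apply: IHg).
  - move=> f IH t H; apply: def_all.
    apply: (def_ext (P := fun e => sat (fun i => (match i with 0 => fun e => e 0
      | S j => fun e => t j (fun i => e (S i)) end) e) f)) => [e|].
      suff -> : (fun i => (match i with 0 => fun e => e 0
      | S j => fun e => t j (fun i => e (S i)) end) e) =
       scons (e 0) (fun i => t i (fun i => e (S i))) by [].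
      by apply: functional_extensionality; case.
    apply: IH => -[|i]; first exact: def_var.
    exact: (def_ren skip1 (H i)).
  - move=> f IH t H; apply: def_ex.
    apply: (def_ext (P := fun e => sat (fun i => (match i with 0 => fun e => e 0
      | S j => fun e => t j (fun i => e (S i)) end) e) f)) => [e|].
      suff -> : (fun i => (match i with 0 => fun e => e 0
      | S j => fun e => t j (fun i => e (S i)) end) e) =
       scons (e 0) (fun i => t i (fun i => e (S i))) by [].
      by apply: functional_extensionality; case.
    apply: IH => -[|i]; first exact: def_var.
    exact: (def_ren skip1 (H i)).
Qed.

Lemma def_subst P (t : nat -> (nat -> M) -> M) :
  Def P -> (forall i, DefT (t i)) -> Def (fun e => P (fun i => t i e)).
Proof.
  move=> [f [s Hf]] Ht.
  apply: (def_ext (P := fun e => sat (fun i => (match s i with inl j => t j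
    | inr c => fun _ => c end) e) f)) => [e|].
    rewrite Hf; suff -> : (fun i => (match s i with inl j => t j
      | inr c => fun _ => c end) e) = val s (fun i => t i e) by [].
    by apply: functional_extensionality => i; rewrite /val; case: (s i).
  by apply: def_sat => i; case: (s i) => // c; apply: def_const.
Qed.

Class Rel1 (R : M -> Prop) : Prop := rel1 : Def (fun e => R (e 0)).
Class Rel2 (R : M -> M -> Prop) : Prop := rel2 : Def (fun e => R (e 0) (e 1)).
Class Rel3 (R : M -> M -> M -> Prop) : Prop :=
  rel3 : Def (fun e => R (e 0) (e 1) (e 2)).
Class Rel5 (R : M -> M -> M -> M -> M -> Prop) : Prop :=
  rel5 : Def (fun e => R (e 0) (e 1) (e 2) (e 3) (e 4)).
Class Fun1 (F : M -> M) : Prop := fun1 : Def (fun e => e 0 = F (e 1)).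
Class Fun2 (F : M -> M -> M) : Prop := fun2 : Def (fun e => e 0 = F (e 1) (e 2)).
Class Fun3 (F : M -> M -> M -> M) : Prop :=
  fun3 : Def (fun e => e 0 = F (e 1) (e 2) (e 3)).

Definition pick5 (t0 t1 t2 t3 t4 : (nat -> M) -> M) (i : nat) : (nat -> M) -> M :=
  match i with 0 => t0 | 1 => t1 | 2 => t2 | 3 => t3 | _ => t4 end.

Lemma def_pick5 t0 t1 t2 t3 t4 : DefT t0 -> DefT t1 -> DefT t2 -> DefT t3 -> DefT t4 ->
  forall i, DefT (pick5 t0 t1 t2 t3 t4 i).
Proof. by move=> H0 H1 H2 H3 H4 [|[|[|[|i]]]]. Qed.

Lemma def_rel1 R `{HR : Rel1 R} t : DefT t -> Def (fun e => R (t e)).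
Proof. by move=> H; apply: (def_subst (t := pick5 t t t t t) HR); apply: def_pick5. Qed.
Lemma def_rel2 R `{HR : Rel2 R} t u : DefT t -> DefT u -> Def (fun e => R (t e) (u e)).
Proof. by move=> H H1; apply: (def_subst (t := pick5 t u u u u) HR); apply: def_pick5. Qed.
Lemma def_rel3 R `{HR : Rel3 R} t u v : DefT t -> DefT u -> DefT v ->
  Def (fun e => R (t e) (u e) (v e)).
Proof. by move=> H H1 H2; apply: (def_subst (t := pick5 t u v v v) HR); apply: def_pick5. Qed.
Lemma def_rel5 R `{HR : Rel5 R} t u v w x : DefT t -> DefT u -> DefT v -> DefT w -> DefT x ->
  Def (fun e => R (t e) (u e) (v e) (w e) (x e)).
Proof. by move=> H H1 H2 H3 H4; apply: (def_subst (t := pick5 t u v w x) HR); apply: def_pick5. Qed.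

Definition pick6 (t0 t1 t2 t3 t4 : (nat -> M) -> M) (i : nat) : (nat -> M) -> M :=
  match i with
  | 0 => fun e => e 0
  | S j => fun e => pick5 t0 t1 t2 t3 t4 j (fun i => e (S i))
  end.
Lemma def_pick6 t0 t1 t2 t3 t4 : DefT t0 -> DefT t1 -> DefT t2 -> DefT t3 -> DefT t4 ->
  forall i, DefT (pick6 t0 t1 t2 t3 t4 i).
Proof.
  move=> H0 H1 H2 H3 H4 [|i] /=; first exact: def_var.
  exact: (def_ren skip1
    (def_pick5 H0 H1 H2 H3 H4 i)).
Qed.

Lemma def_fun1 F `{HF : Fun1 F} t : DefT t -> DefT (fun e => F (t e)).
Proof. by move=> H; apply: (def_subst (t := pick6 t t t t t) HF); apply: def_pick6. Qed.
Lemma def_fun2 F `{HF : Fun2 F} t u : DefT t -> DefT u -> DefT (fun e => F (t e) (u e)).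
Proof. by move=> H H1; apply: (def_subst (t := pick6 t u u u u) HF); apply: def_pick6. Qed.
Lemma def_fun3 F `{HF : Fun3 F} t u v : DefT t -> DefT u -> DefT v ->
  DefT (fun e => F (t e) (u e) (v e)).
Proof. by move=> H H1 H2; apply: (def_subst (t := pick6 t u v v v) HF); apply: def_pick6. Qed.

Lemma def_funct1 F : DefT (fun e => F (e 0)) -> Fun1 F.
Proof. exact: id. Qed.
Lemma def_funct2 F : DefT (fun e => F (e 0) (e 1)) -> Fun2 F.
Proof. exact: id. Qed.
Lemma def_funct3 F : DefT (fun e => F (e 0) (e 1) (e 2)) -> Fun3 F.
Proof. exact: id. Qed.

End Definability.

Arguments def_rel1 {M} R {HR} t.
Arguments def_fun1 {M} F {HF} t.
Arguments def_rel2 {M} R {HR} t u.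
Arguments def_fun2 {M} F {HF} t u.
Arguments def_rel3 {M} R {HR} t u v.
Arguments def_fun3 {M} F {HF} t u v.
Arguments def_rel5 {M} R {HR} t u v w x.

(** * Definite descriptions *)

Section Description.
Context {M : zfc_model}.

Lemma set_inhabited : inhabited M.
Proof. by case: (zfc_infinity M (zfc_ax M)) => w _; constructor. Qed.

Definition junk : M := epsilon set_inhabited (fun _ => True).

Lemma description_ex : exists t : (M -> Prop) -> M, forall P,
  unique P (t P) \/ (~ (exists! y, P y)) /\ t P = junk.
Proof.
  exists (fun P => epsilon set_inhabited
    (fun x => (unique P x) \/ (~ (exists! y, P y)) /\ x = junk)) => P.
  apply: (epsilon_spec set_inhabited
    (fun x => (unique P x) \/ (~ (exists! y, P y)) /\ x = junk)).
  case: (classic (exists! y, P y)) => [[x H]|H]; first by exists x; left.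
  by exists junk; right.
Qed.

(* Kept opaque: unfolding nested descriptions makes conversion tests explode. *)
Definition description : {t : (M -> Prop) -> M | forall P,
  unique P (t P) \/ (~ (exists! y, P y)) /\ t P = junk}.
Proof. exact: constructive_indefinite_description description_ex. Qed.

Definition the (P : M -> Prop) : M := proj1_sig description P.

Lemma the_cases (P : M -> Prop) :
  unique P (the P) \/ (~ (exists! y, P y)) /\ the P = junk.
Proof. exact: (proj2_sig description P). Qed.

Lemma the_spec (P : M -> Prop) : (exists! x, P x) -> P (the P).
Proof. by move=> H; case: (the_cases P) => [[]|[]]. Qed.

Lemma the_eq (P : M -> Prop) x : P x -> (forall y, P y -> x = y) -> the P = x.
Proof.
  move=> Hx Hu; symmetry; apply: (Hu); apply: the_spec; exists x; by split.
Qed.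

(** The graph stays definable where the description fails, because the value is then the constant
    [junk]. *)
Lemma def_the (P : M -> (nat -> M) -> Prop) :
  Def (fun e => P (e 0) (fun i => e (S i))) -> DefT (fun e => the (fun x => P x e)).
Proof.
  move=> HP; rewrite /DefT.
  set P1 := fun e : nat -> M => P (e 0) (fun i => e (S i)) in HP.
  have HP2 : Def (fun e => P (e 1) (fun i => e (S (S i)))).
    exact: (def_ren (fun i => S i) HP).
  have HP3 : Def (fun e => P (e 0) (fun i => e (S (S i)))).
    exact: (def_ren skip1 HP).
  have HP4 : Def (fun e => P (e 0) (fun i => e (S (S (S i))))).
    exact: (def_ren (fun i => match i with 0 => 0 | S j => S (S (S j)) end) HP).
  have HP5 : Def (fun e => P (e 1) (fun i => e (S (S (S i))))).
    exact: (def_ren (fun i => match i with 0 => 1 | S j => S (S (S j)) end) HP).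
  have Hu0 : Def (fun e => unique (fun x => P x (fun i => e (S i))) (e 0)).
    apply: def_and => //; apply: def_all; apply: def_imp => //.
    by apply: def_eq; apply: def_var.
  have Hu1 : Def (fun e => exists y, unique (fun x => P x (fun i => e (S i))) y).
    apply: def_ex; apply: def_and => //; apply: def_all; apply: def_imp => //.
    by apply: def_eq; apply: def_var.
  apply: (def_ext (P := fun e => unique (fun x => P x (fun i => e (S i))) (e 0) \/
    ~ (exists y, unique (fun x => P x (fun i => e (S i))) y) /\ e 0 = junk)) => [e|].
  { have := the_cases (fun x => P x (fun i => e (S i))).
    set T := the _ => HT; split.
    - move=> [[H1 H2]|[H1 E]]; case: HT => [[H3 H4]|[H3 E']].
      + exact: H2.
      + by case: H3; exists (e 0).
      + by case: H1; exists T.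
      + by rewrite E E'.
    - by move=> ->. }
  exact (def_or Hu0 (def_and (def_not Hu1)
    (def_eq (def_var 0) (def_const junk)))).
Qed.

End Description.

#[global] Opaque junk the.

(** Compound operations are wrapped in [locked] to keep conversion from unfolding them; definability
    passes through the wrapper. *)
Lemma def_locked {M : set_structure} (t : (nat -> M) -> M) :
  DefT t -> DefT (fun e => locked (t e)).
Proof.
  by move=> H; have -> : (fun e => locked (t e)) = t
    by apply: functional_extensionality => e; rewrite -lock.
Qed.

(** A hook for operations that take Rocq predicates or functions as arguments; it is redefined as
    such operations appear. *)
Ltac sd_ho := fail.

(* In a pattern [?F (@?t1 e)] the metavariable [t1] may also match the structure
   argument of [F]; [is_arg] rejects this. *)
Ltac is_arg t :=
  let T := type of t in lazymatch T with (nat -> carrier _) -> carrier _ => idtac end.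

Ltac sd :=
  cbv beta;
  lazymatch goal with
  | |- DefT (fun _ => ?c) => exact (def_const c)
  | |- DefT (fun e => e ?n) => exact (def_var n)
  | |- DefT (fun e => the _) => apply def_the; sd
  | |- DefT (fun e => locked _) => apply def_locked; sd
  | |- DefT _ => first [ sd_ho | sd_fun3 ]
  | |- Def (fun _ => ?P) => exact (def_constP P)
  | |- Def (fun e => _ /\ _) => apply def_and; sd
  | |- Def (fun e => _ \/ _) => apply def_or; sd
  | |- Def (fun e => ~ _) => apply def_not; sd
  | |- Def (fun e => _ <-> _) => apply def_iff; sd
  | |- Def (fun e => forall x : carrier _, _) => apply def_all; sd
  | |- Def (fun e => _ -> _) => apply def_imp; sd
  | |- Def (fun e => unique _ _) => unfold unique; sd
  | |- Def (fun e => ex (unique _)) => apply def_exu; sd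
  | |- Def (fun e => exists x, _) => apply def_ex; sd
  | |- Def (fun e => _ = _) => apply def_eq; sd
  | |- Def (fun e => _ ∈ _) => apply def_mem; sd
  | |- Def _ => first [ sd_ho | sd_rel5 ]
  | |- Rel1 ?R => unfold Rel1; sd
  | |- Rel2 ?R => unfold Rel2; sd
  | |- Rel3 ?R => unfold Rel3; sd
  | |- Rel5 ?R => unfold Rel5; sd
  | |- Fun1 ?R => apply def_funct1; sd
  | |- Fun2 ?R => apply def_funct2; sd
  | |- Fun3 ?R => apply def_funct3; sd
  end
with sd_rel5 :=
  lazymatch goal with
  | |- Def (fun e => ?F (@?t1 e) (@?t2 e) (@?t3 e) (@?t4 e) (@?t5 e)) =>
      tryif is_arg t1 then (apply (def_rel5 F t1 t2 t3 t4 t5); sd) else sd_rel3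
  | |- _ => sd_rel3
  end
with sd_rel3 :=
  lazymatch goal with
  | |- Def (fun e => ?F (@?t1 e) (@?t2 e) (@?t3 e)) =>
      tryif is_arg t1 then (apply (def_rel3 F t1 t2 t3); sd) else sd_rel2
  | |- _ => sd_rel2
  end
with sd_rel2 :=
  lazymatch goal with
  | |- Def (fun e => ?F (@?t1 e) (@?t2 e)) =>
      tryif is_arg t1 then (apply (def_rel2 F t1 t2); sd) else sd_rel1
  | |- _ => sd_rel1
  end
with sd_rel1 :=
  lazymatch goal with
  | |- Def (fun e => ?F (@?t1 e)) =>
      tryif is_arg t1 then (apply (def_rel1 F t1); sd) else fail
  end
with sd_fun3 :=
  lazymatch goal with
  | |- DefT (fun e => ?F (@?t1 e) (@?t2 e) (@?t3 e)) =>
      tryif is_arg t1 then (apply (def_fun3 F t1 t2 t3); sd) else sd_fun2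
  | |- _ => sd_fun2
  end
with sd_fun2 :=
  lazymatch goal with
  | |- DefT (fun e => ?F (@?t1 e) (@?t2 e)) =>
      tryif is_arg t1 then (apply (def_fun2 F t1 t2); sd) else sd_fun1
  | |- _ => sd_fun1
  end
with sd_fun1 :=
  lazymatch goal with
  | |- DefT (fun e => ?F (@?t1 e)) =>
      tryif is_arg t1 then (apply (def_fun1 F t1); sd) else fail
  end.

#[global] Hint Extern 0 (Def _) => sd : typeclass_instances.
#[global] Hint Extern 0 (DefT _) => sd : typeclass_instances.

#[global] Hint Extern 0 (Rel1 (fun x => _)) => sd : typeclass_instances.
#[global] Hint Extern 0 (Fun1 (fun x => _)) => sd : typeclass_instances.
#[global] Hint Extern 0 (Rel2 (fun x => _)) => sd : typeclass_instances.
#[global] Hint Extern 0 (Fun2 (fun x => _)) => sd : typeclass_instances.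
#[global] Hint Extern 0 (Rel3 (fun x => _)) => sd : typeclass_instances.
#[global] Hint Extern 0 (Fun3 (fun x => _)) => sd : typeclass_instances.
Ltac sd_partial c :=
  let T := type of c in lazymatch T with carrier _ => sd end.
#[global] Hint Extern 1 (Rel1 (?R ?c)) => sd_partial c : typeclass_instances.
#[global] Hint Extern 1 (Fun1 (?F ?c)) => sd_partial c : typeclass_instances.
#[global] Hint Extern 1 (Rel2 (?R ?c)) => sd_partial c : typeclass_instances.
#[global] Hint Extern 1 (Fun2 (?F ?c)) => sd_partial c : typeclass_instances.
#[global] Hint Extern 1 (Rel3 (?R ?c)) => sd_partial c : typeclass_instances.
#[global] Hint Extern 1 (Fun3 (?F ?c)) => sd_partial c : typeclass_instances.

(** * Basic constructions *)

Section Basic.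
Context {M : zfc_model}.

#[global] Instance rel_subset : Rel2 (@subset M).
Proof. rewrite /subset; sd. Qed.

Lemma ext (x y : M) : (forall z, z ∈ x <-> z ∈ y) -> x = y.
Proof. exact: (zfc_extensionality _ (zfc_ax M)). Qed.

Lemma sub_antisym (x y : M) : x ⊆ y -> y ⊆ x -> x = y.
Proof. by move=> H H'; apply: ext => z; split; [apply: H|apply: H']. Qed.

Lemma the_set (P : M -> Prop) : (exists b : M, forall z, z ∈ b <-> P z) ->
  forall z, z ∈ the (fun b : M => forall z, z ∈ b <-> P z) <-> P z.
Proof.
  move=> [b Hb].
  apply: (the_spec (P := fun b => forall z, z ∈ b <-> P z)).
  by exists b; split=> // c Hc; apply: ext => z; rewrite Hb Hc.
Qed.

Definition sep (A : M) (P : M -> Prop) : M :=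
  the (fun b => forall z, z ∈ b <-> z ∈ A /\ P z).

Lemma sepE (A : M) (P : M -> Prop) `{!Rel1 P} (z : M) : z ∈ sep A P <-> z ∈ A /\ P z.
Proof.
  apply: (the_set (P := fun z => z ∈ A /\ P z)).
  have [f [s Hf]] : Def (fun e : nat -> M => P (e 0)) by [].
  (* All environment positions are made equal to the separated element, so every variable that is
     not a parameter becomes the bound one; the parameters are supplied by the new environment. *)
  have [b Hb] := zfc_separation M (zfc_ax M)
    (ren (fun i => match s i with inl _ => 0 | _ => S i end) f)
    (fun i => match s i with inl _ => A | inr c => c end) A.
  exists b => x; rewrite Hb sat_ren (Hf (fun _ => x)).
  have -> : (fun i => scons x (fun i => match s i with inl _ => A | inr c => c end)
    (match s i with inl _ => 0 | _ => S i end)) = val s (fun _ => x); last by [].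
  apply: functional_extensionality => i; rewrite /val.
  by case E : (s i) => [j|c] //=; rewrite E.
Qed.

Lemma def_sep (A : (nat -> M) -> M) (P : M -> (nat -> M) -> Prop) :
  DefT A -> Def (fun e => P (e 0) (fun i => e (S i))) ->
  DefT (fun e => sep (A e) (fun x => P x e)).
Proof.
  move=> HA HP; rewrite /sep; apply: def_the; apply: def_all; cbv beta; apply: def_iff.
  apply: def_and.
  - apply: def_mem.
    exact: (def_ren (fun i => match i with 0 => 0 | S j => S (S (S j)) end) HA).
  - exact: (def_ren skip1 HP).
Qed.

Definition union (x : M) : M := the (fun u => forall z, z ∈ u <-> exists y, y ∈ x /\ z ∈ y).
#[global] Instance fun_union : Fun1 union.
Proof. rewrite /union; sd. Qed.
Lemma unionE (x z : M) : z ∈ union x <-> exists y, y ∈ x /\ z ∈ y.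
Proof.
  by apply: (the_set (P := fun z => exists y, y ∈ x /\ z ∈ y)); apply: (zfc_union _ (zfc_ax M)).
Qed.

Lemma def_repl (A : (nat -> M) -> M) (F : M -> (nat -> M) -> M) :
  DefT A -> DefT (fun e => F (e 0) (fun i => e (S i))) ->
  DefT (fun e => the (fun b : M => forall z, z ∈ b <-> exists x, x ∈ A e /\ z = F x e)).
Proof.
  move=> HA HF; apply: def_the; apply: def_all; cbv beta; apply: def_iff.
  apply: def_ex; apply: def_and.
  - apply: def_mem.
    exact: (def_ren (fun i => match i with 0 => 0 | S j => S (S (S (S j))) end) HA).
  - exact: (def_ren (fun i => match i with 0 => 1 | 1 => 0 | S (S j) => S (S (S j)) end) HF).
Qed.

Definition repl (A : M) (F : M -> M) : M :=
  the (fun b => forall z, z ∈ b <-> exists x, x ∈ A /\ z = F x).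

Lemma replE (A : M) (F : M -> M) `{HF : !Fun1 F} (z : M) :
  z ∈ repl A F <-> exists x, x ∈ A /\ z = F x.
Proof.
  apply: (the_set (P := fun z => exists x, x ∈ A /\ z = F x)).
  have [f [s Hf]] : Def (fun e : nat -> M => e 0 = F (e 1)) by [].
  (* Position 0 stands for the value, all later positions for the argument of [F]. *)
  pose r i := match s i with inl 0 => 0 | inl _ => 1 | _ => S (S i) end.
  pose p i := match s i with inl _ => A | inr c => c end.
  have E y x : sat (scons y (scons x p)) (ren r f) <-> y = F x.
  { rewrite sat_ren (Hf (scons y (fun _ => x))).
    have -> : (fun i => scons y (scons x p) (r i)) = val s (scons y (fun _ => x)); last by [].
    apply: functional_extensionality => i; rewrite /val /r.
    by case Ei : (s i) => [[|j]|c] //=; rewrite /p Ei. }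
  have [|b Hb] := zfc_replacement M (zfc_ax M) (ren r f) p A.
  { by move=> x Hx y y' /E -> /E ->. }
  exists b => y; rewrite Hb.
  by split=> -[x [Hx /E H]]; exists x.
Qed.

Definition emp : M := the (fun b => forall z, z ∈ b <-> False).
Lemma empE (z : M) : ~ z ∈ emp.
Proof.
  suff /(_ z) -> : forall z, z ∈ emp <-> False by [].
  apply: (the_set (P := fun _ => False)).
  exists (sep junk (fun _ => False)) => x; rewrite sepE; tauto.
Qed.

Definition upair (x y : M) : M := the (fun b => forall z, z ∈ b <-> z = x \/ z = y).
#[global] Instance fun_upair : Fun2 upair.
Proof. rewrite /upair; sd. Qed.
Lemma upairE (x y z : M) : z ∈ upair x y <-> z = x \/ z = y.
Proof.
  apply: (the_set (P := fun z => z = x \/ z = y)).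
  by have [p H] := zfc_pairing M (zfc_ax M) x y; exists p.
Qed.

Definition sing (x : M) : M := locked (upair x x).
#[global] Instance fun_sing : Fun1 sing.
Proof. rewrite /sing; sd. Qed.
Lemma singE (x z : M) : z ∈ sing x <-> z = x.
Proof. rewrite /sing -lock upairE; tauto. Qed.

Definition cup (x y : M) : M := locked (union (upair x y)).
#[global] Instance fun_cup : Fun2 cup.
Proof. rewrite /cup; sd. Qed.
Lemma cupE (x y z : M) : z ∈ cup x y <-> z ∈ x \/ z ∈ y.
Proof.
  rewrite /cup -lock unionE; split.
  - by move=> [w [/upairE [->|->]]]; [left|right].
  - by case=> H; [exists x|exists y]; split=> //; apply/upairE; [left|right].
Qed.

Definition succ (x : M) : M := locked (cup x (sing x)).
#[global] Instance fun_succ : Fun1 succ.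
Proof. rewrite /succ; sd. Qed.
Lemma succE (x z : M) : z ∈ succ x <-> z ∈ x \/ z = x.
Proof. by rewrite /succ -lock cupE singE. Qed.

Definition pow (x : M) : M := the (fun b => forall z, z ∈ b <-> z ⊆ x).
#[global] Instance fun_pow : Fun1 pow.
Proof. rewrite /pow; sd. Qed.
Lemma powE (x z : M) : z ∈ pow x <-> z ⊆ x.
Proof.
  by apply: (the_set (P := fun z => z ⊆ x)); have [p H] := zfc_powerset M (zfc_ax M) x; exists p.
Qed.

Definition pair (x y : M) : M := locked (upair (sing x) (upair x y)).
#[global] Instance fun_pair : Fun2 pair.
Proof. rewrite /pair; sd. Qed.

Lemma pairE (x y z : M) : z ∈ pair x y <-> z = sing x \/ z = upair x y.
Proof. by rewrite /pair -lock upairE. Qed.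

Lemma is_upairE (x y p : M) : is_upair x y p <-> p = upair x y.
Proof.
  split=> [H|->]; last by move=> z; rewrite upairE.
  by apply: ext => z; rewrite upairE; apply: H.
Qed.
Lemma is_pairE (x y p : M) : is_pair x y p <-> p = pair x y.
Proof.
  split=> [H|->].
  - by apply: ext => z; rewrite pairE (H z) !is_upairE /sing -lock.
  - by move=> z; rewrite pairE !is_upairE /sing -lock.
Qed.

Lemma upair_inj (x y x' y' : M) : upair x y = upair x' y' ->
  (x = x' /\ y = y') \/ (x = y' /\ y = x').
Proof.
  move=> E.
  have : x ∈ upair x' y' by rewrite -E upairE; left.
  have : y ∈ upair x' y' by rewrite -E upairE; right.
  have : x' ∈ upair x y by rewrite E upairE; left.
  have : y' ∈ upair x y by rewrite E upairE; right.
  rewrite !upairE; intuition congruence.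
Qed.
Lemma pair_inj (x y x' y' : M) : pair x y = pair x' y' -> x = x' /\ y = y'.
Proof.
  rewrite /pair /sing -!lock.
  move/upair_inj => [[/upair_inj H1 /upair_inj H2]|[/upair_inj H1 /upair_inj H2]];
  intuition congruence.
Qed.

Definition fst (p : M) : M := the (fun x => exists y, p = pair x y).
#[global] Instance fun_fst : Fun1 fst.
Proof. rewrite /fst; sd. Qed.
Definition snd (p : M) : M := the (fun y => exists x, p = pair x y).
#[global] Instance fun_snd : Fun1 snd.
Proof. rewrite /snd; sd. Qed.
Lemma fst_pair (x y : M) : fst (pair x y) = x.
Proof. by apply: the_eq; [exists y|move=> z [w /pair_inj []]]. Qed.
Lemma snd_pair (x y : M) : snd (pair x y) = y.
Proof. by apply: the_eq; [exists x|move=> z [w /pair_inj []]]. Qed.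

Definition prod (A B : M) : M :=
  locked (sep (pow (pow (cup A B)))
    (fun p => exists x, x ∈ A /\ exists y, y ∈ B /\ p = pair x y)).
Lemma prodE (A B p : M) : p ∈ prod A B <-> exists x, x ∈ A /\ exists y, y ∈ B /\ p = pair x y.
Proof.
  rewrite /prod -lock sepE; split=> [[] //|H]; split=> //.
  case: H => x [Hx [y [Hy ->]]]; apply/powE => z /pairE [->|->]; apply/powE => w.
  - by move/singE => ->; apply/cupE; left.
  - by move/upairE => [->|->]; apply/cupE; [left|right].
Qed.
Lemma pair_prod (A B x y : M) : pair x y ∈ prod A B <-> x ∈ A /\ y ∈ B.
Proof.
  rewrite prodE; split=> [[x' [Hx [y' [Hy /pair_inj [-> ->]]]]] //|[Hx Hy]].
  by exists x; split=> //; exists y.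
Qed.

Definition lam (A : M) (F : M -> M) : M := locked (repl A (fun x => pair x (F x))).
Definition ap (f x : M) : M := the (fun y => pair x y ∈ f).
#[global] Instance fun_ap : Fun2 ap.
Proof. rewrite /ap; sd. Qed.

Lemma def_lam (A : (nat -> M) -> M) (F : M -> (nat -> M) -> M) :
  DefT A -> DefT (fun e => F (e 0) (fun i => e (S i))) ->
  DefT (fun e => lam (A e) (fun x => F x e)).
Proof.
  move=> HA HF; apply: def_locked; apply: (def_repl (F := fun x e => pair x (F x e))).
  exact (def_fun2 pair _ _ (def_var 0) HF).
Qed.

Lemma lamE (A : M) (F : M -> M) `{HF : !Fun1 F} (p : M) :
  p ∈ lam A F <-> exists x, x ∈ A /\ p = pair x (F x).
Proof. by rewrite /lam -lock replE. Qed.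
Lemma pair_lam (A : M) (F : M -> M) `{HF : !Fun1 F} (x y : M) :
  pair x y ∈ lam A F <-> x ∈ A /\ y = F x.
Proof.
  rewrite lamE; split=> [[x' [Hx /pair_inj [-> ->]]] //|[Hx ->]].
  by exists x.
Qed.
Lemma ap_lam (A : M) (F : M -> M) `{HF : !Fun1 F} (x : M) : x ∈ A -> ap (lam A F) x = F x.
Proof. by move=> Hx; apply: the_eq => [|y]; rewrite pair_lam // => -[]. Qed.

Definition ite (P : Prop) (a b : M) : M := the (fun y => (P /\ y = a) \/ (~ P /\ y = b)).
Lemma iteT (P : Prop) (a b : M) : P -> ite P a b = a.
Proof. by move=> H; apply: the_eq; [tauto|move=> y [[]|[]] //]. Qed.
Lemma iteF (P : Prop) (a b : M) : ~ P -> ite P a b = b.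
Proof. by move=> H; apply: the_eq; [tauto|move=> y [[]|[]] //]. Qed.
Lemma def_ite P (a b : (nat -> M) -> M) : Def P -> DefT a -> DefT b ->
  DefT (fun e => ite (P e) (a e) (b e)).
Proof.
  move=> HP Ha Hb; rewrite /ite; apply: def_the.
  have HP' := def_ren S HP.
  have Ha' := def_ren skip1 Ha.
  exact (def_or (def_and HP' Ha) (def_and (def_not HP') Hb)).
Qed.

Definition bigcup (A : M) (F : M -> M) : M := locked (union (repl A F)).
Lemma bigcupE (A : M) (F : M -> M) `{HF : !Fun1 F} (z : M) :
  z ∈ bigcup A F <-> exists x, x ∈ A /\ z ∈ F x.
Proof.
  rewrite /bigcup -lock unionE; split.
  - by move=> [y [/replE [x [Hx ->]] Hz]]; exists x.
  - by move=> [x [Hx Hz]]; exists (F x); split=> //; apply/replE; exists x.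
Qed.
Lemma def_bigcup (A : (nat -> M) -> M) (F : M -> (nat -> M) -> M) :
  DefT A -> DefT (fun e => F (e 0) (fun i => e (S i))) ->
  DefT (fun e => bigcup (A e) (fun x => F x e)).
Proof. move=> HA HF; apply: def_locked; exact (def_fun1 union _ (def_repl HA HF)). Qed.
End Basic.

Ltac sd_sets := lazymatch goal with
  | |- DefT (fun e => sep _ _) => apply def_sep; sd
  | |- DefT (fun e => repl _ _) => apply def_repl; sd
  | |- DefT (fun e => lam _ _) => apply def_lam; sd
  | |- DefT (fun e => bigcup _ _) => apply def_bigcup; sd
  | |- DefT (fun e => ite _ _ _) => apply def_ite; sd
  end.
Ltac sd_ho ::= sd_sets.

(** * Functions and choice *)

Section Functions.
Context {M : zfc_model}.

#[global] Instance fun_prod : Fun2 (@prod M).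
Proof. rewrite /prod; sd. Qed.
#[global] Instance rel_is_empty : Rel1 (@is_empty M).
Proof. rewrite /is_empty; sd. Qed.
#[global] Instance rel_is_upair : Rel3 (@is_upair M).
Proof. rewrite /is_upair; sd. Qed.
#[global] Instance rel_is_pair : Rel3 (@is_pair M).
Proof. rewrite /is_pair; sd. Qed.
#[global] Instance rel_app : Rel3 (@app M).
Proof. rewrite /app; sd. Qed.
#[global] Instance rel_is_function : Rel3 (@is_function M).
Proof. rewrite /is_function; sd. Qed.
#[global] Instance rel_is_injection : Rel3 (@is_injection M).
Proof. rewrite /is_injection; sd. Qed.
#[global] Instance rel_is_bijection : Rel3 (@is_bijection M).
Proof. rewrite /is_bijection; sd. Qed.
#[global] Instance rel_transitive : Rel1 (@transitive M).
Proof. rewrite /transitive; sd. Qed.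
#[global] Instance rel_ordinal : Rel1 (@ordinal M).
Proof. rewrite /ordinal; sd. Qed.
#[global] Instance rel_limit_ordinal : Rel1 (@limit_ordinal M).
Proof. rewrite /limit_ordinal; sd. Qed.
#[global] Instance rel_is_omega : Rel1 (@is_omega M).
Proof. rewrite /is_omega; sd. Qed.
#[global] Instance rel_equinumerous : Rel2 (@equinumerous M).
Proof. rewrite /equinumerous; sd. Qed.
#[global] Instance rel_cardinal : Rel1 (@cardinal M).
Proof. rewrite /cardinal; sd. Qed.
#[global] Instance rel_is_cardinality : Rel2 (@is_cardinality M).
Proof. rewrite /is_cardinality; sd. Qed.
#[global] Instance rel_card_lt : Rel2 (@card_lt M).
Proof. rewrite /card_lt; sd. Qed.
#[global] Instance rel_is_complement : Rel3 (@is_complement M).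
Proof. rewrite /is_complement; sd. Qed.
#[global] Instance rel_ultrafilter : Rel2 (@ultrafilter M).
Proof. rewrite /ultrafilter; sd. Qed.
#[global] Instance rel_nonprincipal : Rel2 (@nonprincipal M).
Proof. rewrite /nonprincipal; sd. Qed.
#[global] Instance rel_complete : Rel2 (@complete M).
Proof. rewrite /complete; sd. Qed.
#[global] Instance rel_measurable : Rel1 (@measurable M).
Proof. rewrite /measurable; sd. Qed.

Lemma appE (f x y : M) : app f x y <-> pair x y ∈ f.
Proof.
  split=> [[p [/is_pairE -> //]]|H].
  by exists (pair x y); split=> //; apply/is_pairE.
Qed.

Lemma fn_lam (A B : M) (F : M -> M) `{HF : !Fun1 F} :
  (forall x, x ∈ A -> F x ∈ B) -> is_function (lam A F) A B.
Proof.
  move=> H; split=> [p /lamE [x [Hx ->]]|x Hx].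
  - by exists x, (F x); split=> //; split; [apply: H|apply/is_pairE].
  - by exists (F x); split=> [|y]; rewrite appE pair_lam // => -[].
Qed.

Lemma fn_app (f A B : M) : is_function f A B -> forall x y, (app f x y <-> x ∈ A /\ y = ap f x).
Proof.
  move=> [H1 H2] x y; rewrite appE; split.
  - move=> H; have [x' [y' [Hx [Hy /is_pairE /pair_inj [E E']]]]] := H1 _ H.
    subst x' y'; split=> //; symmetry; apply: the_eq => // z.
    have [w [_ Hw]] := H2 _ Hx; move: (Hw y); rewrite !appE => <- // Hz.
    by apply: Hw; apply/appE.
  - move=> [Hx ->]; have [w [Hw Hu]] := H2 _ Hx.
    have -> : ap f x = w by apply: the_eq => [|z /appE Hz]; [apply/appE|apply: Hu].
    by apply/appE.
Qed.

Lemma fn_val (f A B x : M) : is_function f A B -> x ∈ A -> ap f x ∈ B.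
Proof.
  move=> Hf Hx; have : app f x (ap f x) by apply/(fn_app Hf).
  move/appE => H; have [H1 _] := Hf.
  by have [x' [y' [_ [Hy /is_pairE /pair_inj [_ ->]]]]] := H1 _ H.
Qed.

Lemma fn_eta (f A B : M) : is_function f A B -> f = lam A (fun x => ap f x).
Proof.
  move=> Hf; apply: ext => p; split.
  - move=> Hp; have [H1 _] := Hf; have [x [y [Hx [Hy /is_pairE E]]]] := H1 _ Hp.
    rewrite E pair_lam -(fn_app Hf) appE -E; exact: Hp.
  - move/lamE => [x [Hx ->]]; apply/appE; by rewrite (fn_app Hf).
Qed.

Lemma fn_sub (f A B C : M) :
  is_function f A B -> (forall x, x ∈ A -> ap f x ∈ C) -> is_function f A C.
Proof. by move=> Hf H; rewrite (fn_eta Hf); apply: fn_lam. Qed.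

Lemma lam_ext (A : M) (F G : M -> M) `{!Fun1 F} `{!Fun1 G} :
  (forall x, x ∈ A -> F x = G x) -> lam A F = lam A G.
Proof.
  move=> H; apply: ext => p; rewrite !lamE.
  by split=> -[x [Hx ->]]; exists x; rewrite H.
Qed.

Lemma fn_ext (f g A B C : M) : is_function f A B -> is_function g A C ->
  (forall x, x ∈ A -> ap f x = ap g x) -> f = g.
Proof.
  by move=> Hf Hg H; rewrite (fn_eta Hf) (fn_eta Hg); apply: lam_ext.
Qed.

Definition funs (A B : M) : M :=
  locked (sep (pow (prod A B)) (fun f => is_function f A B)).
#[global] Instance fun_funs : Fun2 funs.
Proof. rewrite /funs; sd. Qed.
Lemma funsE (A B f : M) : f ∈ funs A B <-> is_function f A B.
Proof.
  rewrite /funs -lock sepE; split=> [[] //|H]; split=> //; apply/powE => p Hp.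
  have [H1 _] := H; have [x [y [Hx [Hy /is_pairE ->]]]] := H1 _ Hp.
  by apply/pair_prod.
Qed.

Lemma inj_fn (f A B : M) : is_injection f A B <-> is_function f A B /\
  (forall x y, x ∈ A -> y ∈ A -> ap f x = ap f y -> x = y).
Proof.
  split=> -[Hf H]; split=> //.
  - move=> x y Hx Hy E; apply: (H x y (ap f x)); rewrite (fn_app Hf) //.
  - by move=> x y z; rewrite !(fn_app Hf) => -[Hx ->] [Hy E]; apply: H.
Qed.
Lemma bij_fn (f A B : M) : is_bijection f A B <-> is_injection f A B /\
  (forall y, y ∈ B -> exists x, x ∈ A /\ ap f x = y).
Proof.
  split=> -[Hf H]; split=> // y /H [x Hx]; exists x; move: Hx;
  have [Hf' _] := Hf; rewrite (fn_app Hf'); intuition.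
Qed.

(* The choice axiom is about disjoint families, hence the detour through {x} × x. *)
Lemma choice_fn (A : M) : exists c, forall x, x ∈ A -> (exists z, z ∈ x) -> ap c x ∈ x.
Proof.
  pose (A' := sep A (fun x => exists z, z ∈ x)).
  have [||c Hc] := zfc_choice M (zfc_ax M) (repl A' (fun x => prod (sing x) x)).
  { move=> y /replE [x [/sepE [Hx [z Hz]] ->]] H.
    by apply: (H (pair x z)); apply/pair_prod; rewrite singE. }
  { move=> y y' p /replE [x [Hx ->]] /replE [x' [Hx' ->]].
    by move=> /prodE [u [/singE -> [v [Hv ->]]]] /pair_prod [/singE -> _]. }
  pose (c' := sep c (fun p => exists x, x ∈ A /\ p ∈ prod (sing x) x)).
  exists c' => x Hx Hz.
  have [|p [[Hp Hpc] Hu]] := Hc (prod (sing x) x).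
  { by apply/replE; exists x; split=> //; apply/sepE. }
  have [u [/singE Eu [v [Hv E]]]] := proj1 (prodE _ _ _) Hp; subst u p.
  have -> // : ap c' x = v.
  apply: the_eq => [|w /sepE [Hw [x' [Hx' Hxw]]]].
  { by apply/sepE; split=> //; exists x. }
  have [/singE E Hw'] := proj1 (pair_prod _ _ _ _) Hxw; subst x'.
  by have /pair_inj [] : pair x v = pair x w by apply: Hu.
Qed.

Lemma choice_rel (A B : M) (R : M -> M -> Prop) `{!Rel2 R} :
  (forall x, x ∈ A -> exists y, y ∈ B /\ R x y) ->
  exists f, is_function f A B /\ forall x, x ∈ A -> R x (ap f x).
Proof.
  move=> H; have [c Hc] := choice_fn (pow B).
  have Hs x : x ∈ A -> ap c (sep B (fun y => R x y)) ∈ sep B (fun y => R x y).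
  { move=> Hx; apply: Hc; first by apply/powE => y /sepE [].
    by have [y [Hy HR]] := H _ Hx; exists y; apply/sepE. }
  exists (lam A (fun x => ap c (sep B (fun y => R x y)))); split.
  - by apply: fn_lam => x /Hs /sepE [].
  - by move=> x Hx; rewrite ap_lam //; have /sepE [] := Hs _ Hx.
Qed.

Definition ran (f : M) : M :=
  locked (sep (union (union f)) (fun y => exists x, pair x y ∈ f)).
#[global] Instance fun_ran : Fun1 ran.
Proof. rewrite /ran; sd. Qed.
Lemma ranE (f y : M) : y ∈ ran f <-> exists x, pair x y ∈ f.
Proof.
  rewrite /ran -lock sepE; split=> [[] //|[x Hx]]; split; last by exists x.
  apply/unionE; exists (upair x y); split; last by apply/upairE; right.
  by apply/unionE; exists (pair x y); split=> //; apply/pairE; right.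
Qed.
Lemma ran_lam (A : M) (F : M -> M) `{!Fun1 F} (y : M) :
  y ∈ ran (lam A F) <-> exists x, x ∈ A /\ y = F x.
Proof. by rewrite ranE; split=> -[x]; [rewrite pair_lam|]; move=> H; exists x; rewrite ?pair_lam. Qed.

End Functions.

(** * Well-founded recursion and ordinals *)

Section Recursion.
Context {M : zfc_model}.

Definition wf (A : M) (R : M -> M -> Prop) : Prop :=
  forall S : M, S ⊆ A -> (exists x, x ∈ S) -> exists x, x ∈ S /\ forall y, y ∈ S -> ~ R y x.

Lemma wf_ind (A : M) (R : M -> M -> Prop) (P : M -> Prop) `{!Rel1 P} : wf A R ->
  (forall x, x ∈ A -> (forall y, y ∈ A -> R y x -> P y) -> P x) ->
  forall x, x ∈ A -> P x.
Proof.
  move=> HR H x Hx; apply: NNPP => HP.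
  have [| |z [/sepE [Hz Hz'] Hmin]] := HR (sep A (fun x => ~ P x)).
  - by move=> z /sepE [].
  - by exists x; apply/sepE.
  - apply: (Hz'); apply: H => // y Hy HRy; apply: NNPP => Hy'.
    by apply: (Hmin y) => //; apply/sepE.
Qed.

Definition below (A : M) (R : M -> M -> Prop) (x : M) : M := sep A (fun y => R y x).

(** The first conjunct removes everything from [F] except its graph on [A]; without it the solution
    would not be unique as a set. *)
Definition wfrec (A : M) (R : M -> M -> Prop) (G : M -> M -> M) : M :=
  the (fun F => F = lam A (fun x => ap F x) /\
    forall x, x ∈ A -> ap F x = G (lam (below A R x) (fun y => ap F y)) x).

Section Existence.
Variables (A : M) (R : M -> M -> Prop) (G : M -> M -> M).
Context `{HR : !Rel2 R} `{HG : !Fun2 G}.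
Hypothesis Hwf : wf A R.

Let step (h x : M) : M := G (lam (below A R x) (fun y => ap h y)) x.
Local Instance fun_step : Fun2 step.
Proof. rewrite /step /below; sd. Qed.

Lemma step_ext (h h' x : M) : (forall y, y ∈ A -> R y x -> ap h y = ap h' y) -> step h x = step h' x.
Proof.
  move=> H; rewrite /step; congr (G _ x); apply: lam_ext => y /sepE []; exact: H.
Qed.

(** An attempt at the recursion: correct on a part [B] of [A] that is closed under predecessors. *)
Let att (B h : M) : Prop := B ⊆ A /\ (forall x y, x ∈ B -> y ∈ A -> R y x -> y ∈ B) /\
  (forall x, x ∈ B -> ap h x = step h x).
Local Instance rel_att : Rel2 att.
Proof. rewrite /att; sd. Qed.

Lemma att_unique (B h B' h' x : M) : att B h -> att B' h' -> x ∈ B -> x ∈ B' -> ap h x = ap h' x.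
Proof.
  move=> [HBA [HB1 HB2]] [_ [HB1' HB2']] Hx0; move: (HBA _ Hx0) (Hx0); move: x {Hx0}.
  apply: (wf_ind (R := R) (P := fun x => x ∈ B -> x ∈ B' -> ap h x = ap h' x)) => //.
  move=> z Hz IH Hz1 Hz2; rewrite HB2 // HB2' //; apply: step_ext => y Hy HRy.
  by apply: IH => //; [apply: (HB1 z)|apply: (HB1' z)].
Qed.

Let dom : M := sep A (fun x => exists B h, att B h /\ x ∈ B).
Let sol (x : M) : M := the (fun v => exists B h, att B h /\ x ∈ B /\ v = ap h x).
Local Instance fun_sol : Fun1 sol.
Proof. rewrite /sol; sd. Qed.

Lemma sol_att (B h x : M) : att B h -> x ∈ B -> sol x = ap h x.
Proof.
  move=> HB Hx; apply: the_eq; first by exists B, h.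
  by move=> v [B' [h' [HB' [Hx' ->]]]]; apply: (att_unique HB HB').
Qed.

Lemma att_dom : att dom (lam A sol).
Proof.
  split; first by move=> x /sepE [].
  split.
  - move=> x y /sepE [Hx [B [h [HB HxB]]]] Hy HRy; apply/sepE; split=> //.
    by exists B, h; split=> //; have [_ [H _]] := HB; apply: (H x).
  - move=> x /sepE [Hx [B [h [HB HxB]]]]; rewrite ap_lam // (sol_att HB HxB).
    have [_ [H1 H2]] := HB; rewrite H2 //; apply: step_ext => y Hy HRy.
    by rewrite ap_lam // (sol_att HB) //; apply: (H1 x).
Qed.

Lemma dom_all (x : M) : x ∈ A -> x ∈ dom.
Proof.
  move: x; apply: (wf_ind (R := R) (P := fun x => x ∈ dom)) => // x Hx IH.
  apply: NNPP => Hn; pose (F := lam A sol).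
  have HF : att dom F by apply: att_dom.
  (* If [x] were outside the domain of all attempts, adding the value demanded at [x] would give an
     attempt that contains it. *)
  pose (h := lam A (fun z => ite (z ∈ dom) (ap F z) (step F x))).
  have Eh z : z ∈ dom -> ap h z = ap F z.
  { by move=> Hz; rewrite ap_lam ?iteT //; move/sepE: Hz => []. }
  have Ex : ap h x = step F x by rewrite ap_lam // iteF.
  clearbody h F.
  have Hatt : att (cup dom (sing x)) h; last first.
  { apply: Hn; apply/sepE; split=> //; exists (cup dom (sing x)), h; split=> //.
    by apply/cupE; right; apply/singE. }
  have [H0 [H1 H2]] := HF.
  split; first by move=> z /cupE [/H0 //|/singE ->].
  split.
  - move=> z y /cupE [Hz|/singE ->] Hy HRy; apply/cupE; left; [exact: (H1 z)|exact: IH].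
  - move=> z /cupE [Hz|/singE ->].
    + rewrite Eh // H2 //; apply: step_ext => y Hy HRy; rewrite Eh //; exact: (H1 z).
    + rewrite Ex; apply: step_ext => y Hy HRy; rewrite Eh //; exact: IH.
Qed.

Lemma wfrec_spec : wfrec A R G = lam A (fun x => ap (wfrec A R G) x) /\
  forall x, x ∈ A ->
    ap (wfrec A R G) x = G (lam (below A R x) (fun y => ap (wfrec A R G) y)) x.
Proof.
  apply: (the_spec (P := fun F => F = lam A (fun x => ap F x) /\
    forall x, x ∈ A -> ap F x = G (lam (below A R x) (fun y => ap F y)) x)).
  have [_ [_ H2]] := att_dom.
  exists (lam A sol); split.
  - split; first by apply: lam_ext => x Hx; rewrite ap_lam.
    by move=> x Hx; rewrite H2 //; apply: dom_all.
  - move=> F [EF HF]; rewrite EF; apply: lam_ext => x Hx.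
    apply: (sol_att (B := A)) => //; split=> //; by split.
Qed.

End Existence.

Lemma wfrecE (A : M) (R : M -> M -> Prop) (G : M -> M -> M) `{!Rel2 R} `{!Fun2 G} (x : M) : wf A R -> x ∈ A ->
  ap (wfrec A R G) x = G (lam (below A R x) (fun y => ap (wfrec A R G) y)) x.
Proof. by move=> H; have [_] := wfrec_spec (A := A) (R := R) (G := G) H; apply. Qed.

End Recursion.

(** * Ordinals *)

Section Ordinals.
Context {M : zfc_model}.

Lemma foundation (S : M) : (exists x, x ∈ S) -> exists x, x ∈ S /\ forall y, y ∈ S -> ~ y ∈ x.
Proof.
  move=> [x Hx]; have [|y [Hy H]] := zfc_foundation M (zfc_ax M) S; first by move/(_ x).
  by exists y; split=> // z Hz Hzy; apply: (H z).
Qed.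

Lemma wf_mem (A : M) : wf A mem.
Proof. by move=> S _; apply: foundation. Qed.

Lemma mem_irr (x : M) : ~ x ∈ x.
Proof.
  move=> H; have [|y [/singE -> Hy]] := foundation (S := sing x); first by exists x; apply/singE.
  by apply: (Hy x) => //; apply/singE.
Qed.
Lemma mem_asym (x y : M) : x ∈ y -> ~ y ∈ x.
Proof.
  move=> H H'; have [|z [/upairE [->|->] Hz]] := foundation (S := upair x y).
  - by exists x; apply/upairE; left.
  - by apply: (Hz y) => //; apply/upairE; right.
  - by apply: (Hz x) => //; apply/upairE; left.
Qed.
Lemma mem_cyc3 (x y z : M) : x ∈ y -> y ∈ z -> ~ z ∈ x.
Proof.
  move=> H1 H2 H3; have [|w [/cupE Hw Hm]] := foundation (S := cup (upair x y) (sing z)).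
  - by exists x; apply/cupE; left; apply/upairE; left.
  - case: Hw => [/upairE [Hw|Hw]|/singE Hw]; subst w.
    + by apply: (Hm z) => //; apply/cupE; right; apply/singE.
    + by apply: (Hm x) => //; apply/cupE; left; apply/upairE; left.
    + by apply: (Hm y) => //; apply/cupE; left; apply/upairE; right.
Qed.

Lemma ord_trans (a b c : M) : ordinal a -> b ∈ a -> c ∈ b -> c ∈ a.
Proof. by move=> [H _] Hb; apply: H. Qed.

Lemma ord_in (a b : M) : ordinal a -> b ∈ a -> ordinal b.
Proof.
  move=> Ha Hb; have [H1 H2] := Ha; split.
  - move=> y Hy z Hz.
    have Hya := ord_trans Ha Hb Hy; have Hza := ord_trans Ha Hya Hz.
    case: (H2 _ _ Hza Hb) => [//|[E|H]].
    + by subst z; case: (mem_asym Hy).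
    + by case: (mem_cyc3 Hz Hy).
  - by move=> x y Hx Hy; apply: H2; apply: (ord_trans Ha Hb).
Qed.

Lemma ord_sub_mem (a b : M) : ordinal a -> ordinal b -> a ⊆ b -> a <> b -> a ∈ b.
Proof.
  move=> Ha Hb Hab Hne.
  have [|x [/sepE [Hx Hxa] Hmin]] := foundation (S := sep b (fun x => ~ x ∈ a)).
  { apply: NNPP => H; apply: Hne; apply: sub_antisym => // x Hx.
    by apply: NNPP => Hxa; apply: H; exists x; apply/sepE. }
  have -> // : a = x; apply: sub_antisym => z Hz.
  - have [_ Htr] := Hb; case: (Htr _ _ (Hab _ Hz) Hx) => [//|[E|Hxz]].
    + by subst z.
    + by case: Hxa; apply: (ord_trans Ha Hz).
  - apply: NNPP => Hza; apply: (Hmin z) => //; apply/sepE; split=> //.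
    exact: (ord_trans Hb Hx).
Qed.

Lemma ord_trich (a b : M) : ordinal a -> ordinal b -> a ∈ b \/ a = b \/ b ∈ a.
Proof.
  move=> Ha Hb; pose (c := sep a (fun x => x ∈ b)).
  have Hc : ordinal c.
  { split.
    - move=> y /sepE [Hy Hyb] z Hz; apply/sepE; split.
      + exact: (ord_trans Ha Hy).
      + exact: (ord_trans Hb Hyb).
    - move=> x y /sepE [Hx _] /sepE [Hy _]; have [_ H] := Ha; exact: H. }
  have Hca : c ⊆ a by move=> x /sepE [].
  have Hcb : c ⊆ b by move=> x /sepE [].
  case: (classic (c = a)) => [E|Ea]; case: (classic (c = b)) => [E'|Eb].
  - by right; left; rewrite -E -E'.
  - by left; rewrite -E; apply: ord_sub_mem.
  - by right; right; rewrite -E'; apply: ord_sub_mem.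
  - have H1 := ord_sub_mem Hc Ha Hca Ea; have H2 := ord_sub_mem Hc Hb Hcb Eb.
    by case: (@mem_irr c); apply/sepE.
Qed.

Lemma ord_sub (a b : M) : ordinal a -> ordinal b -> (a ⊆ b <-> a ∈ b \/ a = b).
Proof.
  move=> Ha Hb; split=> [H|[H|-> //]].
  - by case: (classic (a = b)) => E; [right|left; apply: ord_sub_mem].
  - by move=> x Hx; apply: (ord_trans Hb H).
Qed.
Lemma ord_nmem (a b : M) : ordinal a -> ordinal b -> (~ a ∈ b <-> b ⊆ a).
Proof.
  move=> Ha Hb; rewrite ord_sub //; split.
  - by case: (ord_trich Ha Hb) => [//|[->|H] _]; [right|left].
  - by move=> [H|->]; [apply: mem_asym|apply: mem_irr].
Qed.

Lemma ord_le_lt (a b c : M) : ordinal c -> a ⊆ b -> ordinal a -> b ∈ c -> a ∈ c.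
Proof.
  move=> Hc Hab Ha Hbc; have Hb := ord_in Hc Hbc.
  by move/(ord_sub Ha Hb): Hab => [H|-> //]; apply: (ord_trans Hc Hbc).
Qed.
Lemma ord_lt_sub (a b : M) : ordinal b -> a ∈ b -> a ⊆ b.
Proof. by move=> [H _]; apply: H. Qed.
Lemma ord_total (a b : M) : ordinal a -> ordinal b -> a ⊆ b \/ b ⊆ a.
Proof.
  move=> Ha Hb; case: (ord_trich Ha Hb) => [H|[->|H]]; [left|by left|right];
  exact: ord_lt_sub.
Qed.

Lemma ord_tr (a : M) : transitive a -> (forall x, x ∈ a -> ordinal x) -> ordinal a.
Proof. by move=> H H'; split=> // x y Hx Hy; apply: ord_trich; apply: H'. Qed.

Lemma ord_emp : ordinal (emp : M).
Proof. by apply: ord_tr => x /empE. Qed.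
Lemma ord_succ (a : M) : ordinal a -> ordinal (succ a).
Proof.
  move=> Ha; apply: ord_tr => x /succE [Hx|->] //.
  - move=> y Hy; apply/succE; left; exact: (ord_trans Ha Hx).
  - by move=> y Hy; apply/succE; left.
  - exact: (ord_in Ha).
Qed.
Lemma ord_union (A : M) : (forall x, x ∈ A -> ordinal x) -> ordinal (union A).
Proof.
  move=> H; apply: ord_tr => x /unionE [a [Ha Hx]].
  - move=> y Hy; apply/unionE; exists a; split=> //; exact: (ord_trans (H _ Ha) Hx).
  - exact: (ord_in (H _ Ha)).
Qed.
Lemma ord_emp_mem (a : M) : ordinal a -> (exists x, x ∈ a) -> emp ∈ a.
Proof.
  move=> Ha [x Hx]; apply: (@ord_le_lt emp x) => //; last exact: ord_emp.
  by move=> z /empE.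
Qed.
Lemma succ_sub (a b : M) : ordinal b -> a ∈ b -> succ a ⊆ b.
Proof. by move=> Hb Ha x /succE [Hx|-> //]; apply: (ord_trans Hb Ha). Qed.

Lemma least_ex (P : M -> Prop) `{!Rel1 P} (a : M) : ordinal a -> P a ->
  exists b, ordinal b /\ P b /\ b ⊆ a /\ forall c, c ∈ b -> ~ P c.
Proof.
  move=> Ha HP; have [|b [/sepE [Hb HPb] Hmin]] := foundation (S := sep (succ a) P).
  { by exists a; apply/sepE; split=> //; apply/succE; right. }
  have Hob := ord_in (ord_succ Ha) Hb.
  exists b; split=> //; split=> //; split.
  - by move/succE: Hb => [H|-> //]; apply: ord_lt_sub.
  - move=> c Hc HPc; apply: (Hmin c) => //; apply/sepE; split=> //.
    exact: (ord_trans (ord_succ Ha) Hb).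
Qed.

Definition least (P : M -> Prop) : M :=
  the (fun a => ordinal a /\ P a /\ forall c, c ∈ a -> ~ P c).

Lemma least_spec (P : M -> Prop) `{!Rel1 P} (a : M) : ordinal a -> P a ->
  P (least P) /\ ordinal (least P) /\ least P ⊆ a /\ forall c, c ∈ least P -> ~ P c.
Proof.
  move=> Ha HP; have [b [Hb [HPb [Hba Hm]]]] := least_ex Ha HP.
  have -> // : least P = b.
  apply: the_eq => // c [Hc [HPc Hmc]].
  case: (ord_trich Hb Hc) => [H|[//|H]].
  - by case: (Hmc _ H).
  - by case: (Hm _ H).
Qed.

Lemma def_least (P : M -> (nat -> M) -> Prop) :
  Def (fun e => P (e 0) (fun i => e (S i))) -> DefT (fun e => least (fun x => P x e)).
Proof.
  move=> HP; apply: def_the; cbv beta.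
  have HP' := def_ren skip1 HP.
  have HP2 : Def (fun e : nat -> M => forall c, c ∈ e 0 -> ~ P c (fun i => e (S i))).
  { by apply: def_all; cbv beta; apply: def_imp; apply: def_not. }
  have Ho : Def (fun e : nat -> M => ordinal (e 0)) by sd.
  exact (def_and Ho (def_and HP HP2)).
Qed.

(** Burali-Forti: the successor of the supremum of all ordinals in [A] is not in [A]. *)
Lemma ord_class_not_set (A : M) : exists a, ordinal a /\ ~ a ∈ A.
Proof.
  pose (B := sep A ordinal).
  exists (succ (union B)).
  have HB : ordinal (union B) by apply: ord_union => x /sepE [].
  split; first exact: ord_succ.
  move=> H; apply: (@mem_irr (union B)); apply/unionE; exists (succ (union B)).
  split; last by apply/succE; right.
  by apply/sepE; split=> //; apply: ord_succ.
Qed.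
End Ordinals.

Ltac sd_recursion := lazymatch goal with
  | |- DefT (fun e => least _) => apply def_least; sd
  | |- DefT (fun e => wfrec _ _ _) => unfold wfrec, below; sd
  | |- _ => sd_sets
  end.
Ltac sd_ho ::= sd_recursion.

(** * Order types and cardinalities *)

Section OrdinalRecursion.
Context {M : zfc_model}.

Lemma below_mem (a b : M) : ordinal a -> b ∈ a -> below a mem b = b.
Proof.
  move=> Ha Hb; apply: ext => z; rewrite sepE; split=> [[] //|Hz]; split=> //.
  exact: (ord_trans Ha Hb).
Qed.

(** Recursion over the class of all ordinals: the value at [a] is read off from a recursion on the
    set [succ a], and [wfrec_coh] makes these recursions agree. *)
Definition orec (G : M -> M -> M) (a : M) : M := locked (ap (wfrec (succ a) mem G) a).
#[global] Instance rel_mem : Rel2 (@mem M).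
Proof. exact: (def_mem (def_var 0) (def_var 1)). Qed.

Lemma wfrec_coh (G : M -> M -> M) `{!Fun2 G} (l l' a : M) : ordinal l -> ordinal l' ->
  a ∈ l -> a ∈ l' -> ap (wfrec l mem G) a = ap (wfrec l' mem G) a.
Proof.
  move=> Hl Hl' Ha; have ? : Fun1 (fun x => ap (wfrec l mem G) x) by sd.
  move: a Ha; apply: (wf_ind (R := mem) (P := fun a => a ∈ l' ->
    ap (wfrec l mem G) a = ap (wfrec l' mem G) a)); first exact: wf_mem.
  move=> a Ha IH Ha'; rewrite !wfrecE //; try exact: wf_mem.
  rewrite !below_mem //; congr (G _ a); apply: lam_ext => b Hb.
  by apply: IH => //; [exact: (ord_trans Hl Ha)|exact: (ord_trans Hl' Ha')].
Qed.

Lemma orecE (G : M -> M -> M) `{!Fun2 G} `{!Fun1 (orec G)} (a : M) : ordinal a ->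
  orec G a = G (lam a (fun b => orec G b)) a.
Proof.
  move=> Ha; have Hs := ord_succ Ha; have Has : a ∈ succ a by apply/succE; right.
  rewrite {1}/orec -lock wfrecE //; try exact: wf_mem.
  rewrite below_mem //; congr (G _ a); apply: lam_ext => b Hb; rewrite /orec -lock; apply: wfrec_coh => //.
  - exact: (ord_succ (ord_in Ha Hb)).
  - by apply/succE; left.
  - by apply/succE; right.
Qed.

(** The Mostowski collapse of [R] on [A]. Extensionality of [R] is not assumed, so the collapse may
    identify points; this is how ultrapowers are formed later without equivalence classes. *)
Definition clp (A : M) (R : M -> M -> Prop) : M :=
  locked (wfrec A R (fun h x => ran h)).

Lemma clpE (A : M) (R : M -> M -> Prop) `{!Rel2 R} (x z : M) : wf A R -> x ∈ A ->
  (z ∈ ap (clp A R) x <-> exists y, y ∈ A /\ R y x /\ z = ap (clp A R) y).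
Proof.
  move=> HR Hx; rewrite /clp -lock {1}wfrecE // ran_lam.
  split=> [[y [/sepE [Hy HRy] ->]]|[y [Hy [HRy ->]]]]; exists y; split=> //.
  by apply/sepE.
Qed.

Lemma clp_ord (A : M) (R : M -> M -> Prop) `{!Rel2 R} : wf A R ->
  (forall x y z, x ∈ A -> y ∈ A -> z ∈ A -> R x y -> R y z -> R x z) ->
  forall x, x ∈ A -> ordinal (ap (clp A R) x).
Proof.
  move=> HR Htr; apply: (wf_ind (R := R)) => // x Hx IH; apply: ord_tr.
  - move=> z /clpE [//|//|y [Hy [HRy ->]]] w /clpE [//|//|v [Hv [HRv ->]]].
    apply/clpE => //; exists v; split=> //; split=> //; exact: (Htr v y x).
  - by move=> z /clpE [//|//|y [Hy [HRy ->]]]; apply: IH.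
Qed.

Definition linear (A : M) (R : M -> M -> Prop) : Prop :=
  forall x y, x ∈ A -> y ∈ A -> R x y \/ x = y \/ R y x.

Lemma clp_inj (A : M) (R : M -> M -> Prop) `{!Rel2 R} : wf A R -> linear A R ->
  forall x y, x ∈ A -> y ∈ A -> ap (clp A R) x = ap (clp A R) y -> x = y.
Proof.
  move=> HR Hl x y Hx Hy E; case: (Hl _ _ Hx Hy) => [H|[//|H]].
  - by case: (@mem_irr M (ap (clp A R) x)); rewrite {2}E; apply/clpE => //; exists x.
  - by case: (@mem_irr M (ap (clp A R) y)); rewrite -{2}E; apply/clpE => //; exists y.
Qed.
End OrdinalRecursion.

Ltac sd_ordinals := lazymatch goal with
  | |- DefT (fun e => orec _ _) => unfold orec; sd
  | |- DefT (fun e => clp _ _) => unfold clp; sd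
  | |- _ => sd_recursion
  end.
Ltac sd_ho ::= sd_ordinals.

(** * Comparing sizes by injections *)

Section Embeddings.
Context {M : zfc_model}.

Definition inj (f X Y : M) : Prop := is_function f X Y /\
  forall x y, x ∈ X -> y ∈ X -> ap f x = ap f y -> x = y.
#[global] Instance rel_inj : Rel3 inj.
Proof. rewrite /inj; sd. Qed.
Definition bij (f X Y : M) : Prop := inj f X Y /\ forall y, y ∈ Y -> exists x, x ∈ X /\ ap f x = y.
#[global] Instance rel_bij : Rel3 bij.
Proof. rewrite /bij; sd. Qed.
Definition emb (X Y : M) : Prop := exists f, inj f X Y.
#[global] Instance rel_emb : Rel2 emb.
Proof. rewrite /emb; sd. Qed.

Lemma bijE (f X Y : M) : is_bijection f X Y <-> bij f X Y.
Proof. by rewrite bij_fn inj_fn. Qed.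
Lemma equiE (X Y : M) : equinumerous X Y <-> exists f, bij f X Y.
Proof. by split=> -[f /bijE H]; exists f. Qed.

Lemma bij_lam (X Y : M) (F : M -> M) `{!Fun1 F} : (forall x, x ∈ X -> F x ∈ Y) ->
  (forall x y, x ∈ X -> y ∈ X -> F x = F y -> x = y) ->
  (forall y, y ∈ Y -> exists x, x ∈ X /\ F x = y) -> bij (lam X F) X Y.
Proof.
  move=> H1 H2 H3; split; first split; first exact: fn_lam.
  - by move=> x y Hx Hy; rewrite !ap_lam //; apply: H2.
  - by move=> y /H3 [x [Hx <-]]; exists x; rewrite ap_lam.
Qed.

Lemma emb_F (X Y : M) (F : M -> M) `{!Fun1 F} : (forall x, x ∈ X -> F x ∈ Y) ->
  (forall x y, x ∈ X -> y ∈ X -> F x = F y -> x = y) -> emb X Y.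
Proof.
  move=> H1 H2; exists (lam X F); split; first exact: fn_lam.
  by move=> x y Hx Hy; rewrite !ap_lam //; apply: H2.
Qed.
Lemma emb_sub (X Y : M) : X ⊆ Y -> emb X Y.
Proof. by move=> H; apply: (emb_F (F := fun x => x)). Qed.
Lemma emb_trans (X Y Z : M) : emb X Y -> emb Y Z -> emb X Z.
Proof.
  move=> [f [Hf If]] [g [Hg Ig]]; apply: (emb_F (F := fun x => ap g (ap f x))).
  - by move=> x Hx; apply: (fn_val Hg); apply: (fn_val Hf).
  - move=> x y Hx Hy /Ig E; apply: If => //; apply: E; exact: (fn_val Hf).
Qed.
Lemma emb_rel (X Y : M) (R : M -> M -> Prop) `{!Rel2 R} :
  (forall x, x ∈ X -> exists y, y ∈ Y /\ R x y) ->
  (forall x x' y, x ∈ X -> x' ∈ X -> R x y -> R x' y -> x = x') -> emb X Y.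
Proof.
  move=> H1 H2; have [f [Hf HR]] := choice_rel H1.
  exists f; split=> // x y Hx Hy E; apply: (H2 x y (ap f x)) => //; first exact: HR.
  by rewrite E; apply: HR.
Qed.
Lemma emb_repl (X : M) (F : M -> M) `{!Fun1 F} : emb (repl X F) X.
Proof.
  apply: (emb_rel (R := fun y x => y = F x)).
  - by move=> y /replE.
  - by move=> y y' x _ _ -> ->.
Qed.

Lemma bij_emb (f X Y : M) : bij f X Y -> emb X Y.
Proof. by move=> [H _]; exists f. Qed.
Lemma bij_sym (f X Y : M) : bij f X Y -> exists g, bij g Y X.
Proof.
  move=> [[Hf If] Sf].
  have H y : y ∈ Y -> exists x, x ∈ X /\ ap f x = y by apply: Sf.
  have [g [Hg HR]] := choice_rel (R := fun y x => ap f x = y) H.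
  exists g; split; first split=> //.
  - by move=> x y Hx Hy E; rewrite -(HR _ Hx) -(HR _ Hy) E.
  - move=> x Hx; exists (ap f x); have Hfx := fn_val Hf Hx; split=> //.
    by apply: If => //; [exact: (fn_val Hg)|exact: HR].
Qed.
Lemma bij_trans (f g X Y Z : M) : bij f X Y -> bij g Y Z -> exists h, bij h X Z.
Proof.
  move=> [[Hf If] Sf] [[Hg Ig] Sg]; exists (lam X (fun x => ap g (ap f x))); apply: bij_lam.
  - by move=> x Hx; apply: (fn_val Hg); apply: (fn_val Hf).
  - by move=> x y Hx Hy /Ig E; apply: If => //; apply: E; exact: (fn_val Hf).
  - by move=> z /Sg [y [/Sf [x [Hx <-]] <-]]; exists x.
Qed.
Lemma inj_bij (f X Y : M) : inj f X Y -> bij f X (repl X (fun x => ap f x)).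
Proof.
  move=> [Hf If]; split; first split=> //.
  - by apply: (fn_sub Hf) => x Hx; apply/replE; exists x.
  - by move=> y /replE [x [Hx ->]]; exists x.
Qed.

(** The collapse of membership on [S] never lies above the identity, so the order type of [S] is at
    most [l]. *)
Lemma otp_sub (l S : M) : ordinal l -> S ⊆ l ->
  exists t f, ordinal t /\ t ⊆ l /\ bij f S t.
Proof.
  move=> Hl HS; have HoS x : x ∈ S -> ordinal x by move=> /HS; apply: (ord_in Hl).
  have Hwf : wf S mem by apply: wf_mem.
  pose (c := fun x => ap (clp S mem) x).
  have ? : Fun1 c by rewrite /c; sd.
  have Ho x : x ∈ S -> ordinal (c x).
  { apply: clp_ord => // u v w _ _ Hw Hu Hv; exact: (ord_trans (HoS _ Hw) Hv). }
  have Hc : forall x, x ∈ S -> c x ⊆ x.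
  { apply: (wf_ind (R := mem)) => // x Hx IH z /clpE [//|//|y [Hy [Hyx ->]]].
    apply: (ord_le_lt (HoS _ Hx) (IH _ Hy Hyx)) => //; exact: Ho. }
  exists (repl S c), (lam S c); split; last split.
  - apply: ord_tr => z /replE [x [Hx ->]]; last exact: Ho.
    by move=> w /clpE [//|//|y [Hy [Hyx ->]]]; apply/replE; exists y.
  - move=> z /replE [x [Hx ->]]; exact: (ord_le_lt Hl (Hc _ Hx) (Ho _ Hx) (HS _ Hx)).
  - apply: bij_lam.
    + by move=> x Hx; apply/replE; exists x.
    + apply: clp_inj => // x y Hx Hy; apply: ord_trich; exact: HoS.
    + by move=> y /replE [x [Hx ->]]; exists x.
Qed.

Lemma wellorder (X : M) : exists l f, ordinal l /\ bij f l X.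
Proof.
  have [c Hc] := choice_fn (pow X).
  (* Elements are chosen one after the other from what is left of [X], until nothing is left. *)
  pose (rest := fun h => sep X (fun y => ~ y ∈ ran h)).
  pose (F := orec (fun h _ => ap c (rest h))).
  have ? : Fun1 rest by rewrite /rest; sd.
  have HG : Fun2 (fun h _ : M => ap c (rest h)) by sd.
  have HF : Fun1 F by rewrite /F; sd.
  pose (rs := fun a => sep X (fun y => forall b, b ∈ a -> y <> F b)).
  have ? : Fun1 rs by rewrite /rs; sd.
  have HFE a : ordinal a -> (exists y, y ∈ rs a) -> F a ∈ rs a.
  { move=> Ha Hne; have E : rest (lam a F) = rs a.
    { apply: ext => y; rewrite !sepE; split=> -[Hy H]; split=> //.
      - by move=> b Hb E; apply: H; apply/ran_lam; exists b.
      - by move/ran_lam => [b [Hb E]]; apply: (H b). }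
    have EF := @orecE _ (fun h _ => ap c (rest h)) HG HF a Ha.
    have {}EF : F a = ap c (rs a) by rewrite -E; exact: EF.
    by rewrite EF; apply: Hc => //; apply/powE => y /sepE []. }
  clearbody F; have Hinj a b : ordinal a -> b ∈ a -> (exists y, y ∈ rs a) -> F a <> F b.
  { by move=> Ha Hb Hne E; have /sepE [_ H] := HFE _ Ha Hne; apply: (H b). }
  case: (classic (exists a, ordinal a /\ ~ exists y, y ∈ rs a)) => [[a0 [Ha0 Hra0]]|Hall].
  - have [a [Ha [Hra [_ Hmin]]]] := least_ex (P := fun a => ~ exists y, y ∈ rs a) Ha0 Hra0.
    have Hne b : b ∈ a -> exists y, y ∈ rs b by move=> /Hmin /NNPP.
    exists a, (lam a F); split=> //; apply: bij_lam.
    + by move=> b Hb; have /sepE [] := HFE b (ord_in Ha Hb) (Hne _ Hb).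
    + move=> b d Hb Hd E; have Hob := ord_in Ha Hb; have Hod := ord_in Ha Hd.
      case: (ord_trich Hob Hod) => [H|[//|H]].
      * by case: (Hinj _ _ Hod H (Hne _ Hd)).
      * by case: (Hinj _ _ Hob H (Hne _ Hb)).
    + move=> y Hy; apply: NNPP => Hn; apply: Hra; exists y; apply/sepE; split=> // b Hb E.
      by apply: Hn; exists b.
  - have Hne a : ordinal a -> exists y, y ∈ rs a.
    { by move=> Ha; apply: NNPP => H; apply: Hall; exists a. }
    (* If the choices never ended, the inverse of [F] would map a subset of [X] onto all ordinals,
       against replacement. *)
    have [a [Ha Hn]] := ord_class_not_set
      (repl X (fun x => the (fun a => ordinal a /\ F a = x))).
    case: Hn; apply/replE; exists (F a).
    have /sepE [Hx _] := HFE _ Ha (Hne _ Ha); split=> //; symmetry; apply: the_eq => //.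
    move=> b [Hb E]; case: (ord_trich Ha Hb) => [H|[//|H]].
    + by case: (Hinj _ _ Hb H (Hne _ Hb)).
    + by case: (Hinj _ _ Ha H (Hne _ Ha)).
Qed.

Lemma emb_equi (X l : M) : ordinal l -> emb X l ->
  exists t f, ordinal t /\ t ⊆ l /\ bij f X t.
Proof.
  move=> Hl [f Hf]; have Hb := inj_bij Hf.
  have [|t [g [Ht [Htl Hg]]]] := otp_sub (S := repl X (fun x => ap f x)) Hl.
  { by move=> y /replE [x [Hx ->]]; have [Hf' _] := Hf; apply: (fn_val Hf'). }
  by have [h Hh] := bij_trans Hb Hg; exists t, h.
Qed.

Lemma card_lt_emb (X l k : M) : ordinal k -> l ∈ k -> emb X l -> card_lt X k.
Proof.
  move=> Hk Hl He; have Hol := ord_in Hk Hl.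
  have [t [f [Ht [Htl Hf]]]] := emb_equi Hol He.
  have [|b [Hb [/equiE [g Hg] [Hbt Hmin]]]] := least_ex (P := fun b => equinumerous X b) Ht.
  { by apply/equiE; exists f. }
  exists b; split.
  - split; last by apply/equiE; exists g.
    split=> // a Ha /equiE [h Hh]; apply: (Hmin _ Ha).
    have [h' Hh'] := bij_sym Hh.
    by have [p Hp] := bij_trans Hg Hh'; apply/equiE; exists p.
  - apply: (ord_le_lt Hk _ Hb Hl) => x /Hbt; exact: Htl.
Qed.

Lemma card_no_emb (k l : M) : cardinal k -> l ∈ k -> ~ emb k l.
Proof.
  move=> [Hk Hc] Hl He; have [t [f [Ht [Htl Hf]]]] := emb_equi (ord_in Hk Hl) He.
  have [g Hg] := bij_sym Hf.
  apply: (Hc t); last by apply/equiE; exists g.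
  exact: (ord_le_lt Hk Htl Ht Hl).
Qed.

(** Size below [k], put in terms of injections so that no cardinality has to be computed. *)
Definition sml (X k : M) : Prop := exists l, l ∈ k /\ emb X l.
#[global] Instance rel_sml : Rel2 sml.
Proof. rewrite /sml; sd. Qed.

Lemma sml_emb (X Y k : M) : emb X Y -> sml Y k -> sml X k.
Proof. by move=> H [l [Hl H']]; exists l; split=> //; apply: (emb_trans H). Qed.
Lemma sml_sub (X Y k : M) : X ⊆ Y -> sml Y k -> sml X k.
Proof. by move=> /emb_sub; apply: sml_emb. Qed.
Lemma sml_mem (l k : M) : l ∈ k -> sml l k.
Proof. by move=> H; exists l; split=> //; apply: emb_sub. Qed.

Lemma card_emb_ord (k X : M) : cardinal k -> sml X k -> ~ emb k X.
Proof. by move=> Hk [l [Hl He]] H; apply: (card_no_emb Hk Hl); apply: (emb_trans H He). Qed.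

Lemma subset_card_bij (k Q : M) : ordinal k -> Q ⊆ k -> ~ sml Q k -> exists f, bij f k Q.
Proof.
  move=> Hk HQ Hn; have [t [f [Ht [Htk Hf]]]] := otp_sub Hk HQ.
  move/(ord_sub Ht Hk): Htk => [H|E].
  - by case: Hn; exists t; split=> //; apply: (bij_emb Hf).
  - by rewrite -E; apply: (bij_sym Hf).
Qed.

(* A union of an increasing [k]-chain of sets of size less than [k] is well-ordered
   in type at most [k] by comparing first the stage at which a point appears. *)
Lemma emb_stratified (k T : M) (S : M -> M) `{!Fun1 S} : cardinal k ->
  (forall a b, a ∈ b -> b ∈ k -> S a ⊆ S b) ->
  (forall a, a ∈ k -> sml (S a) k) ->
  (forall t, t ∈ T -> exists a, a ∈ k /\ t ∈ S a) -> emb T k.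
Proof.
  move=> Hck Hmon Hsml Hcov; have Hk : ordinal k by case: Hck.
  have [l [f [Hl Hf]]] := wellorder T; have [w [[Hw Iw] _]] := bij_sym Hf.
  pose (rk := fun t => least (fun a => a ∈ k /\ t ∈ S a)).
  have ? : Fun1 rk by rewrite /rk; sd.
  have Hrk t : t ∈ T -> rk t ∈ k /\ t ∈ S (rk t) /\ ordinal (rk t).
  { move=> Ht; have [a [Ha HtS]] := Hcov _ Ht.
    have [[H1 H2] [H3 _]] := least_spec (P := fun a => a ∈ k /\ t ∈ S a) (ord_in Hk Ha)
      (conj Ha HtS); by []. }
  clearbody rk.
  have Ho t : t ∈ T -> ordinal (ap w t) by move=> Ht; apply: (ord_in Hl); apply: (fn_val Hw).
  pose (R := fun t s => rk t ∈ rk s \/ rk t = rk s /\ ap w t ∈ ap w s).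
  have HR : Rel2 R by rewrite /R; sd.
  have Hlin : linear T R.
  { move=> t s Ht Hs; rewrite /R; have [_ [_ H1]] := Hrk _ Ht; have [_ [_ H2]] := Hrk _ Hs.
    case: (ord_trich H1 H2) => [H|[H|H]]; [by left; left| |by right; right; left].
    case: (ord_trich (Ho _ Ht) (Ho _ Hs)) => [H'|[H'|H']].
    - by left; right.
    - by right; left; apply: Iw.
    - by right; right; right. }
  have Htr x y z : x ∈ T -> y ∈ T -> z ∈ T -> R x y -> R y z -> R x z.
  { move=> Hx Hy Hz; have [_ [_ Hrz]] := Hrk _ Hz; rewrite /R.
    move=> [H|[E H]] [H'|[E' H']].
    - left; exact: (ord_trans Hrz H').
    - by left; rewrite -E'.
    - by left; rewrite E.
    - right; split; first by rewrite E.
      exact: (ord_trans (Ho _ Hz) H'). }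
  have Hwf : wf T R.
  { move=> A HA [x0 Hx0].
    have [|r [/replE [x1 [Hx1 Er]] Hr]] := foundation (S := repl A rk).
    { by exists (rk x0); apply/replE; exists x0. }
    have [|v [/replE [x [/sepE [Hx Ex] ->]] Hv]] :=
      foundation (S := repl (sep A (fun x => rk x = r)) (fun x => ap w x)).
    { by exists (ap w x1); apply/replE; exists x1; split=> //; apply/sepE. }
    exists x; split=> // y Hy [H|[E H]].
    - by apply: (Hr (rk y)); [apply/replE; exists y|rewrite -Ex].
    - apply: (Hv (ap w y)) => //; apply/replE; exists y; split=> //; apply/sepE.
      by rewrite E Ex. }
  pose (c := fun x => ap (clp T R) x).
  have ? : Fun1 c by rewrite /c; sd.
  have Hco : forall x, x ∈ T -> ordinal (c x) by apply: clp_ord.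
  have Hci : forall x y, x ∈ T -> y ∈ T -> c x = c y -> x = y by apply: clp_inj.
  (* All predecessors of [x] already belong to the stage at which [x] appears. If the rank of [x]
     reached [k], then [k] would inject into that single small stage. *)
  apply: (emb_F (F := c)) => // x Hx; apply: NNPP => /(ord_nmem (Hco _ Hx) Hk) Hkc.
  have [Hr1 [Hr2 Hr3]] := Hrk _ Hx.
  apply: (card_emb_ord Hck (Hsml _ Hr1)); apply: (emb_trans (emb_sub Hkc)).
  apply: (emb_rel (R := fun z y => y ∈ T /\ z = c y)).
  - move=> z /clpE [//|//|y [Hy [HRy ->]]]; exists y; split=> //.
    have [_ [Hy2 _]] := Hrk _ Hy; case: HRy => [H|[E _]].
    + exact: (Hmon _ _ H Hr1).
    + by rewrite -E.
  - by move=> z z' y _ _ [_ ->] [_ ->].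
Qed.
End Embeddings.

(** * Measurable cardinals *)

Section Omega.
Context {M : zfc_model}.
Variable w : M.
Hypothesis Hw : is_omega w.

Lemma omega_ord : ordinal w.
Proof. by case: Hw => -[]. Qed.
Lemma omega0 : emp ∈ w.
Proof.
  case: Hw => -[Ho [Hne _]] _; apply: ord_emp_mem => //.
  by apply: NNPP => H; apply: Hne => z Hz; apply: H; exists z.
Qed.
Lemma omegaS n : n ∈ w -> succ n ∈ w.
Proof.
  case: Hw => -[Ho [_ Hl]] _ Hn; have [m [Hm Hnm]] := Hl _ Hn.
  have Hom := ord_in Ho Hm.
  exact: (ord_le_lt Ho (succ_sub Hom Hnm) (ord_succ (ord_in Ho Hn))).
Qed.
Lemma omega_ind (P : M -> Prop) `{!Rel1 P} : P emp ->
  (forall n, n ∈ w -> P n -> P (succ n)) -> forall n, n ∈ w -> P n.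
Proof.
  move=> H0 HS; apply: (wf_ind (R := mem)) => [|n Hn IH]; first exact: wf_mem.
  have Ho := omega_ord; have Hon := ord_in Ho Hn.
  case: (classic (is_empty n)) => He.
  - by have -> : n = emp by apply: ext => z; split=> [/He|/empE].
  - have : ~ limit_ordinal n by case: Hw => _; apply.
    move=> Hnl; have [m [Hm Hmax]] : exists m, m ∈ n /\ ~ exists y, y ∈ n /\ m ∈ y.
    { apply: NNPP => H; apply: Hnl; split=> //; split=> // m Hm; apply: NNPP => H'.
      by apply: H; exists m. }
    have Hom := ord_in Hon Hm.
    have E : n = succ m.
    { apply: sub_antisym; last exact: succ_sub.
      move=> z Hz; apply/succE; case: (ord_trich (ord_in Hon Hz) Hom) => [H|[H|H]].
      - by left.
      - by right.
      - by case: Hmax; exists z. }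
    rewrite E; apply: HS; first exact: (ord_trans Ho Hn).
    by apply: IH => //; exact: (ord_trans Ho Hn).
Qed.

Lemma omega_rec (a : M) (G : M -> M) `{!Fun1 G} :
  exists f, ap f emp = a /\ forall n, n ∈ w -> ap f (succ n) = G (ap f n).
Proof.
  have Ho := omega_ord.
  (* For a successor [n], the union of [n] is its predecessor. *)
  pose (F := orec (fun h n => ite (n = emp) a (G (ap h (union n))))).
  have HG : Fun2 (fun h n : M => ite (n = emp) a (G (ap h (union n)))) by sd.
  have HF : Fun1 F by rewrite /F; sd.
  have FE n : ordinal n -> F n = ite (n = emp) a (G (ap (lam n F) (union n))) by apply: orecE.
  clearbody F; exists (lam w F); have H0 := omega0; split.
  - by rewrite ap_lam // FE ?iteT //; exact: ord_emp.
  - move=> n Hn; have HSn := omegaS Hn; rewrite !ap_lam // FE; first exact: (ord_in Ho HSn).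
    rewrite iteF; first by move=> E; apply: (@empE _ n); rewrite -E; apply/succE; right.
    have -> : union (succ n) = n.
    { apply: ext => z; rewrite unionE; split.
      - move=> [y [/succE [Hy|->] Hz]] //; exact: (ord_trans (ord_in Ho Hn) Hy).
      - by move=> Hz; exists n; split=> //; apply/succE; right. }
    by rewrite ap_lam //; apply/succE; right.
Qed.

Lemma trcl_ex (a : M) : exists t, transitive t /\ a ⊆ t.
Proof.
  pose (F := orec (fun h _ => cup a (union (union (ran h))))).
  have HG : Fun2 (fun h _ : M => cup a (union (union (ran h)))) by sd.
  have HF : Fun1 F by rewrite /F; sd.
  have FE n : ordinal n -> F n = cup a (union (union (ran (lam n F)))) by apply: orecE.
  clearbody F; exists (bigcup w F); split.
  - move=> x /bigcupE [n [Hn Hx]] y Hy; apply/bigcupE; exists (succ n).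
    have HSn := omegaS Hn; split=> //.
    rewrite FE; first exact: (ord_in omega_ord HSn).
    apply/cupE; right; apply/unionE; exists x; split=> //; apply/unionE; exists (F n); split=> //.
    by apply/ran_lam; exists n; split=> //; apply/succE; right.
  - move=> x Hx; apply/bigcupE; exists emp; have H0 := omega0; split=> //.
    by rewrite FE; [exact: ord_emp|apply/cupE; left].
Qed.

Lemma omega_unique w' : is_omega w' -> w = w'.
Proof.
  move=> Hw'; have [[Ho _] Hl] := Hw; have [[Ho' _] Hl'] := Hw'.
  case: (ord_trich Ho Ho') => [H|[//|H]].
  - by case: (Hl' _ H); case: Hw.
  - by case: (Hl _ H); case: Hw'.
Qed.
End Omega.

Section Measure.
Context {M : zfc_model}.

Definition measure (k u : M) : Prop := cardinal k /\ (exists w, is_omega w /\ w ∈ k) /\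
  ultrafilter k u /\ nonprincipal k u /\ complete k u.
#[global] Instance rel_measure : Rel2 measure.
Proof. rewrite /measure; sd. Qed.

Lemma measurableE (k : M) : measurable k <-> exists u, measure k u.
Proof.
  split.
  - by move=> [Hc [Ho [u Hu]]]; exists u.
  - by move=> [u [Hc [Ho Hu]]]; split=> //; split=> //; exists u.
Qed.

Section MeasureOne.
Variables k u : M.
Hypothesis Hm : measure k u.

Lemma um_ord : ordinal k.
Proof. by case: Hm => -[]. Qed.
Lemma um_mono (P Q : M -> Prop) `{!Rel1 P} `{!Rel1 Q} : sep k P ∈ u ->
  (forall c, c ∈ k -> P c -> Q c) -> sep k Q ∈ u.
Proof.
  move: Hm => [_ [_ [[_ [_ [_ [Hup _]]]] _]]] HP HPQ; apply: (Hup (sep k P)) => //.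
  - by move=> c /sepE [Hc Hp]; apply/sepE; split=> //; apply: HPQ.
  - by move=> c /sepE [].
Qed.
Lemma um_all_k (P : M -> Prop) `{!Rel1 P} : (forall c, c ∈ k -> P c) -> sep k P ∈ u.
Proof.
  move=> H; have -> : sep k P = k; last by move: Hm => [_ [_ [[_ []]]]].
  by apply: ext => c; rewrite sepE; split=> [[]|Hc] //; split=> //; apply: H.
Qed.
Lemma um_and (P Q : M -> Prop) `{!Rel1 P} `{!Rel1 Q} : sep k P ∈ u -> sep k Q ∈ u ->
  sep k (fun c => P c /\ Q c) ∈ u.
Proof.
  move: Hm => [_ [_ [[_ [_ [_ [_ [Hi _]]]]] _]]] HP HQ; apply: (Hi _ _ _ HP HQ).
  by move=> c; rewrite !sepE; tauto.
Qed.
Lemma um_ne (P : M -> Prop) `{!Rel1 P} : sep k P ∈ u -> exists c, c ∈ k /\ P c.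
Proof.
  move: Hm => [_ [_ [[_ [_ [Hne _]]] _]]] HP; apply: NNPP => H.
  by apply: (Hne _ HP) => c /sepE Hc; apply: H; exists c.
Qed.
Lemma um_dec (P : M -> Prop) `{!Rel1 P} : sep k P ∈ u \/ sep k (fun c => ~ P c) ∈ u.
Proof.
  move: Hm => [_ [_ [[_ [_ [_ [_ [_ Hd]]]]] _]]]; apply: Hd.
  - by move=> c /sepE [].
  - by move=> c; rewrite !sepE; tauto.
Qed.
Lemma um_not (P : M -> Prop) `{!Rel1 P} : ~ sep k P ∈ u <-> sep k (fun c => ~ P c) ∈ u.
Proof.
  split; first by case: (um_dec (P := P)).
  move=> H H'; have [c [_ [H1 H2]]] := um_ne (um_and H H'); by [].
Qed.

Lemma um_all (Y : M) (P : M -> M -> Prop) `{!Rel2 P} : sml Y k ->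
  (forall y, y ∈ Y -> sep k (fun c => P y c) ∈ u) ->
  sep k (fun c => forall y, y ∈ Y -> P y c) ∈ u.
Proof.
  (* The empty family is treated apart because [complete] speaks of nonempty families only. *)
  move=> [l [Hl He]] H; case: (classic (exists y, y ∈ Y)) => [[y0 Hy0]|Hn]; last first.
  { by apply: um_all_k => c _ y Hy; case: Hn; exists y. }
  have [_ [_ [_ [_ Hc]]]] := Hm.
  apply: (Hc (repl Y (fun y => sep k (fun c => P y c)))).
  - by move=> x /replE [y [Hy ->]]; apply: H.
  - by move/(_ (sep k (fun c => P y0 c))); apply; apply/replE; exists y0.
  - apply: (card_lt_emb um_ord Hl); apply: (emb_trans _ He); exact: emb_repl.
  - move=> z; rewrite sepE; split.
    + by move=> [Hz Hall] x /replE [y [Hy ->]]; apply/sepE; split=> //; apply: Hall.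
    + move=> Hall; have HH y : y ∈ Y -> z ∈ k /\ P y z.
      { move=> Hy; have : z ∈ sep k (fun c => P y c) by apply: Hall; apply/replE; exists y.
        by move/sepE. }
      by split; [case: (HH _ Hy0)|move=> y /HH []].
Qed.

(** If all fibres had measure zero, completeness would give a point lying in none of them. *)
Lemma um_part (Y : M) (G : M -> M) `{!Fun1 G} : sml Y k -> (forall c, c ∈ k -> G c ∈ Y) ->
  exists y, y ∈ Y /\ sep k (fun c => G c = y) ∈ u.
Proof.
  move=> HY HG; apply: NNPP => H.
  have := @um_all Y (fun y c => ~ G c = y) _ HY.
  move=> Ha; have {}Ha : sep k (fun c => forall y, y ∈ Y -> ~ G c = y) ∈ u.
  { by apply: Ha => y Hy; apply/um_not => Hn; apply: H; exists y. }
  have [c [Hc Hcy]] := um_ne Ha; exact: (Hcy _ (HG _ Hc)).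
Qed.

Lemma um_single a : a ∈ k -> sep k (fun c => c <> a) ∈ u.
Proof.
  move=> Ha; apply/(um_not (P := fun c => c = a)).
  have [_ [_ [_ [Hn _]]]] := Hm; apply: (Hn a) => // z.
  by rewrite sepE; split=> [[_ ->]|[->|->]] //; left.
Qed.

Lemma um_gt a : a ∈ k -> sep k (fun c => a ∈ c) ∈ u.
Proof.
  move=> Ha; have Hk := um_ord.
  have H1 : sep k (fun c => forall b, b ∈ a -> c <> b) ∈ u.
  { apply: (um_all (P := fun b c => c <> b)); first exact: sml_mem.
    by move=> b Hb; apply: um_single; exact: (ord_trans Hk Ha). }
  apply: (um_mono (um_and H1 (um_single Ha))) => c Hc [Hb Hca].
  by case: (ord_trich (ord_in Hk Ha) (ord_in Hk Hc)) => [//|[E|H]];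
    [case: Hca|case: (Hb _ H)].
Qed.

Lemma um_succ a : a ∈ k -> succ a ∈ k.
Proof.
  move=> Ha; have Hk := um_ord; have [c [Hc Hac]] := um_ne (um_gt Ha).
  apply: (ord_le_lt Hk _ (ord_succ (ord_in Hk Ha)) Hc).
  exact: (succ_sub (ord_in Hk Hc)).
Qed.
Lemma um_emp : emp ∈ k.
Proof.
  have [_ [[w [Hw Hwk]] _]] := Hm.
  apply: ord_emp_mem; [exact: um_ord|by exists w].
Qed.

(** Regularity of [k]: by completeness almost every ordinal below [k] exceeds all the values. *)
Lemma um_reg (Y : M) (G : M -> M) `{!Fun1 G} : sml Y k -> (forall y, y ∈ Y -> G y ∈ k) ->
  exists b, b ∈ k /\ forall y, y ∈ Y -> G y ∈ b.
Proof.
  move=> HY HG; have H : sep k (fun c => forall y, y ∈ Y -> G y ∈ c) ∈ u.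
  { apply: (um_all (P := fun y c => G y ∈ c)) => // y Hy; apply: um_gt; exact: HG. }
  exact: (um_ne H).
Qed.

(** A measurable cardinal is a strong limit. For each [a] below [l] almost all sets [ap f c] agree
    about [a], hence by completeness almost all of them agree about every [a], and two distinct
    points have the same image. *)
Lemma um_strong l : l ∈ k -> ~ emb k (pow l).
Proof.
  move=> Hl [f [Hf If]].
  have H : sep k (fun c => forall a, a ∈ l ->
     (a ∈ ap f c <-> sep k (fun d => a ∈ ap f d) ∈ u)) ∈ u.
  { apply: (um_all (P := fun a c => (a ∈ ap f c <-> sep k (fun d => a ∈ ap f d) ∈ u))).
    - exact: sml_mem.
    - move=> a Ha; case: (classic (sep k (fun d => a ∈ ap f d) ∈ u)) => Hd.
      + by apply: (um_mono Hd).
      + move: (Hd) => /um_not Hd'; by apply: (um_mono Hd'). }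
  have [c [Hc Hca]] := um_ne H.
  have [d [Hd [Hda Hdc]]] := um_ne (um_and H (um_single Hc)).
  apply: Hdc; apply: If => //.
  have /powE Hfc := fn_val Hf Hc; have /powE Hfd := fn_val Hf Hd.
  apply: ext => a; split=> Ha.
  - by have Hal := Hfd _ Ha; rewrite Hca // -Hda.
  - by have Hal := Hfc _ Ha; rewrite Hda // -Hca.
Qed.

Lemma sml_pow (X : M) : sml X k -> sml (pow X) k.
Proof.
  move=> [l [Hl [f [Hf If]]]]; have Hk := um_ord.
  apply: (@sml_emb _ _ (pow l)).
  - apply: (emb_F (F := fun s => repl s (fun x => ap f x))).
    + move=> s /powE Hs; apply/powE => y /replE [x [Hx ->]]; apply: (fn_val Hf); exact: Hs.
    + have Haux s t : s ⊆ X -> t ⊆ X ->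
        repl s (fun x => ap f x) = repl t (fun x => ap f x) -> s ⊆ t.
      { move=> Hs Ht E x Hx; have : ap f x ∈ repl t (fun x => ap f x).
        { by rewrite -E; apply/replE; exists x. }
        move/replE => [x' [Hx' /If E']]; rewrite E' //; [exact: Hs|exact: Ht]. }
      by move=> s t /powE Hs /powE Ht E; apply: sub_antisym; apply: Haux.
  - have [t [g [Ht Hg]]] := wellorder (pow l).
    have [g' Hg'] := bij_sym Hg; exists t; split; last exact: (bij_emb Hg').
    apply: NNPP => /(ord_nmem Ht Hk) Hkt; apply: (um_strong Hl).
    exact: (emb_trans (emb_sub Hkt) (bij_emb Hg)).
Qed.

Lemma sml_prod (X Y : M) : sml X k -> sml Y k -> sml (prod X Y) k.
Proof.
  move=> [l [Hl [f [Hf If]]]] [l' [Hl' [g [Hg Ig]]]]; have Hk := um_ord.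
  have [m [Hm1 [H1 H2]]] : exists m, m ∈ k /\ l ⊆ m /\ l' ⊆ m.
  { case: (ord_total (ord_in Hk Hl) (ord_in Hk Hl')) => H; [exists l'|exists l]; do ! split=> //. }
  (* Kuratowski pairs over [m] are elements of [pow (pow m)], so the strong limit property replaces
     cardinal arithmetic. *)
  apply: (@sml_emb _ _ (pow (pow m))); last by do 2 apply: sml_pow; apply: sml_mem.
  apply: (emb_F (F := fun p => pair (ap f (fst p)) (ap g (snd p)))).
  - move=> p /prodE [x [Hx [y [Hy ->]]]]; rewrite fst_pair snd_pair.
    have H3 := H1 _ (fn_val Hf Hx); have H4 := H2 _ (fn_val Hg Hy).
    apply/powE => z /pairE [->|->]; apply/powE => v.
    + by move/singE => ->.
    + by move/upairE => [->|->].
  - move=> p q /prodE [x [Hx [y [Hy ->]]]] /prodE [x' [Hx' [y' [Hy' ->]]]].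
    rewrite !fst_pair !snd_pair => /pair_inj [/If E /Ig E'].
    by rewrite E // E'.
Qed.
End MeasureOne.

Lemma limit_cardinal (k : M) : limit_of_measurables k -> cardinal k.
Proof.
  move=> [Hk [_ Hlim]]; split=> // a Ha /equiE [f Hf].
  have [m [Hm [Ham /measurableE [u [Hcm _]]]]] := Hlim _ Ha.
  have [g Hg] := bij_sym Hf.
  apply: (card_no_emb Hcm Ham); apply: (emb_trans _ (bij_emb Hg)).
  by apply: emb_sub; case: Hk => Htr _; apply: Htr.
Qed.
End Measure.

(** * The iterated product of the measures *)

(** [Me] is a cofinal set of measurable cardinals below [kap], and [ult] chooses one measure on each
    of them. The value [mu] is excluded for the sake of [um_bound]. *)
Structure setting : Type := Setting {
  model :> zfc_model;
  kap : model;
  mu : model;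
  Me : model;
  ult : model;
  kap_limit : limit_of_measurables kap;
  mu_cof : is_cofinality kap mu;
  Me_kap : forall d, d ∈ Me -> d ∈ kap;
  Me_mu : forall d, d ∈ Me -> d <> mu;
  Me_measure : forall d, d ∈ Me -> measure d (ap ult d);
  Me_cofinal : forall a, a ∈ kap -> exists d, d ∈ Me /\ a ∈ d
}.

Section ProductFilter.
Context {M : setting}.

Lemma kap_card : cardinal (kap M).
Proof. exact: limit_cardinal (kap_limit M). Qed.
Lemma kap_ord : ordinal (kap M).
Proof. by case: kap_card. Qed.
Lemma Me_ord (d : M) : d ∈ Me M -> ordinal d.
Proof. by move=> /Me_kap; apply: (ord_in kap_ord). Qed.

Definition Om : M := prod (Me M) (kap M).
Definition um (i : M) : M := ap (ult M) (fst i).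
#[global] Instance fun_um : Fun1 um.
Proof. rewrite /um; sd. Qed.
Definition lt (i j : M) : Prop := fst i ∈ fst j \/ fst i = fst j /\ snd i ∈ snd j.
#[global] Instance rel_lt : Rel2 lt.
Proof. rewrite /lt; sd. Qed.

Lemma Om_fst (i : M) : i ∈ Om -> fst i ∈ Me M.
Proof. by move=> /prodE [d [Hd [b [Hb ->]]]]; rewrite fst_pair. Qed.
Lemma Om_snd (i : M) : i ∈ Om -> snd i ∈ kap M.
Proof. by move=> /prodE [d [Hd [b [Hb ->]]]]; rewrite snd_pair. Qed.
Lemma Om_pair (i : M) : i ∈ Om -> i = pair (fst i) (snd i).
Proof. by move=> /prodE [d [Hd [b [Hb ->]]]]; rewrite snd_pair fst_pair. Qed.
Lemma Om_measure (i : M) : i ∈ Om -> measure (fst i) (um i).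
Proof. by move=> /Om_fst; apply: Me_measure. Qed.
Lemma Om_ord (i : M) : i ∈ Om -> ordinal (fst i).
Proof. by move=> /Om_fst /Me_ord. Qed.
Lemma Om_emp (i : M) : i ∈ Om -> emp ∈ fst i.
Proof. by move=> /Om_measure /um_emp. Qed.
Lemma Om_kap (i : M) : i ∈ Om -> fst i ⊆ kap M.
Proof. by move=> /Om_fst /Me_kap H c Hc; apply: (ord_trans kap_ord H). Qed.

Lemma lt_irr (i : M) : ~ lt i i.
Proof. by move=> [|[_]]; apply: mem_irr. Qed.
Lemma lt_trans (i j l : M) : l ∈ Om -> lt i j -> lt j l -> lt i l.
Proof.
  move=> Hl; have Ho1 := Om_ord Hl; have Ho2 := ord_in kap_ord (Om_snd Hl).
  move=> [H|[E H]] [H'|[E' H']].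
  - left; exact: (ord_trans Ho1 H').
  - by left; rewrite -E'.
  - by left; rewrite E.
  - right; split; [by rewrite E|exact: (ord_trans Ho2 H')].
Qed.
Lemma lt_linear : linear Om lt.
Proof.
  move=> i j Hi Hj; rewrite /lt.
  case: (ord_trich (Om_ord Hi) (Om_ord Hj)) => [H|[H|H]]; [by left; left| |by right; right; left].
  case: (ord_trich (ord_in kap_ord (Om_snd Hi)) (ord_in kap_ord (Om_snd Hj))) => [H'|[H'|H']].
  - by left; right.
  - by right; left; rewrite (Om_pair Hi) (Om_pair Hj) H H'.
  - by right; right; right.
Qed.
Lemma lt_wf : wf Om lt.
Proof.
  move=> A HA [x0 Hx0].
  have [|r [/replE [x1 [Hx1 Er]] Hr]] := foundation (S := repl A fst).
  { by exists (fst x0); apply/replE; exists x0. }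
  have [|v [/replE [x [/sepE [Hx Ex] ->]] Hv]] :=
    foundation (S := repl (sep A (fun x => fst x = r)) snd).
  { by exists (snd x1); apply/replE; exists x1; split=> //; apply/sepE. }
  exists x; split=> // y Hy [H|[E H]].
  - by apply: (Hr (fst y)); [apply/replE; exists y|rewrite -Ex].
  - apply: (Hv (snd y)) => //; apply/replE; exists y; split=> //; apply/sepE.
    by rewrite E Ex.
Qed.

Definition Pi : M := sep (funs Om (kap M)) (fun a => forall i, i ∈ Om -> ap a i ∈ fst i).
Lemma Pi_fn (a : M) : a ∈ Pi -> is_function a Om (kap M).
Proof. by move/sepE => [/funsE]. Qed.
Lemma Pi_val (a i : M) : a ∈ Pi -> i ∈ Om -> ap a i ∈ fst i.
Proof. by move/sepE => [_]; apply. Qed.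
Lemma Pi_lam (F : M -> M) `{!Fun1 F} : (forall i, i ∈ Om -> F i ∈ fst i) -> lam Om F ∈ Pi.
Proof.
  move=> H; apply/sepE; split; last by move=> i Hi; rewrite ap_lam //; apply: H.
  by apply/funsE; apply: fn_lam => i Hi; apply: (Om_kap Hi); apply: H.
Qed.
Lemma Pi_ext (a b : M) : a ∈ Pi -> b ∈ Pi -> (forall i, i ∈ Om -> ap a i = ap b i) -> a = b.
Proof. by move=> /Pi_fn Ha /Pi_fn Hb; apply: (fn_ext Ha Hb). Qed.

Definition upd (a i c : M) : M := locked (lam Om (fun j => ite (j = i) c (ap a j))).
#[global] Instance fun_upd : Fun3 upd.
Proof. rewrite /upd; sd. Qed.
Lemma upd_eq (a i c : M) : i ∈ Om -> ap (upd a i c) i = c.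
Proof. by move=> Hi; rewrite /upd -lock ap_lam // iteT. Qed.
Lemma upd_ne (a i c j : M) : j ∈ Om -> j <> i -> ap (upd a i c) j = ap a j.
Proof. by move=> Hj Hne; rewrite /upd -lock ap_lam // iteF. Qed.
Lemma upd_Pi (a i c : M) : a ∈ Pi -> i ∈ Om -> c ∈ fst i -> upd a i c ∈ Pi.
Proof.
  move=> Ha Hi Hc; rewrite /upd -lock; apply: Pi_lam => j Hj.
  case: (classic (j = i)) => [->|Hne]; [by rewrite iteT|rewrite iteF //; exact: Pi_val].
Qed.
Lemma upd_id (a i : M) : a ∈ Pi -> i ∈ Om -> upd a i (ap a i) = a.
Proof.
  move=> Ha Hi; apply: Pi_ext => //; first by apply: upd_Pi => //; apply: Pi_val.
  move=> j Hj; case: (classic (j = i)) => [->|Hne]; [by rewrite upd_eq|by rewrite upd_ne].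
Qed.

Definition strategy (T : M) : Prop :=
  (forall i a, i ∈ Om -> a ∈ Pi -> ap T (pair i a) ∈ um i) /\
  (forall i a b, i ∈ Om -> a ∈ Pi -> b ∈ Pi ->
    (forall j, j ∈ Om -> lt j i -> ap a j = ap b j) -> ap T (pair i a) = ap T (pair i b)).
#[global] Instance rel_strategy : Rel1 strategy.
Proof. rewrite /strategy; sd. Qed.
Definition follows (a T : M) : Prop := forall i, i ∈ Om -> ap a i ∈ ap T (pair i a).
#[global] Instance rel_follows : Rel2 follows.
Proof. rewrite /follows; sd. Qed.

(* The iterated product of the measures [um i]: a set of points is large if it
   contains every point [a] whose [i]-th coordinate is always chosen in a set of
   measure one depending on the earlier coordinates of [a] only. *)
Definition ae (P : M -> Prop) : Prop :=
  exists T, strategy T /\ forall a, a ∈ Pi -> follows a T -> P a.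
End ProductFilter.

Ltac sd_ae := lazymatch goal with
  | |- Def (fun e => ae _) => unfold ae; sd
  | |- _ => sd_ordinals
  end.
Ltac sd_ho ::= sd_ae.

Section AlmostEverywhere.
Context {M : setting}.
Implicit Types (a b c i j F S X Y : M).

Lemma ae_mono (P Q : M -> Prop) : ae P -> (forall a, a ∈ Pi -> P a -> Q a) -> ae Q.
Proof. by move=> [T [HT HP]] H; exists T; split=> // a Ha Hf; apply: H => //; apply: HP. Qed.

Lemma strategy_lam (G : M -> M) `{!Fun1 G} :
  (forall i a, i ∈ Om -> a ∈ Pi -> G (pair i a) ∈ um i) ->
  (forall i a b, i ∈ Om -> a ∈ Pi -> b ∈ Pi ->
    (forall j, j ∈ Om -> lt j i -> ap a j = ap b j) -> G (pair i a) = G (pair i b)) ->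
  strategy (lam (prod Om Pi) G).
Proof.
  move=> H1 H2; split.
  - by move=> i a Hi Ha; rewrite ap_lam ?pair_prod //; apply: H1.
  - by move=> i a b Hi Ha Hb E; rewrite !ap_lam ?pair_prod //; apply: H2.
Qed.

Lemma ae_intro (P : M -> Prop) (G : M -> M) `{!Fun1 G} :
  (forall i a, i ∈ Om -> a ∈ Pi -> G (pair i a) ∈ um i) ->
  (forall i a b, i ∈ Om -> a ∈ Pi -> b ∈ Pi ->
    (forall j, j ∈ Om -> lt j i -> ap a j = ap b j) -> G (pair i a) = G (pair i b)) ->
  (forall a, a ∈ Pi -> (forall i, i ∈ Om -> ap a i ∈ G (pair i a)) -> P a) -> ae P.
Proof.
  move=> H1 H2 H3; exists (lam (prod Om Pi) G); split; first exact: strategy_lam.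
  move=> a Ha Hf; apply: H3 => // i Hi; move: (Hf _ Hi).
  by rewrite ap_lam ?pair_prod.
Qed.

Lemma ae_true (P : M -> Prop) : (forall a, a ∈ Pi -> P a) -> ae P.
Proof.
  move=> H; apply: (ae_intro (G := fun q => fst (fst q))).
  - move=> i a Hi Ha; rewrite fst_pair; have [_ [_ [[_ []]]]] := Om_measure Hi; by [].
  - by move=> i a b _ _ _ _; rewrite !fst_pair.
  - by move=> a Ha _; apply: H.
Qed.

Lemma um_in_sep i X : i ∈ Om -> X ∈ um i -> sep (fst i) (fun c => c ∈ X) ∈ um i.
Proof.
  move=> Hi HX; have -> // : sep (fst i) (fun c => c ∈ X) = X.
  apply: ext => c; rewrite sepE; split=> [[]|Hc] //; split=> //.
  have [_ [_ [[Hs _] _]]] := Om_measure Hi; exact: (Hs _ HX).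
Qed.

Lemma ae_all (Y : M) (P : M -> M -> Prop) `{!Rel2 P} :
  (forall i, i ∈ Om -> sml Y (fst i)) ->
  (forall y, y ∈ Y -> ae (fun a => P y a)) -> ae (fun a => forall y, y ∈ Y -> P y a).
Proof.
  move=> HY H.
  (* Choosing strategies simultaneously requires that they come from one set, so each strategy is
     restricted to [prod Om Pi]. *)
  have H' y : y ∈ Y -> exists T, T ∈ funs (prod Om Pi) (pow (kap M)) /\
      strategy T /\ forall a, a ∈ Pi -> follows a T -> P y a.
  { move=> /H [T [[HT1 HT2] HT3]]; exists (lam (prod Om Pi) (fun q => ap T q)); split; last split.
    - apply/funsE; apply: fn_lam => q /prodE [i [Hi [a [Ha ->]]]]; apply/powE => c Hc.
      apply: (Om_kap Hi); have [_ [_ [[Hs _] _]]] := Om_measure Hi.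
      exact: (Hs _ (HT1 _ _ Hi Ha)).
    - exact: strategy_lam.
    - move=> a Ha Hf; apply: HT3 => // i Hi; move: (Hf _ Hi).
      by rewrite ap_lam ?pair_prod. }
  have [t [_ Ht]] := choice_rel (R := fun y T => strategy T /\
    forall a, a ∈ Pi -> follows a T -> P y a) H'.
  apply: (ae_intro (G := fun q => sep (fst (fst q)) (fun c => forall y, y ∈ Y -> c ∈ ap (ap t y) q))).
  - move=> i a Hi Ha; rewrite fst_pair.
    apply: (um_all (Om_measure Hi) (P := fun y c => c ∈ ap (ap t y) (pair i a))).
    + exact: HY.
    + move=> y Hy; have [[HT _] _] := Ht _ Hy; apply: um_in_sep => //; exact: HT.
  - move=> i a b Hi Ha Hb E; rewrite !fst_pair; apply: ext => c; rewrite !sepE.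
    have Ey y : y ∈ Y -> ap (ap t y) (pair i a) = ap (ap t y) (pair i b).
    { by move=> Hy; have [[_ HT] _] := Ht _ Hy; apply: HT. }
    by split=> -[Hc Hall]; split=> // y Hy; move: (Hall _ Hy); rewrite Ey.
  - move=> a Ha Hf y Hy; have [_ HT] := Ht _ Hy; apply: HT => // i Hi.
    by have /sepE [_] := Hf _ Hi; apply.
Qed.

Lemma ae_and (P Q : M -> Prop) : ae P -> ae Q -> ae (fun a => P a /\ Q a).
Proof.
  move=> [T [[HT1 HT2] HP]] [T' [[HT1' HT2'] HQ]].
  apply: (ae_intro (G := fun q => sep (fst (fst q)) (fun c => c ∈ ap T q /\ c ∈ ap T' q))).
  - move=> i a Hi Ha; rewrite fst_pair.
    apply: (um_and (Om_measure Hi) (P := fun c => c ∈ ap T (pair i a))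
      (Q := fun c => c ∈ ap T' (pair i a))); apply: um_in_sep => //; [exact: HT1|exact: HT1'].
  - move=> i a b Hi Ha Hb E; rewrite !fst_pair.
    by rewrite (HT2 i a b) // (HT2' i a b).
  - move=> a Ha Hf; split; [apply: HP => //|apply: HQ => //]; move=> i Hi;
    by have /sepE [_ []] := Hf _ Hi.
Qed.

(** Strategies are consulted at full points of the product only, so a partial point is completed by
    [emp], which belongs to every factor. *)
Definition cut (h i : M) : M := locked (lam Om (fun j => ite (lt j i) (ap h j) emp)).
#[local] Instance fun_cut : Fun2 cut.
Proof. rewrite /cut; sd. Qed.
Lemma cut_lt h i j : j ∈ Om -> lt j i -> ap (cut h i) j = ap h j.
Proof. by move=> Hj Hlt; rewrite /cut -lock ap_lam // iteT. Qed.
Lemma cut_Pi h i : (forall j, j ∈ Om -> lt j i -> ap h j ∈ fst j) -> cut h i ∈ Pi.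
Proof.
  move=> H; rewrite /cut -lock; apply: Pi_lam => j Hj; case: (classic (lt j i)) => Hlt.
  - by rewrite iteT //; apply: H.
  - by rewrite iteF //; apply: Om_emp.
Qed.
Lemma cut_lam h i : cut (lam (below Om lt i) (fun j => ap h j)) i = cut h i.
Proof.
  rewrite /cut -!lock; apply: lam_ext => j Hj; case: (classic (lt j i)) => Hlt.
  - by rewrite !iteT // ap_lam //; apply/sepE.
  - by rewrite !iteF.
Qed.

(** A point following the strategy is built by recursion along [lt], always taking the least
    permitted coordinate; measure one sets are not empty. *)
Lemma ae_ne (P : M -> Prop) : ae P -> exists a, a ∈ Pi /\ P a.
Proof.
  move=> [T [[HT1 HT2] HP]].
  pose (G := fun h i => least (fun c => c ∈ ap T (pair i (cut h i)))).
  have HG : Fun2 G by rewrite /G; sd.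
  pose (a := wfrec Om lt G).
  have Ea i : i ∈ Om -> ap a i = least (fun c => c ∈ ap T (pair i (cut a i))).
  { move=> Hi; rewrite {1}/a wfrecE //; first exact: lt_wf.
    by rewrite /G cut_lam. }
  have Ha0 : a = lam Om (fun i => ap a i).
  { by have [] := wfrec_spec (A := Om) (R := lt) (G := G) lt_wf. }
  clearbody a.
  have Hval i : i ∈ Om -> cut a i ∈ Pi -> ap a i ∈ ap T (pair i (cut a i)).
  { move=> Hi Hc; rewrite Ea //; have HT := HT1 _ _ Hi Hc.
    have Hm := Om_measure Hi.
    have [c [Hc1 Hc2]] := um_ne Hm (um_in_sep Hi HT).
    by have [] := least_spec (P := fun c => c ∈ ap T (pair i (cut a i)))
      (ord_in (um_ord Hm) Hc1) Hc2. }
  have Hin : forall i, i ∈ Om -> ap a i ∈ fst i.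
  { apply: (wf_ind (R := lt)); first exact: lt_wf.
    move=> i Hi IH; have Hc := cut_Pi IH.
    have [_ [_ [[Hs _] _]]] := Om_measure Hi; exact: (Hs _ (HT1 _ _ Hi Hc) _ (Hval _ Hi Hc)). }
  have Ha : a ∈ Pi by rewrite Ha0; apply: Pi_lam.
  exists a; split=> //; apply: HP => // i Hi.
  have Hc : cut a i ∈ Pi by apply: cut_Pi => j Hj _; apply: Hin.
  rewrite (HT2 _ _ _ Hi Ha Hc); first by move=> j Hj Hlt; rewrite cut_lt.
  exact: Hval.
Qed.

Definition depP (P : M -> Prop) (S : M) : Prop := forall a b, a ∈ Pi -> b ∈ Pi ->
  (forall i, i ∈ S -> ap a i = ap b i) -> P a -> P b.

(** One half of Fubini's theorem for the product filter. The strategy is refined at [i] to the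
    values [c] that make [P] true; this set depends on earlier coordinates only, because [P] looks
    at no coordinate after [i]. *)
Lemma ae_fubini (P : M -> Prop) `{!Rel1 P} i : i ∈ Om ->
  depP P (sep Om (fun j => lt j i \/ j = i)) ->
  ae (fun b => sep (fst i) (fun c => P (upd b i c)) ∈ um i) -> ae P.
Proof.
  move=> Hi Hd [T [[HT1 HT2] HP]].
  pose (X := fun a => sep (fst i) (fun c => P (upd a i c))).
  have ? : Fun1 X by rewrite /X; sd.
  pose (Q := fun q => fst q = i /\ X (snd q) ∈ um i).
  have ? : Rel1 Q by rewrite /Q; sd.
  have XE a b : a ∈ Pi -> b ∈ Pi -> (forall j, j ∈ Om -> lt j i -> ap a j = ap b j) -> X a = X b.
  { have Haux a' b' : a' ∈ Pi -> b' ∈ Pi ->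
      (forall j, j ∈ Om -> lt j i -> ap a' j = ap b' j) -> X a' ⊆ X b'.
    { move=> Ha Hb E c /sepE [Hc HPc]; apply/sepE; split=> //.
      apply: (Hd (upd a' i c)) => //; try exact: upd_Pi.
      move=> j /sepE [Hj [Hlt|->]]; last by rewrite !upd_eq.
      have Hne : j <> i by move=> Ej; subst j; apply: (lt_irr Hlt).
      by rewrite !upd_ne //; apply: E. }
    move=> Ha Hb E; apply: sub_antisym; apply: Haux => // j Hj Hlt; by rewrite E. }
  apply: (ae_intro (G := fun q => ite (Q q) (sep (fst i) (fun c => c ∈ ap T q /\ c ∈ X (snd q)))
    (ap T q))).
  - move=> j a Hj Ha; have HT := HT1 _ _ Hj Ha.
    case: (classic (Q (pair j a))) => HQ; last by rewrite iteF.
    rewrite iteT //; case: HQ; rewrite fst_pair snd_pair => E HX; subst j.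
    apply: (um_and (Om_measure Hi) (P := fun c => c ∈ ap T (pair i a)) (Q := fun c => c ∈ X a));
    exact: um_in_sep.
  - move=> j a b Hj Ha Hb E; have ET := HT2 _ _ _ Hj Ha Hb E.
    have EQ : j = i -> X a = X b by move=> Ej; subst j; apply: XE.
    case: (classic (Q (pair j a))) => HQ; move: (HQ); rewrite /Q fst_pair snd_pair.
    + move=> [Ej HX]; have HQb : Q (pair j b) by rewrite /Q fst_pair snd_pair -(EQ Ej).
      by rewrite !iteT // !snd_pair ET EQ.
    + move=> HQ'; have HQb : ~ Q (pair j b).
      { move=> [H1 H2]; apply: HQ'; move: H1 H2; rewrite fst_pair snd_pair => Ej.
        by rewrite -(EQ Ej). }
      by rewrite !iteF.
  - move=> a Ha Hf.
    have HaT : follows a T.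
    { move=> j Hj; move: (Hf _ Hj); case: (classic (Q (pair j a))) => HQ; last by rewrite iteF.
      by rewrite iteT // => /sepE [_ []]. }
    have HXa : X a ∈ um i by apply: HP.
    have : ap a i ∈ X a.
    { have HQ : Q (pair i a) by rewrite /Q fst_pair snd_pair.
      by move: (Hf _ Hi); rewrite iteT // snd_pair => /sepE [_ []]. }
    by move/sepE => [_]; rewrite upd_id.
Qed.

(** Since [lt] is a well-order, the sets all of whose nonempty subsets have a greatest element are
    those that are finite in the sense of the model. This form makes enumerations unnecessary. *)
Definition fin (F : M) : Prop := F ⊆ Om /\ forall S, S ⊆ F -> (exists x, x ∈ S) ->
  exists m, m ∈ S /\ forall j, j ∈ S -> lt j m \/ j = m.
#[global] Instance rel_fin : Rel1 fin.
Proof. rewrite /fin; sd. Qed.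

Lemma fin_sub F F' : fin F -> F' ⊆ F -> fin F'.
Proof.
  move=> [H1 H2] H; split; first by move=> x /H /H1.
  by move=> S HS; apply: H2 => x /HS /H.
Qed.
Lemma fin_emp : fin emp.
Proof. split; [by move=> x /empE|by move=> S HS [x /HS /empE]]. Qed.
Lemma fin_sing i : i ∈ Om -> fin (sing i).
Proof.
  move=> Hi; split; first by move=> x /singE ->.
  move=> S HS [x Hx]; exists x; split=> // j Hj; right.
  by rewrite (proj1 (singE _ _) (HS _ Hx)) (proj1 (singE _ _) (HS _ Hj)).
Qed.
Lemma fin_cup F F' : fin F -> fin F' -> fin (cup F F').
Proof.
  move=> [H1 H2] [H1' H2']; have HO : cup F F' ⊆ Om by move=> x /cupE [/H1|/H1'].
  split=> // S HS HSne.
  have [|Hn] := classic (exists x, x ∈ sep S (fun x => x ∈ F)); last first.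
  { apply: H2' => // x Hx; case/cupE: (HS _ Hx) => // HF.
    by case: Hn; exists x; apply/sepE. }
  have HsF : sep S (fun x => x ∈ F) ⊆ F by move=> x /sepE [].
  move/(H2 _ HsF) => [m [/sepE [Hm HmF] Hmax]].
  have [|Hn] := classic (exists x, x ∈ sep S (fun x => x ∈ F')); last first.
  { exists m; split=> // j Hj; apply: Hmax; apply/sepE; split=> //.
    by case/cupE: (HS _ Hj) => // HF; case: Hn; exists j; apply/sepE. }
  have HsF' : sep S (fun x => x ∈ F') ⊆ F' by move=> x /sepE [].
  move/(H2' _ HsF') => [m' [/sepE [Hm' HmF'] Hmax']].
  have Hcase j : j ∈ S -> (lt j m \/ j = m) \/ (lt j m' \/ j = m').
  { by move=> Hj; case/cupE: (HS _ Hj) => HF; [left; apply: Hmax|right; apply: Hmax']; apply/sepE. }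
  have HmO := HO _ (HS _ Hm); have HmO' := HO _ (HS _ Hm').
  case: (lt_linear HmO HmO') => [H|[E|H]].
  - exists m'; split=> // j Hj; case: (Hcase _ Hj) => // -[Hl|->]; last by left.
    by left; apply: (lt_trans HmO' Hl).
  - by subst m'; exists m; split=> // j Hj; case: (Hcase _ Hj).
  - exists m; split=> // j Hj; case: (Hcase _ Hj) => // -[Hl|->]; last by left.
    by left; apply: (lt_trans HmO Hl).
Qed.

(** The greatest index is removed, to match [ae_fubini], which integrates out the last coordinate of
    a support. *)
Lemma fin_ind (P : M -> Prop) `{!Rel1 P} : P emp ->
  (forall F i, fin F -> i ∈ F -> (forall j, j ∈ F -> lt j i \/ j = i) ->
    P (sep F (fun j => lt j i)) -> P F) -> forall F, fin F -> P F.
Proof.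
  move=> H0 HS F HF; have [HFO HFm] := HF.
  pose (cutF := fun i => sep F (fun j => lt j i \/ j = i)).
  have ? : Fun1 cutF by rewrite /cutF; sd.
  have Hall : forall i, i ∈ F -> P (cutF i).
  { have Hwf : wf F lt by move=> S HSF; apply: lt_wf => x /HSF /HFO.
    apply: (wf_ind (R := lt) (P := fun i => P (cutF i))) => // i Hi IH.
    have Hfc : fin (cutF i) by apply: (fin_sub HF) => x /sepE [].
    apply: (HS _ i) => //.
    - by apply/sepE; split=> //; right.
    - by move=> j /sepE [].
    - have E : sep (cutF i) (fun j => lt j i) = sep F (fun j => lt j i).
      { by apply: ext => j; rewrite /cutF !sepE; tauto. }
      rewrite E; case: (classic (exists j, j ∈ sep F (fun j => lt j i))) => Hne.
      + have [|m [/sepE [Hm Hmi] Hmax]] := HFm (sep F (fun j => lt j i)) _ Hne.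
        { by move=> j /sepE []. }
        have -> : sep F (fun j => lt j i) = cutF m; last exact: IH.
        apply: ext => j; rewrite /cutF !sepE; split=> -[Hj H]; split=> //.
        * by apply: Hmax; apply/sepE.
        * by case: H => [H|-> //]; apply: (lt_trans (HFO _ Hi) H).
      + have -> // : sep F (fun j => lt j i) = emp.
        by apply: ext => j; split=> [Hj|/empE //]; case: Hne; exists j. }
  case: (classic (exists i, i ∈ F)) => Hne.
  - have [//|m [Hm Hmax]] := HFm F _ Hne.
    have -> : F = cutF m; last exact: Hall.
    by apply: ext => j; rewrite /cutF sepE; split=> [Hj|[]] //; split=> //; apply: Hmax.
  - have -> // : F = emp.
    by apply: ext => j; split=> [Hj|/empE //]; case: Hne; exists j.
Qed.

Lemma depP_sub (P : M -> Prop) S S' : depP P S -> S ⊆ S' -> depP P S'.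
Proof. by move=> H HS a b Ha Hb E; apply: H => // i /HS; apply: E. Qed.

Lemma ae_dec (P : M -> Prop) `{!Rel1 P} F : fin F -> depP P F -> ae P \/ ae (fun a => ~ P a).
Proof.
  move=> HF HP.
  (* The induction needs a statement definable in the model, so it quantifies over subsets of the
     product instead of Rocq predicates. *)
  have Hall : forall X, depP (fun a => a ∈ X) F -> ae (fun a => a ∈ X) \/ ae (fun a => ~ a ∈ X).
  { move: F HF {HP}.
    have ? : Rel1 (fun F => forall X, depP (fun a => a ∈ X) F ->
      ae (fun a => a ∈ X) \/ ae (fun a => ~ a ∈ X)) by rewrite /depP; sd.
    apply: fin_ind.
    - move=> X HX; case: (classic (exists a, a ∈ Pi /\ a ∈ X)) => [[a [Ha HaX]]|Hn].
      + by left; apply: ae_true => b Hb; apply: (HX a b) => // i /empE.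
      + by right; apply: ae_true => b Hb HbX; apply: Hn; exists b.
    - move=> F i HF Hi Hmax IH X HX; have HiO := proj1 HF _ Hi.
      have HFO : F ⊆ sep Om (fun j => lt j i \/ j = i).
      { by move=> j Hj; apply/sepE; split; [apply: (proj1 HF)|apply: Hmax]. }
      (* The points whose section of [X] in the last coordinate [i] has measure one; the support of
         this set no longer contains [i]. *)
      pose (D := sep Pi (fun b => sep (fst i) (fun c => upd b i c ∈ X) ∈ um i)).
      have HD : depP (fun a => a ∈ D) (sep F (fun j => lt j i)).
      { move=> a b Ha Hb E /sepE [_ HaD]; apply/sepE; split=> //.
        apply: (um_mono (Om_measure HiO) HaD) => c Hc; apply: HX; try exact: upd_Pi.
        move=> j Hj; case: (Hmax _ Hj) => [Hlt|->]; last by rewrite !upd_eq.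
        have Hne : j <> i by move=> Ej; subst j; apply: (lt_irr Hlt).
        rewrite !upd_ne //; try exact: (proj1 HF); by apply: E; apply/sepE. }
      case: (IH _ HD) => H.
      + left; apply: (ae_fubini HiO); first exact: (depP_sub HX).
        by apply: (ae_mono H) => b Hb /sepE [].
      + right; apply: (ae_fubini (P := fun a => ~ a ∈ X) HiO).
        * move=> a b Ha Hb E HaX HbX; apply: HaX; apply: (HX b a) => // j Hj.
          by rewrite E //; apply: HFO.
        * apply: (ae_mono H) => b Hb HbD.
          apply/(um_not (Om_measure HiO) (P := fun c => upd b i c ∈ X)) => HbX.
          by apply: HbD; apply/sepE. }
  case: (Hall (sep Pi P)) => [|H|H].
  - by move=> a b Ha Hb E /sepE [_ HPa]; apply/sepE; split=> //; apply: (HP a).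
  - by left; apply: (ae_mono H) => a Ha /sepE [].
  - by right; apply: (ae_mono H) => a Ha HaP HPa; apply: HaP; apply/sepE.
Qed.
End AlmostEverywhere.

(** * Iterated ultrapowers *)

Lemma sat_fv {M : set_structure} (f : formula) : exists n, forall e e' : nat -> M,
  (forall i, i < n -> e i = e' i) -> sat e f <-> sat e' f.
Proof.
  elim: f => /=.
  - move=> i j; exists (S (i + j)) => e e' H; rewrite !H //; lia.
  - move=> i j; exists (S (i + j)) => e e' H; rewrite !H //; lia.
  - by move=> f [n IH]; exists n => e e' H; rewrite (IH e e').
  - move=> f [n IHf] g [m IHg]; exists (n + m) => e e' H.
    rewrite (IHf e e') ?(IHg e e') // => i Hi; apply: H; lia.
  - move=> f [n IHf] g [m IHg]; exists (n + m) => e e' H.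
    rewrite (IHf e e') ?(IHg e e') // => i Hi; apply: H; lia.
  - move=> f [n IHf] g [m IHg]; exists (n + m) => e e' H.
    rewrite (IHf e e') ?(IHg e e') // => i Hi; apply: H; lia.
  - move=> f [n IH]; exists n => e e' H.
    have E x : sat (scons x e) f <-> sat (scons x e') f.
    { by apply: IH => -[//|i] Hi /=; apply: H; lia. }
    by split=> Hs x; apply/E.
  - move=> f [n IH]; exists n => e e' H.
    have E x : sat (scons x e) f <-> sat (scons x e') f.
    { by apply: IH => -[//|i] Hi /=; apply: H; lia. }
    by split=> -[x Hs]; exists x; apply/E.
Qed.

Lemma scons_map {A B : Type} (F : A -> B) x e :
  scons (F x) (fun i => F (e i)) = fun i => F (scons x e i).
Proof. by apply: functional_extensionality; case. Qed.

Section Ultrapower.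
Context {M : setting}.
Implicit Types (a b c g h k F I J N S X Y : M).

Definition depg (g F : M) : Prop := forall a b, a ∈ Pi -> b ∈ Pi ->
  (forall i, i ∈ F -> ap a i = ap b i) -> ap g a = ap g b.
#[global] Instance rel_depg : Rel2 depg.
Proof. rewrite /depg; sd. Qed.

Lemma depg_sub g F F' : depg g F -> F ⊆ F' -> depg g F'.
Proof. by move=> H HS a b Ha Hb E; apply: H => // i /HS; apply: E. Qed.

(** All iterations use the same product over [Om]; the iteration along [I] merely restricts the
    supports to [I]. *)
Definition FS (N I : M) : M :=
  locked (sep (funs Pi N) (fun g => exists F, fin F /\ F ⊆ I /\ depg g F)).
#[global] Instance fun_FS : Fun2 FS.
Proof. rewrite /FS; sd. Qed.
Lemma FSE N I g : g ∈ FS N I <->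
  is_function g Pi N /\ exists F, fin F /\ F ⊆ I /\ depg g F.
Proof. by rewrite /FS -lock sepE funsE. Qed.
Lemma FS_val N I g a : g ∈ FS N I -> a ∈ Pi -> ap g a ∈ N.
Proof. by move/FSE => [H _]; apply: fn_val. Qed.
Lemma FS_mono N N' I I' g : N ⊆ N' -> I ⊆ I' -> g ∈ FS N I -> g ∈ FS N' I'.
Proof.
  move=> HN HI /FSE [Hg [F [HF [HFI Hd]]]]; apply/FSE; split.
  - by apply: (fn_sub Hg) => a Ha; apply: HN; apply: (fn_val Hg).
  - by exists F; split=> //; split=> // i /HFI /HI.
Qed.
Lemma FS_lam N I F (K : M -> M) `{!Fun1 K} : (forall a, a ∈ Pi -> K a ∈ N) ->
  fin F -> F ⊆ I ->
  (forall a b, a ∈ Pi -> b ∈ Pi -> (forall i, i ∈ F -> ap a i = ap b i) -> K a = K b) ->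
  lam Pi K ∈ FS N I.
Proof.
  move=> HK HF HFI Hd; apply/FSE; split; first exact: fn_lam.
  exists F; split=> //; split=> // a b Ha Hb E; rewrite !ap_lam //; exact: Hd.
Qed.

Definition cst (c : M) : M := locked (lam Pi (fun _ => c)).
#[global] Instance fun_cst : Fun1 cst.
Proof. rewrite /cst; sd. Qed.
Lemma cstE c a : a ∈ Pi -> ap (cst c) a = c.
Proof. by move=> Ha; rewrite /cst -lock ap_lam. Qed.
Lemma cst_FS N I c : c ∈ N -> cst c ∈ FS N I.
Proof.
  move=> Hc; rewrite /cst -lock; apply: (FS_lam (F := emp)) => //; first exact: fin_emp.
  by move=> i /empE.
Qed.

Definition inW (g h : M) : Prop := ae (fun a => ap g a ∈ ap h a).
#[global] Instance rel_inW : Rel2 inW.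
Proof. rewrite /inW; sd. Qed.
Definition eqW (g h : M) : Prop := ae (fun a => ap g a = ap h a).
#[global] Instance rel_eqW : Rel2 eqW.
Proof. rewrite /eqW; sd. Qed.

Lemma eqW_refl g : eqW g g.
Proof. exact: ae_true. Qed.
Lemma eqW_sym g h : eqW g h -> eqW h g.
Proof. by move=> H; apply: (ae_mono H). Qed.
Lemma eqW_trans g h k : eqW g h -> eqW h k -> eqW g k.
Proof. by move=> H H'; apply: (ae_mono (ae_and H H')) => a Ha [-> ->]. Qed.
Lemma inW_eql g g' h : eqW g g' -> inW g h -> inW g' h.
Proof. by move=> H H'; apply: (ae_mono (ae_and H H')) => a Ha [<-]. Qed.
Lemma inW_eqr g h h' : eqW h h' -> inW g h -> inW g h'.
Proof. by move=> H H'; apply: (ae_mono (ae_and H H')) => a Ha [<-]. Qed.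

Lemma Om_omega : exists w : M, is_omega w /\ forall i, i ∈ @Om M -> w ∈ fst i.
Proof.
  have [_ [Hne _]] := kap_limit M.
  have [x Hx] : exists x, x ∈ kap M by apply: NNPP => H; apply: Hne => z Hz; apply: H; exists z.
  have [d [Hd _]] := Me_cofinal Hx; have [_ [[w [Hw _]] _]] := Me_measure Hd.
  exists w; split=> // i Hi; have [_ [[w' [Hw' Hwi]] _]] := Om_measure Hi.
  by rewrite (omega_unique Hw Hw').
Qed.

(** A descending sequence of functions imposes countably many conditions, each true almost
    everywhere. Some point satisfies all of them, and there the values descend in the model, against
    foundation. *)
Lemma inW_wf N I : wf (FS N I) inW.
Proof.
  move=> S HS [g0 Hg0]; apply: NNPP => Hno.
  have Hs g : g ∈ S -> exists h, h ∈ S /\ inW h g.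
  { move=> Hg; apply: NNPP => H; apply: Hno; exists g; split=> // h Hh Hin.
    by apply: H; exists h. }
  have [s [Hsf Hsin]] := choice_rel (R := fun g h => inW h g) Hs.
  have [w [Hw Hwi]] := Om_omega.
  have [f [Hf0 HfS]] := omega_rec Hw g0 (G := fun x => ap s x).
  have HfIn : forall n, n ∈ w -> ap f n ∈ S.
  { apply: (omega_ind Hw) => [|n Hn IH]; first by rewrite Hf0.
    by rewrite HfS //; apply: (fn_val Hsf). }
  have Hall : ae (fun a => forall n, n ∈ w -> ap (ap f (succ n)) a ∈ ap (ap f n) a).
  { apply: (ae_all (P := fun n a => ap (ap f (succ n)) a ∈ ap (ap f n) a)).
    - by move=> i Hi; apply: sml_mem; apply: Hwi.
    - by move=> n Hn; rewrite HfS //; apply: Hsin; apply: HfIn. }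
  have [a [Ha Hdec]] := ae_ne Hall.
  have [|y [/replE [n [Hn ->]] Hmin]] := foundation (S := repl w (fun n => ap (ap f n) a)).
  { by exists (ap (ap f emp) a); apply/replE; exists emp; split=> //; exact: omega0. }
  apply: (Hmin (ap (ap f (succ n)) a)); last exact: Hdec.
  by apply/replE; exists (succ n); split=> //; exact: omegaS.
Qed.

(** The element of the iterated ultrapower of [N] along [I] that [g] represents; functions equal
    almost everywhere get the same value. *)
Definition pi (N I g : M) : M := locked (ap (clp (FS N I) inW) g).
#[global] Instance fun_pi : Fun3 pi.
Proof. rewrite /pi; sd. Qed.
Lemma piE N I g z : g ∈ FS N I ->
  (z ∈ pi N I g <-> exists h, h ∈ FS N I /\ inW h g /\ z = pi N I h).
Proof.
  move=> Hg; rewrite /pi -lock clpE //; first exact: inW_wf.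
  by split=> -[h [H1 [H2 H3]]]; exists h; move: H3; rewrite -lock.
Qed.

Lemma pi_eqW N I g h : g ∈ FS N I -> h ∈ FS N I -> eqW g h -> pi N I g = pi N I h.
Proof.
  move=> Hg Hh E; apply: ext => z; rewrite !piE //.
  split=> -[k [Hk [Hkg Ez]]]; exists k; split=> //; split=> //.
  - exact: (inW_eqr E).
  - exact: (inW_eqr (eqW_sym E)).
Qed.

Lemma FS_fin2 N I g h : g ∈ FS N I -> h ∈ FS N I ->
  exists F, fin F /\ F ⊆ I /\ depg g F /\ depg h F.
Proof.
  move=> /FSE [_ [F [H1 [H2 H3]]]] /FSE [_ [F' [H1' [H2' H3']]]].
  exists (cup F F'); split; first exact: fin_cup.
  split; first by move=> x /cupE [/H2|/H2'].
  by split; [apply: (depg_sub H3)|apply: (depg_sub H3')] => x Hx; apply/cupE; [left|right].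
Qed.

(** The set of possible witnesses at [a] depends only on the coordinates in [F], hence so does the
    witness chosen from it. The value [n0] is a default where there is none. *)
Lemma FS_pick N I F (K : M -> M -> Prop) `{!Rel2 K} : fin F -> F ⊆ I ->
  (forall z a b, a ∈ Pi -> b ∈ Pi -> (forall i, i ∈ F -> ap a i = ap b i) -> K a z -> K b z) ->
  ae (fun a => exists z, z ∈ N /\ K a z) ->
  exists h, h ∈ FS N I /\ ae (fun a => K a (ap h a)).
Proof.
  move=> HF HFI Hd Hae; have [a0 [_ [n0 [Hn0 _]]]] := ae_ne Hae.
  have [c Hc] := choice_fn (pow N).
  pose (Kh := fun a => ite (exists z, z ∈ N /\ K a z) (ap c (sep N (fun z => K a z))) n0).
  have ? : Fun1 Kh by rewrite /Kh; sd.
  have Hpick a : (exists z, z ∈ N /\ K a z) -> Kh a ∈ N /\ K a (Kh a).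
  { move=> Hz; rewrite /Kh iteT //.
    have /sepE [] // : ap c (sep N (fun z => K a z)) ∈ sep N (fun z => K a z).
    apply: Hc; first by apply/powE => z /sepE [].
    by case: Hz => z [Hz HK]; exists z; apply/sepE. }
  exists (lam Pi Kh); split.
  - apply: (FS_lam (F := F)) => //.
    + move=> a Ha; case: (classic (exists z, z ∈ N /\ K a z)) => H; first by case: (Hpick a H).
      by rewrite /Kh iteF.
    + move=> a b Ha Hb E; have EK z : K a z <-> K b z.
      { by split; apply: Hd => // i Hi; rewrite E. }
      have Es : sep N (fun z => K a z) = sep N (fun z => K b z).
      { by apply: ext => z; rewrite !sepE EK. }
      rewrite /Kh Es; case: (classic (exists z, z ∈ N /\ K a z)) => H.
      * rewrite !iteT //; by case: H => z [Hz HK]; exists z; split=> //; apply/EK.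
      * rewrite !iteF //; by move=> [z [Hz HK]]; apply: H; exists z; split=> //; apply/EK.
  - by apply: (ae_mono Hae) => a Ha H; rewrite ap_lam //; case: (Hpick a H).
Qed.

(** * Łoś's theorem for bounded formulas *)

Section Los.
Variables N I : M.
Hypothesis HN : transitive N.

(** The collapse makes no further identifications. If elements of [ap g a] outside [ap h a] existed
    almost everywhere, [FS_pick] would collect them into some [k]; its value would also be
    represented by a member of [h], which by induction equals [k] almost everywhere. Since such
    conditions are decided, both inclusions hold almost everywhere. *)
Lemma pi_inj : forall g, g ∈ FS N I -> forall h, h ∈ FS N I -> pi N I g = pi N I h -> eqW g h.
Proof.
  apply: (wf_ind (R := inW) (P := fun g => forall h, h ∈ FS N I -> pi N I g = pi N I h -> eqW g h)).
  { exact: inW_wf. }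
  move=> g Hg IH h Hh E; have [F [HF [HFI [Hdg Hdh]]]] := FS_fin2 Hg Hh.
  have Dg a b : a ∈ Pi -> b ∈ Pi -> (forall i, i ∈ F -> ap a i = ap b i) -> ap g a = ap g b.
  { exact: Hdg. }
  have Dh a b : a ∈ Pi -> b ∈ Pi -> (forall i, i ∈ F -> ap a i = ap b i) -> ap h a = ap h b.
  { exact: Hdh. }
  have H1 : ~ ae (fun a => exists z, z ∈ N /\ (z ∈ ap g a /\ ~ z ∈ ap h a)).
  { move=> Hae.
    (* The explicit term rewrites along [Dg] and [Dh]: the condition on [z] depends only on the
       coordinates in [F]. *)
    have [k [Hk Hkae]] := FS_pick (K := fun a z => z ∈ ap g a /\ ~ z ∈ ap h a) HF HFI
      (fun z a b Ha Hb Eab => eq_ind _ (fun v => _ -> z ∈ v /\ _)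
        (eq_ind _ (fun v => _ -> _ /\ ~ z ∈ v) (fun x => x) _ (Dh a b Ha Hb Eab))
        _ (Dg a b Ha Hb Eab)) Hae.
    have Hkg : inW k g by apply: (ae_mono Hkae) => a Ha [].
    have : pi N I k ∈ pi N I h by rewrite -E; apply/piE => //; exists k.
    move/piE => /(_ Hh) [k' [Hk' [Hk'h Ek]]].
    have Hkk := IH _ Hk Hkg _ Hk' Ek.
    have [a [Ha [[_ Hn] [Ekk Hin]]]] := ae_ne (ae_and Hkae (ae_and Hkk Hk'h)).
    by apply: Hn; rewrite Ekk. }
  have H2 : ~ ae (fun a => exists z, z ∈ N /\ (z ∈ ap h a /\ ~ z ∈ ap g a)).
  { move=> Hae.
    have [k [Hk Hkae]] := FS_pick (K := fun a z => z ∈ ap h a /\ ~ z ∈ ap g a) HF HFI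
      (fun z a b Ha Hb Eab => eq_ind _ (fun v => _ -> z ∈ v /\ _)
        (eq_ind _ (fun v => _ -> _ /\ ~ z ∈ v) (fun x => x) _ (Dg a b Ha Hb Eab))
        _ (Dh a b Ha Hb Eab)) Hae.
    have Hkh : inW k h by apply: (ae_mono Hkae) => a Ha [].
    have : pi N I k ∈ pi N I g by rewrite E; apply/piE => //; exists k.
    move/piE => /(_ Hg) [k' [Hk' [Hk'g Ek]]].
    have Hkk := IH _ Hk' Hk'g _ Hk (eq_sym Ek).
    have [a [Ha [[_ Hn] [Ekk Hin]]]] := ae_ne (ae_and Hkae (ae_and Hkk Hk'g)).
    by apply: Hn; rewrite -Ekk. }
  have D1 : depP (fun a => exists z, z ∈ N /\ (z ∈ ap g a /\ ~ z ∈ ap h a)) F.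
  { by move=> a b Ha Hb Eab; rewrite (Dg a b) // (Dh a b). }
  have D2 : depP (fun a => exists z, z ∈ N /\ (z ∈ ap h a /\ ~ z ∈ ap g a)) F.
  { by move=> a b Ha Hb Eab; rewrite (Dg a b) // (Dh a b). }
  case: (ae_dec HF D1) => // H1'; case: (ae_dec HF D2) => // H2'.
  apply: (ae_mono (ae_and H1' H2')) => a Ha [Hn1 Hn2]; apply: ext => z; split=> Hz.
  - apply: NNPP => Hn; apply: Hn1; exists z; split=> //; exact: (HN (FS_val Hg Ha)).
  - apply: NNPP => Hn; apply: Hn2; exists z; split=> //; exact: (HN (FS_val Hh Ha)).
Qed.

Lemma pi_eqE g h : g ∈ FS N I -> h ∈ FS N I -> (pi N I g = pi N I h <-> eqW g h).
Proof. by move=> Hg Hh; split; [apply: pi_inj|apply: pi_eqW]. Qed.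
Lemma pi_memE g h : g ∈ FS N I -> h ∈ FS N I -> (pi N I g ∈ pi N I h <-> inW g h).
Proof.
  move=> Hg Hh; rewrite piE //; split=> [[k [Hk [Hkh E]]]|H]; last by exists g.
  by apply: (inW_eql _ Hkh); apply: eqW_sym; apply: pi_inj.
Qed.

Lemma fin_env (e : nat -> M) n : (forall i, e i ∈ FS N I) ->
  exists F, fin F /\ F ⊆ I /\ forall i, i < n -> depg (e i) F.
Proof.
  move=> He; elim: n => [|n [F [HF [HFI Hd]]]].
  - by exists emp; split; [exact: fin_emp|split; [move=> x /empE|lia]].
  - have /FSE [_ [F' [HF' [HFI' Hd']]]] := He n.
    exists (cup F F'); split; first exact: fin_cup.
    split; first by move=> x /cupE [/HFI|/HFI'].
    move=> i Hi; case: (Nat.eq_dec i n) => [->|Hne].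
    + by apply: (depg_sub Hd') => x Hx; apply/cupE; right.
    + by apply: (depg_sub (Hd i ltac:(lia))) => x Hx; apply/cupE; left.
Qed.

Lemma sat_dep (f : formula) (e : nat -> M) : (forall i, e i ∈ FS N I) ->
  exists F, fin F /\ F ⊆ I /\ depP (fun a => sat (fun i => ap (e i) a) f) F.
Proof.
  move=> He; have [n Hn] := @sat_fv M f.
  have [F [HF [HFI Hd]]] := fin_env n He.
  exists F; split=> //; split=> // a b Ha Hb E; apply: (proj1 (Hn _ _ _)) => i Hi.
  exact: (Hd i Hi).
Qed.

#[local] Instance rel_sat (f : formula) (e : nat -> M) :
  Rel1 (fun a : M => sat (fun i => ap (e i) a) f).
Proof. rewrite /Rel1; apply: def_sat => i; sd. Qed.

Let los_for (f : formula) : Prop := forall e : nat -> M, (forall i, e i ∈ FS N I) ->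
  sat (fun i => pi N I (e i)) f <-> ae (fun a => sat (fun i => ap (e i) a) f).

Lemma los_not f : los_for f -> los_for (FNot f).
Proof.
  move=> IH e He /=; rewrite IH //; split.
  - have [F [HF [HFI Hd]]] := sat_dep f He.
    by case: (ae_dec HF Hd).
  - by move=> H H'; have [a [_ [H1 H2]]] := ae_ne (ae_and H H').
Qed.

(** The bound makes [FS_pick] applicable: witnesses belong to values of [e i], hence to the
    transitive set [N]. An unbounded quantifier would lack such a set. *)
Lemma los_bex i f : los_for f -> los_for (FEx (FAnd (FMem 0 (S i)) f)).
Proof.
  move=> IH e He /=; split.
  - move=> [x [/piE Hx Hs]]; have [h [Hh [Hhe Ex]]] := Hx (He i); subst x.
    rewrite scons_map in Hs; move/IH: Hs => Hs.
    have {}Hs : ae (fun a => sat (fun i => ap (scons h e i) a) f) by apply: Hs => -[].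
    apply: (ae_mono (ae_and Hhe Hs)) => a Ha [H1 H2].
    by exists (ap h a); split=> //; rewrite (scons_map (fun g => ap g a)).
  - move=> Hae; have [F [HF [HFI Hd]]] : exists F, fin F /\ F ⊆ I /\
      forall z a b, a ∈ Pi -> b ∈ Pi -> (forall i, i ∈ F -> ap a i = ap b i) ->
      (z ∈ ap (e i) a /\ sat (scons z (fun j => ap (e j) a)) f) ->
      (z ∈ ap (e i) b /\ sat (scons z (fun j => ap (e j) b)) f).
    { have [n Hn] := @sat_fv M f; have [F [HF [HFI Hd]]] := fin_env (S i + n) He.
      exists F; split=> //; split=> // z a b Ha Hb E [Hz Hs]; split.
      - by rewrite -(Hd i ltac:(lia) a b Ha Hb E).
      - apply: (proj1 (Hn _ _ _) Hs) => -[//|j] Hj /=; exact: (Hd j ltac:(lia) a b Ha Hb E). }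
    have HK : Rel2 (fun a z : M => z ∈ ap (e i) a /\ sat (scons z (fun j => ap (e j) a)) f).
    { have H1 : Def (fun v : nat -> M => v 1 ∈ ap (e i) (v 0)) by sd.
      have H2 : Def (fun v : nat -> M => sat (scons (v 1) (fun j => ap (e j) (v 0))) f).
      { have -> : (fun v : nat -> M => sat (scons (v 1) (fun j => ap (e j) (v 0))) f) =
          (fun v => sat (fun j => (match j with 0 => fun v => v 1
            | S j => fun v => ap (e j) (v 0) end) v) f).
        { apply: functional_extensionality => v; congr (sat _ f).
          by apply: functional_extensionality => -[]. }
        by apply: def_sat => -[|j]; sd. }
      exact (def_and H1 H2). }
    have [|h [Hh Hhae]] := FS_pick (N := N)
      (K := fun a z => z ∈ ap (e i) a /\ sat (scons z (fun j => ap (e j) a)) f) HF HFI Hd.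
    { apply: (ae_mono Hae) => a Ha [z [Hz Hs]]; exists z; split=> //.
      exact: (HN (FS_val (He i) Ha)). }
    exists (pi N I h); split.
    + by apply/pi_memE => //; apply: (ae_mono Hhae) => a Ha [].
    + rewrite scons_map; apply/IH; first by case.
      by apply: (ae_mono Hhae) => a Ha [_]; rewrite (scons_map (fun g => ap g a)).
Qed.

Lemma los_and (f g : formula) : los_for f -> los_for g -> los_for (FAnd f g).
Proof.
  move=> IHf IHg e He /=; rewrite IHf // IHg //; split.
  - by move=> [H H']; apply: ae_and.
  - by move=> H; split; apply: (ae_mono H) => a Ha [].
Qed.

Lemma los_equiv (f g : formula) : (forall e : nat -> M, sat e f <-> sat e g) -> los_for f -> los_for g.
Proof.
  move=> E IH e He; rewrite -E IH //.
  by split=> H; apply: (ae_mono H) => a Ha; rewrite E.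
Qed.

Lemma los (f : formula) : delta0 f -> los_for f.
Proof.
  elim=> {f}.
  - by move=> i j e He /=; rewrite pi_memE.
  - by move=> i j e He /=; rewrite pi_eqE.
  - by move=> f _ IH; apply: los_not.
  - by move=> f g _ IHf _ IHg; apply: los_and.
  - move=> f g _ IHf _ IHg; apply: (los_equiv (f := FNot (FAnd (FNot f) (FNot g)))).
    + by move=> e /=; tauto.
    + by apply: los_not; apply: los_and; apply: los_not.
  - move=> f g _ IHf _ IHg; apply: (los_equiv (f := FNot (FAnd f (FNot g)))).
    + by move=> e /=; tauto.
    + by apply: los_not; apply: los_and => //; apply: los_not.
  - move=> i f _ IH; apply: (los_equiv (f := FNot (FEx (FAnd (FMem 0 (S i)) (FNot f))))).
    + move=> e /=; split.
      * by move=> H x Hx; apply: NNPP => Hn; apply: H; exists x.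
      * by move=> H [x [Hx Hn]]; apply: Hn; apply: H.
    + by apply: los_not; apply: los_bex; apply: los_not.
  - by move=> i f _ IH; apply: los_bex.
Qed.
End Los.
End Ultrapower.

(** * Finitely supported functions *)

Section Images.
Context {M : setting}.
Implicit Types (a b c d e i j g h k F I J N S X Y x y : M).

Lemma dep_upd (K : M -> M) F i : fin F -> i ∈ F ->
  (forall j, j ∈ F -> lt j i \/ j = i) ->
  (forall a b, a ∈ Pi -> b ∈ Pi -> (forall j, j ∈ F -> ap a j = ap b j) -> K a = K b) ->
  forall a b, a ∈ Pi -> b ∈ Pi ->
  (forall j, j ∈ sep F (fun j => lt j i) -> ap a j = ap b j) ->
  forall c, c ∈ fst i -> K (upd a i c) = K (upd b i c).
Proof.
  move=> HF Hi Hmax HK a b Ha Hb E c Hc; have HiO := proj1 HF _ Hi.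
  apply: HK; try exact: upd_Pi.
  move=> j Hj; have HjO := proj1 HF _ Hj.
  case: (Hmax _ Hj) => [Hlt|->]; last by rewrite !upd_eq.
  have Hne : j <> i by move=> Ej; subst j; apply: (lt_irr Hlt).
  by rewrite !upd_ne //; apply: E; apply/sepE.
Qed.

(** In a coordinate [i] whose measure lives on a cardinal above the number of possible values, a
    function is almost constant. The coordinates outside [J] all come after [J], so they are
    eliminated one by one from the end. *)
Lemma drop N J H F : J ⊆ Om -> depg H J -> fin F ->
  (forall i, i ∈ F -> ~ i ∈ J -> (forall j, j ∈ J -> lt j i) /\
     forall a, a ∈ Pi -> sml (ap H a) (fst i)) ->
  forall g, is_function g Pi N -> depg g F -> (forall a, a ∈ Pi -> ap g a ∈ ap H a) ->
  exists g', is_function g' Pi N /\ depg g' (sep F (fun i => i ∈ J)) /\ eqW g g'.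
Proof.
  move=> HJO HH HF; move: F HF.
  have ? : Rel1 (fun F => (forall i, i ∈ F -> ~ i ∈ J -> (forall j, j ∈ J -> lt j i) /\
     forall a, a ∈ Pi -> sml (ap H a) (fst i)) ->
    forall g, is_function g Pi N -> depg g F -> (forall a, a ∈ Pi -> ap g a ∈ ap H a) ->
    exists g', is_function g' Pi N /\ depg g' (sep F (fun i => i ∈ J)) /\ eqW g g') by sd.
  apply: fin_ind.
  - move=> _ g Hg Hd Hin; exists g; split=> //; split; last exact: eqW_refl.
    by move=> a b Ha Hb _; apply: Hd => // i /empE.
  - move=> F i HF Hi Hmax IH Hcond g Hg Hd Hin; have HiO := proj1 HF _ Hi.
    (* If the greatest index lies in [J], then all of [F] does, and nothing has to be eliminated. *)
    case: (classic (i ∈ J)) => HiJ.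
    { exists g; split=> //; split; last exact: eqW_refl.
      apply: (depg_sub Hd) => j Hj; apply/sepE; split=> //; apply: NNPP => HjJ.
      have [/(_ _ HiJ) Hlt _] := Hcond _ Hj HjJ; have HjO := proj1 HF _ Hj.
      case: (Hmax _ Hj) => [Hlt'|E].
      - exact: (lt_irr (lt_trans HjO Hlt' Hlt)).
      - by subst j. }
    have [_ Hsml] := Hcond _ Hi HiJ; have Hm := Om_measure HiO.
    (* The value that [g] takes for almost all choices of the coordinate [i]. *)
    pose (K := fun b => the (fun v => sep (fst i) (fun c => ap g (upd b i c) = v) ∈ um i)).
    have ? : Fun1 K by rewrite /K; sd.
    have HJi b c : b ∈ Pi -> c ∈ fst i -> ap H (upd b i c) = ap H b.
    { move=> Hb Hc; apply: HH => //; first exact: upd_Pi.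
      move=> j Hj; rewrite upd_ne //; first exact: HJO.
      by move=> E; subst j. }
    have KE b v : b ∈ Pi -> sep (fst i) (fun c => ap g (upd b i c) = v) ∈ um i -> K b = v.
    { move=> Hb Hv; apply: the_eq => // v' Hv'.
      by have [c [_ [E E']]] := um_ne Hm (um_and Hm Hv Hv'); rewrite -E -E'. }
    have HK b : b ∈ Pi -> K b ∈ ap H b /\
       sep (fst i) (fun c => ap g (upd b i c) = K b) ∈ um i.
    { move=> Hb; have [|v [Hv1 Hv2]] :=
        um_part Hm (Y := ap H b) (G := fun c => ap g (upd b i c)) (Hsml _ Hb).
      - by move=> c Hc; rewrite -(HJi b c) //; apply: Hin; apply: upd_Pi.
      - by rewrite (KE _ _ Hb Hv2). }
    have HKd a b : a ∈ Pi -> b ∈ Pi ->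
      (forall j, j ∈ sep F (fun j => lt j i) -> ap a j = ap b j) -> K a = K b.
    { move=> Ha Hb E; symmetry; apply: KE => //; have [_ HKa] := HK _ Ha.
      apply: (um_mono Hm HKa) => c Hc <-; symmetry.
      exact: (dep_upd (K := fun a => ap g a) HF Hi Hmax). }
    have HKN b : b ∈ Pi -> K b ∈ N.
    { move=> Hb; have [c [Hc <-]] := um_ne Hm (proj2 (HK _ Hb)).
      by apply: (fn_val Hg); apply: upd_Pi. }
    have Hcond' j : j ∈ sep F (fun j => lt j i) -> ~ j ∈ J ->
      (forall j', j' ∈ J -> lt j' j) /\ forall a, a ∈ Pi -> sml (ap H a) (fst j).
    { by move=> /sepE [Hj _]; apply: Hcond. }
    have HKf : is_function (lam Pi K) Pi N by apply: fn_lam.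
    have [||g' [Hg' [Hd' Eg']]] := IH Hcond' _ HKf.
    + by move=> a b Ha Hb E; rewrite !ap_lam //; apply: HKd.
    + by move=> a Ha; rewrite ap_lam //; case: (HK _ Ha).
    + exists g'; split=> //; split.
      * by apply: (depg_sub Hd') => j /sepE [/sepE [Hj _] HjJ]; apply/sepE.
      * apply: (eqW_trans _ Eg'); apply: (ae_fubini HiO).
        -- move=> a b Ha Hb E.
           have EF j : j ∈ F -> ap a j = ap b j.
           { move=> Hj; apply: E; apply/sepE; split; [exact: (proj1 HF)|exact: Hmax]. }
           rewrite !ap_lam // (Hd a b) // (HKd a b) // => j /sepE [Hj _]; exact: EF.
        -- apply: ae_true => b Hb; have [_ HKb] := HK _ Hb.
           apply: (um_mono Hm HKb) => c Hc ->; rewrite ap_lam; first exact: upd_Pi.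
           apply: HKd => //; first exact: upd_Pi.
           move=> j /sepE [Hj Hlt]; rewrite upd_ne //; first exact: (proj1 HF).
           by move=> E; subst j; apply: (lt_irr Hlt).
Qed.

(** Turns a bound valid almost everywhere into one valid at every point, as [drop] demands; [z]
    replaces the values that violate it. *)
Lemma FS_force N N' I g h z : z ∈ N -> g ∈ FS N I -> h ∈ FS N' I ->
  (forall a, a ∈ Pi -> z ∈ ap h a) -> inW g h ->
  exists g', g' ∈ FS N I /\ (forall a, a ∈ Pi -> ap g' a ∈ ap h a) /\ eqW g g'.
Proof.
  move=> Hz Hg Hh Hzh Hin.
  have /FSE [_ [F [HF [HFI HdF]]]] := Hg; have /FSE [_ [F' [HF' [HFI' HdF']]]] := Hh.
  pose (K := fun a => ite (ap g a ∈ ap h a) (ap g a) z).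
  have ? : Fun1 K by rewrite /K; sd.
  exists (lam Pi K); split; last split.
  - apply: (FS_lam (F := cup F F')).
    + move=> a Ha; case: (classic (ap g a ∈ ap h a)) => H; rewrite /K.
      * by rewrite iteT //; exact: (FS_val Hg).
      * by rewrite iteF.
    + exact: fin_cup.
    + by move=> x /cupE [/HFI|/HFI'].
    + move=> a b Ha Hb E.
      have E1 : ap g a = ap g b by apply: HdF => // i Hi; apply: E; apply/cupE; left.
      have E2 : ap h a = ap h b by apply: HdF' => // i Hi; apply: E; apply/cupE; right.
      by rewrite /K E1 E2.
  - move=> a Ha; rewrite ap_lam //.
    by case: (classic (ap g a ∈ ap h a)) => H; rewrite /K; [rewrite iteT|rewrite iteF //; apply: Hzh].
  - by apply: (ae_mono Hin) => a Ha H; rewrite ap_lam // /K iteT.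
Qed.

Lemma FS_drop N J I h g : J ⊆ I -> I ⊆ Om -> depg h J ->
  (forall i, i ∈ I -> ~ i ∈ J -> (forall j, j ∈ J -> lt j i) /\
     forall a, a ∈ Pi -> sml (ap h a) (fst i)) ->
  g ∈ FS N I -> (forall a, a ∈ Pi -> ap g a ∈ ap h a) ->
  exists g', g' ∈ FS N J /\ eqW g g'.
Proof.
  move=> HJI HIO Hdh Hcond /FSE [Hg [F [HF [HFI Hd]]]] Hin.
  have Hcond' i : i ∈ F -> ~ i ∈ J -> (forall j, j ∈ J -> lt j i) /\
    forall a, a ∈ Pi -> sml (ap h a) (fst i) by move=> /HFI; apply: Hcond.
  have [g' [Hg' [Hd' E]]] := drop (fun j Hj => HIO _ (HJI _ Hj)) Hdh HF Hcond' Hg Hd Hin.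
  exists g'; split=> //; apply/FSE; split=> //.
  exists (sep F (fun i => i ∈ J)); split; first by apply: (fin_sub HF) => x /sepE [].
  by split=> // x /sepE [].
Qed.

Lemma kap_succ x : x ∈ kap M -> succ x ∈ kap M.
Proof.
  move=> Hx; have [d [Hd Hxd]] := Me_cofinal Hx.
  apply: (ord_trans kap_ord (Me_kap Hd)); exact: (um_succ (Me_measure Hd)).
Qed.
Lemma kap_emp : emp ∈ kap M.
Proof.
  have [_ [Hne _]] := kap_limit M; apply: ord_emp_mem; first exact: kap_ord.
  by apply: NNPP => H; apply: Hne => z Hz; apply: H; exists z.
Qed.
Lemma kap_trans : transitive (kap M).
Proof. by case: (@kap_ord M). Qed.

Lemma mu_ord : ordinal (mu M).
Proof. by case: (mu_cof M). Qed.
Lemma mu_bound Y (G : M -> M) `{!Fun1 G} : Y ∈ mu M -> (forall y, y ∈ Y -> G y ∈ kap M) ->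
  exists b, b ∈ kap M /\ forall y, y ∈ Y -> G y ∈ b.
Proof.
  move=> HY HG; have [_ [_ Hn]] := mu_cof M; apply: NNPP => Hno.
  apply: (Hn _ HY); exists (lam Y G); split; first exact: fn_lam.
  move=> b Hb; have Hob := ord_in kap_ord Hb.
  have [y [Hy Hyb]] : exists y, y ∈ Y /\ ~ G y ∈ b.
  { apply: NNPP => H; apply: Hno; exists b; split=> // y Hy; apply: NNPP => H'.
    by apply: H; exists y. }
  exists y, (G y); split; first by apply/appE; rewrite pair_lam.
  by apply/ord_nmem => //; apply: (ord_in kap_ord); apply: HG.
Qed.
Lemma mu_cofinal : exists C, is_function C (mu M) (kap M) /\
  forall b, b ∈ kap M -> exists x, x ∈ mu M /\ b ∈ ap C x.
Proof.
  have [_ [[C [HC Hcof]] _]] := mu_cof M; exists C; split=> // b Hb.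
  have [x [y [/(fn_app HC) [Hx ->] Hsub]]] := Hcof _ (kap_succ Hb).
  by exists x; split=> //; apply: Hsub; apply/succE; right.
Qed.

(** Three cases: below [mu] the cofinality of [kap] bounds all values. Above [mu] the measure is
    complete enough to fix, almost everywhere, one term of a cofinal [mu]-sequence as a bound. For
    [fst i] equal to [mu] a cofinal map would be a counterexample, which is why [Me] omits it. *)
Lemma um_bound i (G : M -> M) `{!Fun1 G} : i ∈ Om -> (forall c, c ∈ fst i -> G c ∈ kap M) ->
  exists b, b ∈ kap M /\ sep (fst i) (fun c => G c ∈ b) ∈ um i.
Proof.
  move=> Hi HG; have Hm := Om_measure Hi.
  case: (ord_trich (Om_ord Hi) mu_ord) => [H|[H|H]].
  - have [b [Hb Hall]] := mu_bound H HG; exists b; split=> //; exact: (um_all_k Hm).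
  - by case: (Me_mu (Om_fst Hi)).
  - have [C [HC Hcof]] := mu_cofinal.
    pose (K := fun c => least (fun x => x ∈ mu M /\ G c ∈ ap C x)).
    have ? : Fun1 K by rewrite /K; sd.
    have HK c : c ∈ fst i -> K c ∈ mu M /\ G c ∈ ap C (K c).
    { move=> /HG /Hcof [x [Hx HGx]].
      by have [] := least_spec (P := fun x => x ∈ mu M /\ G c ∈ ap C x)
        (ord_in mu_ord Hx) (conj Hx HGx). }
    have [||x [Hx Hux]] := um_part Hm (Y := mu M) (G := K).
    + exact: sml_mem.
    + by move=> c /HK [].
    + exists (ap C x); split; first exact: (fn_val HC).
      by apply: (um_mono Hm Hux) => c /HK [_ H'] <-.
Qed.

(** The least bound in the last coordinate is itself a function of the earlier coordinates, to which
    the induction applies. *)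
Lemma bound_fin F : fin F -> forall g, is_function g Pi (kap M) -> depg g F ->
  exists b, b ∈ kap M /\ ae (fun a => ap g a ∈ b).
Proof.
  move: F.
  have ? : Rel1 (fun F => forall g, is_function g Pi (kap M) -> depg g F ->
    exists b, b ∈ kap M /\ ae (fun a => ap g a ∈ b)) by sd.
  apply: fin_ind.
  - move=> g Hg Hd; case: (classic (exists a, a ∈ Pi)) => [[a Ha]|Hn].
    + exists (succ (ap g a)); split; first by apply: kap_succ; apply: (fn_val Hg).
      apply: ae_true => b Hb; apply/succE; right; apply: Hd => // i /empE //.
    + exists emp; split; first exact: kap_emp.
      by apply: ae_true => b Hb; case: Hn; exists b.
  - move=> F i HF Hi Hmax IH g Hg Hd; have HiO := proj1 HF _ Hi; have Hm := Om_measure HiO.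
    pose (K := fun a => least (fun b => b ∈ kap M /\
      sep (fst i) (fun c => ap g (upd a i c) ∈ b) ∈ um i)).
    have ? : Fun1 K by rewrite /K; sd.
    have HK a : a ∈ Pi -> K a ∈ kap M /\ sep (fst i) (fun c => ap g (upd a i c) ∈ K a) ∈ um i.
    { move=> Ha; have [|b [Hb Hub]] := um_bound (G := fun c => ap g (upd a i c)) HiO.
      - by move=> c Hc; apply: (fn_val Hg); apply: upd_Pi.
      - by have [] := least_spec (P := fun b => b ∈ kap M /\
          sep (fst i) (fun c => ap g (upd a i c) ∈ b) ∈ um i) (ord_in kap_ord Hb) (conj Hb Hub). }
    have HKd a b : a ∈ Pi -> b ∈ Pi ->
      (forall j, j ∈ sep F (fun j => lt j i) -> ap a j = ap b j) -> K a = K b.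
    { move=> Ha Hb E.
      have Es x : sep (fst i) (fun c => ap g (upd a i c) ∈ x) =
        sep (fst i) (fun c => ap g (upd b i c) ∈ x).
      { apply: ext => c; rewrite !sepE; split=> -[Hc];
        by rewrite (dep_upd (K := fun a => ap g a) HF Hi Hmax Hd Ha Hb E Hc). }
      rewrite /K; congr least; apply: functional_extensionality => x; by rewrite Es. }
    have [||b [Hb Hae]] := IH (lam Pi K).
    + by apply: fn_lam => a /HK [].
    + by move=> a b Ha Hb E; rewrite !ap_lam //; apply: HKd.
    + exists b; split=> //.
      have Hgk : ae (fun a => ap g a ∈ ap (lam Pi K) a).
      { apply: (ae_fubini HiO).
        - move=> a a' Ha Ha' E.
          have EF j : j ∈ F -> ap a j = ap a' j.
          { move=> Hj; apply: E; apply/sepE; split; [exact: (proj1 HF)|exact: Hmax]. }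
          rewrite !ap_lam // (Hd a a') // (HKd a a') // => j /sepE [Hj _]; exact: EF.
        - apply: ae_true => a Ha; have [_ HKa] := HK _ Ha.
          apply: (um_mono Hm HKa) => c Hc Hin; rewrite ap_lam; first exact: upd_Pi.
          have -> // : K (upd a i c) = K a.
          apply: HKd => //; first exact: upd_Pi.
          move=> j /sepE [Hj Hlt]; rewrite upd_ne //; first exact: (proj1 HF).
          by move=> E; subst j; apply: (lt_irr Hlt). }
      apply: (ae_mono (ae_and Hgk Hae)) => a Ha [H1 H2].
      exact: (ord_trans (ord_in kap_ord Hb) H2).
Qed.

(** Continuity of the embedding at [kap]: functions into [kap] are bounded by constants almost
    everywhere. *)
Lemma bound I g : g ∈ FS (kap M) I -> exists b, b ∈ kap M /\ inW g (cst b).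
Proof.
  move=> /FSE [Hg [F [HF [HFI Hd]]]]; have [b [Hb Hae]] := bound_fin HF Hg Hd.
  by exists b; split=> //; apply: (ae_mono Hae) => a Ha; rewrite cstE.
Qed.
End Images.

(** * The ordinals of an iterated ultrapower *)

Section Tameness.
Context {M : setting}.
Implicit Types (a b c d e i j g h k F I J N S X Y x y : M).

Lemma FS_ord I g a : g ∈ FS (kap M) I -> a ∈ Pi -> ordinal (ap g a).
Proof. by move=> Hg Ha; apply: (ord_in kap_ord); exact: (FS_val Hg). Qed.
Lemma inW_trans I g h k : k ∈ FS (kap M) I -> inW g h -> inW h k -> inW g k.
Proof.
  move=> Hk H H'; apply: (ae_mono (ae_and H H')) => a Ha [H1 H2].
  exact: (ord_trans (FS_ord Hk Ha) H2).
Qed.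

Lemma pi_ord I g : g ∈ FS (kap M) I -> ordinal (pi (kap M) I g).
Proof.
  move: g; apply: (wf_ind (R := inW) (P := fun g => ordinal (pi (kap M) I g))).
  { exact: inW_wf. }
  move=> g Hg IH; apply: ord_tr.
  - move=> z /piE => /(_ Hg) [h [Hh [Hhg ->]]] y /piE => /(_ Hh) [k [Hk [Hkh ->]]].
    by apply/piE => //; exists k; split=> //; split=> //; apply: (inW_trans Hg Hkh).
  - by move=> z /piE => /(_ Hg) [h [Hh [Hhg ->]]]; apply: IH.
Qed.

Lemma cst_kap I c : c ∈ kap M -> cst c ∈ FS (kap M) I.
Proof. exact: cst_FS. Qed.
Lemma inW_cst c d : c ∈ d -> inW (cst c) (cst d).
Proof. by move=> H; apply: ae_true => a Ha; rewrite !cstE. Qed.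

Lemma pi_ge I c : c ∈ kap M -> c ⊆ pi (kap M) I (cst c).
Proof.
  move: c; apply: (wf_ind (R := mem) (P := fun c => c ⊆ pi (kap M) I (cst c))); first exact: wf_mem.
  move=> c Hc IH d Hd; have Hdk := kap_trans Hc Hd.
  have Hin : pi (kap M) I (cst d) ∈ pi (kap M) I (cst c).
  { apply/piE; first exact: cst_kap.
    by exists (cst d); split; [exact: cst_kap|split=> //; apply: inW_cst]. }
  apply: (ord_le_lt (pi_ord (cst_kap _ Hc)) (IH _ Hdk Hd) _ Hin).
  exact: (ord_in kap_ord Hdk).
Qed.

Lemma force_below I g c : c ∈ kap M -> g ∈ FS (kap M) I -> inW g (cst c) ->
  exists g', g' ∈ FS (kap M) I /\ (forall a, a ∈ Pi -> ap g' a ∈ c) /\ eqW g g'.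
Proof.
  move=> Hc Hg Hin; have [a [Ha]] := ae_ne Hin; rewrite cstE // => Hga.
  have Hz : emp ∈ c by apply: ord_emp_mem; [exact: (ord_in kap_ord Hc)|exists (ap g a)].
  have [|g' [Hg' [Hv E]]] := FS_force (kap_emp) Hg (cst_kap I Hc) _ Hin.
  { by move=> b Hb; rewrite cstE. }
  by exists g'; split=> //; split=> // b Hb; move: (Hv _ Hb); rewrite cstE.
Qed.

(* Functions with values in [e] supported by [I] are coded by subsets of
   [P(I × l) × e], so the ordinal they represent stays below the strong limit [d]. *)
Lemma pi_small d l e I : d ∈ Me M -> l ∈ d -> I ⊆ Om -> I ⊆ prod l l -> e ∈ d ->
  pi (kap M) I (cst e) ∈ d.
Proof.
  move=> Hd Hl HIO HI He; have Hm := Me_measure Hd; have Hdo := Me_ord Hd.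
  have Hek : e ∈ kap M := kap_trans (Me_kap Hd) He.
  have Hpo := pi_ord (cst_kap I Hek).
  apply: NNPP => /(ord_nmem Hpo Hdo) Hsub.
  pose (Sc := pow (prod (pow (prod I l)) e)).
  have HS : sml Sc d.
  { apply: (sml_pow Hm); apply: (sml_prod Hm); last exact: sml_mem.
    apply: (sml_pow Hm); apply: (sml_prod Hm); last exact: sml_mem.
    apply: (sml_sub HI); apply: (sml_prod Hm); exact: sml_mem. }
  have [Hcd _] := Hm.
  apply: (card_emb_ord Hcd HS); apply: (emb_trans (emb_sub Hsub)).
  pose (res := fun a => sep a (fun p => fst p ∈ I)).
  have Hres : Fun1 res by rewrite /res; sd.
  (* The graph of [g] as a function of the restriction of [a] to [I]. As [g] is supported by [I],
     this set determines it. *)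
  pose (code := fun g => sep (prod (pow (prod I l)) e) (fun q => exists a, a ∈ Pi /\ q = pair (res a) (ap g a))).
  have Hcode : Fun1 code by rewrite /code; sd.
  have resP a : a ∈ Pi -> res a ⊆ prod I l.
  { move=> Ha p /sepE [Hp Hpi]; have Hf := Pi_fn Ha.
    rewrite (fn_eta Hf) in Hp; move/lamE: Hp => [i [Hi E]].
    move: Hpi; rewrite E fst_pair => HiI; apply/pair_prod; split=> //.
    have /prodE [d' [Hd' [b [_ Ei]]]] := HI _ HiI.
    have Hlo := ord_in Hdo Hl; apply: (ord_trans Hlo Hd').
    by have := Pi_val Ha Hi; rewrite {2}Ei fst_pair. }
  have resE a b i : a ∈ Pi -> b ∈ Pi -> res a = res b -> i ∈ I -> ap a i = ap b i.
  { move=> Ha Hb E Hi; have Hf := Pi_fn Ha; have Hf' := Pi_fn Hb; have HiO := HIO _ Hi.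
    have : pair i (ap a i) ∈ res a.
    { by apply/sepE; rewrite fst_pair; split=> //; apply/appE; apply/(fn_app Hf). }
    by rewrite E => /sepE [/appE /(fn_app Hf') []]. }
  clearbody res.
  apply: (emb_rel (R := fun t s => exists g, g ∈ FS (kap M) I /\ (forall a, a ∈ Pi -> ap g a ∈ e) /\
     t = pi (kap M) I g /\ s = code g)).
  - move=> t /piE => /(_ (cst_kap _ Hek)) [g [Hg [Hge ->]]].
    have [g' [Hg' [Hv E]]] := force_below Hek Hg Hge.
    exists (code g'); split; first by apply/powE => q /sepE [].
    exists g'; split=> //; split=> //; split=> //; exact: pi_eqW.
  - move=> t t' s _ _ [g [Hg [Hge [-> Es]]]] [g' [Hg' [Hge' [-> Es']]]].
    apply: pi_eqW => //; apply: ae_true => a Ha.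
    have : pair (res a) (ap g a) ∈ code g.
    { apply/sepE; split; last by exists a.
      apply/pair_prod; split; [by apply/powE; apply: resP|exact: Hge]. }
    rewrite -Es Es' => /sepE [_ [b [Hb /pair_inj [Er ->]]]].
    have /FSE [_ [F [HF [HFI Hdep]]]] := Hg'.
    by apply: Hdep => // i Hi; symmetry; apply: resE => //; apply: HFI.
Qed.

(* Iterating further with measures on cardinals [≥ t] does not change what is
   represented below [t]. *)
Definition endext (J I t : M) : Prop := J ⊆ I /\ I ⊆ Om /\
  forall i, i ∈ I -> ~ i ∈ J -> (forall j, j ∈ J -> lt j i) /\ t ⊆ fst i.

Lemma endext_drop J I t g h : endext J I t -> t ∈ kap M -> h ∈ FS (kap M) J ->
  inW h (cst t) -> g ∈ FS (kap M) I -> inW g h -> exists g', g' ∈ FS (kap M) J /\ eqW g g'.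
Proof.
  move=> [HJI [HIO Hc]] Ht Hh Hht Hg Hgh.
  (* The successor makes the bound nonempty, so that [emp] can be the default in [FS_force]. Where
     [h] leaves [t], the bound 1 keeps the number of values below every later [fst i]. *)
  pose (K := fun a => ite (ap h a ∈ t) (succ (ap h a)) (succ emp)).
  have ? : Fun1 K by rewrite /K; sd.
  have Hto := ord_in kap_ord Ht.
  have /FSE [_ [F [HF [HFJ Hd]]]] := Hh.
  have HKd a b : a ∈ Pi -> b ∈ Pi -> (forall i, i ∈ F -> ap a i = ap b i) -> K a = K b.
  { by move=> Ha Hb E; rewrite /K (Hd a b). }
  have HK0 a : emp ∈ K a.
  { case: (classic (ap h a ∈ t)) => H; rewrite /K; [rewrite iteT //|rewrite iteF //]; last first.
    - by apply/succE; right.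
    - apply: ord_emp_mem; first by apply: ord_succ; exact: (ord_in Hto H).
      by exists (ap h a); apply/succE; right. }
  have HKi i a : t ⊆ fst i -> i ∈ Om -> a ∈ Pi -> K a ∈ fst i.
  { move=> Hti Hi Ha; have Hm := Om_measure Hi.
    case: (classic (ap h a ∈ t)) => H; rewrite /K; [rewrite iteT //|rewrite iteF //];
    apply: (um_succ Hm); [exact: Hti|exact: (um_emp Hm)]. }
  have HKfs : lam Pi K ∈ FS (kap M) J.
  { apply: (FS_lam (F := F)) => // a Ha.
    case: (classic (ap h a ∈ t)) => H; rewrite /K; [rewrite iteT //|rewrite iteF //];
    apply: kap_succ; [exact: (FS_val Hh)|exact: kap_emp]. }
  have Hin : inW g (lam Pi K).
  { apply: (ae_mono (ae_and Hgh Hht)) => a Ha [H1]; rewrite cstE // => H2.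
    by rewrite ap_lam // /K iteT //; apply/succE; left. }
  have HKI : lam Pi K ∈ FS (kap M) I by apply: (FS_mono _ HJI HKfs).
  have [|g1 [Hg1 [Hv E1]]] := FS_force kap_emp Hg HKI _ Hin.
  { by move=> a Ha; rewrite ap_lam. }
  have [||g2 [Hg2 E2]] := FS_drop (h := lam Pi K) HJI HIO _ _ Hg1 Hv.
  - by move=> a b Ha Hb E; rewrite !ap_lam //; apply: HKd => // i /HFJ; apply: E.
  - move=> i Hi HiJ; have [Hlt Hti] := Hc _ Hi HiJ; split=> // a Ha.
    by rewrite ap_lam //; apply: sml_mem; apply: HKi => //; apply: HIO.
  - by exists g2; split=> //; apply: (eqW_trans E1).
Qed.

Lemma pi_endext J I t : endext J I t -> t ∈ kap M -> forall h, h ∈ FS (kap M) J ->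
  inW h (cst t) -> pi (kap M) I h = pi (kap M) J h.
Proof.
  move=> He Ht; have HJI : J ⊆ I by case: He.
  have Hsub g : g ∈ FS (kap M) J -> g ∈ FS (kap M) I by apply: FS_mono.
  apply: (wf_ind (R := inW)
    (P := fun h => inW h (cst t) -> pi (kap M) I h = pi (kap M) J h)); first exact: inW_wf.
  move=> h Hh IH Hht; apply: ext => z; rewrite !piE //; first exact: Hsub.
  split.
  - move=> [g [Hg [Hgh ->]]]; have [g' [Hg' E]] := endext_drop He Ht Hh Hht Hg Hgh.
    have Hg'h := inW_eql E Hgh; exists g'; split=> //; split=> //.
    rewrite (pi_eqW Hg (Hsub _ Hg') E); apply: IH => //.
    exact: (inW_trans (cst_kap J Ht) Hg'h).
  - move=> [g [Hg [Hgh ->]]]; exists g; split; first exact: Hsub.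
    split=> //; symmetry; apply: IH => //; exact: (inW_trans (cst_kap J Ht) Hgh).
Qed.

(** The part of the iteration that acts at or below [c] must be bounded in length, for otherwise the
    image of [c] could reach [kap]. *)
Definition tame (I : M) : Prop := I ⊆ Om /\ forall c, c ∈ kap M ->
  exists b, b ∈ kap M /\ forall i, i ∈ I -> fst i ⊆ c -> snd i ∈ b.

Lemma tame_sub J I : J ⊆ I -> tame I -> tame J.
Proof.
  move=> H [HI Ht]; split; first by move=> x /H /HI.
  by move=> c /Ht [b [Hb Hall]]; exists b; split=> // i /H; apply: Hall.
Qed.
Lemma tame_bounded I l : l ∈ kap M -> I ⊆ Om -> I ⊆ prod l l -> tame I.
Proof.
  move=> Hl HIO HI; split=> // c Hc; exists l; split=> // i /HI /prodE [x [_ [y [Hy ->]]]] _.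
  by rewrite snd_pair.
Qed.

(** Indices with first entry above [c] do not affect the image of [c]. The remaining ones form a
    bounded set, and [pi_small] bounds the image by a measurable cardinal below [kap]. *)
Lemma pi_cst_lt I c : tame I -> c ∈ kap M -> pi (kap M) I (cst c) ∈ kap M.
Proof.
  move=> [HIO Ht] Hc; have [b [Hb Hbi]] := Ht _ Hc; have Hsc := kap_succ Hc.
  have Hco := ord_in kap_ord Hc.
  pose (J := sep I (fun i => fst i ⊆ c)).
  have HJI : J ⊆ I by move=> x /sepE [].
  (* The threshold is [succ c] because [pi_endext] speaks of functions strictly below it. *)
  have He : endext J I (succ c).
  { split=> //; split=> // i Hi HiJ; have Hio := Om_ord (HIO _ Hi).
    have Hci : c ∈ fst i.
    { apply: NNPP => H; apply: HiJ; apply/sepE; split=> //; by apply/(ord_nmem Hco Hio). }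
    split; last exact: succ_sub.
    move=> j /sepE [Hj Hjc]; left; apply: (ord_le_lt Hio Hjc) => //.
    exact: (Om_ord (HIO _ Hj)). }
  rewrite (pi_endext He Hsc (cst_kap J Hc)); first by apply: inW_cst; apply/succE; right.
  have [l [Hl [Hscl Hbl]]] : exists l, l ∈ kap M /\ succ c ⊆ l /\ b ⊆ l.
  { case: (ord_total (ord_in kap_ord Hsc) (ord_in kap_ord Hb)) => H;
    [exists b|exists (succ c)]; do ! split=> //. }
  have [d [Hd Hld]] := Me_cofinal Hl.
  apply: (kap_trans (Me_kap Hd)); apply: (pi_small Hd Hld).
  - by move=> x /HJI /HIO.
  - move=> i /sepE [Hi Hic]; rewrite (Om_pair (HIO _ Hi)); apply/pair_prod; split.
    + apply: Hscl; apply/succE; have Hio := Om_ord (HIO _ Hi).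
      by move/(ord_sub Hio Hco): Hic.
    + by apply: Hbl; apply: Hbi.
  - apply: (ord_trans (Me_ord Hd) Hld); apply: Hscl; by apply/succE; right.
Qed.

Lemma pi_lt I g : tame I -> g ∈ FS (kap M) I -> pi (kap M) I g ∈ kap M.
Proof.
  move=> HI Hg; have [b [Hb Hgb]] := bound Hg.
  apply: (ord_trans kap_ord (pi_cst_lt HI Hb)); apply/piE; first exact: cst_kap.
  by exists g.
Qed.

(** The embedding does not decrease ordinals, so [e] is the image of [e] or an element of it, and
    elements of it are represented by functions. *)
Lemma pi_onto I e : tame I -> e ∈ kap M -> exists g, g ∈ FS (kap M) I /\ pi (kap M) I g = e.
Proof.
  move=> HI He; have Hge := pi_ge I He; have Heo := ord_in kap_ord He.
  move/(ord_sub Heo (pi_ord (cst_kap I He))): Hge => [H|E].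
  - by move/piE: H => /(_ (cst_kap I He)) [g [Hg [_ ->]]]; exists g.
  - by exists (cst e); split=> //; apply: cst_kap.
Qed.

(* The image of [x ⊆ kappa] under the iterated ultrapower indexed by [I]. *)
Definition img (I x : M) : M := locked (sep (kap M) (fun e =>
  exists g, g ∈ FS (kap M) I /\ pi (kap M) I g = e /\ ae (fun a => ap g a ∈ x))).
#[global] Instance fun_img : Fun2 img.
Proof. rewrite /img; sd. Qed.
Lemma img_sub I x : img I x ⊆ kap M.
Proof. by move=> e; rewrite /img -lock => /sepE []. Qed.

Lemma imgE I x g : tame I -> g ∈ FS (kap M) I ->
  (pi (kap M) I g ∈ img I x <-> ae (fun a => ap g a ∈ x)).
Proof.
  move=> HI Hg; rewrite /img -lock sepE; split.
  - move=> [_ [h [Hh [E H]]]]; have Hhg := pi_inj kap_trans Hh Hg E.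
    by apply: (ae_mono (ae_and Hhg H)) => a Ha [<-].
  - by move=> H; split; [exact: pi_lt|exists g].
Qed.

Lemma img_cst I x c : tame I -> c ∈ kap M -> (pi (kap M) I (cst c) ∈ img I x <-> c ∈ x).
Proof.
  move=> HI Hc; rewrite imgE //; first exact: cst_kap.
  split.
  - by move/ae_ne => [a [Ha]]; rewrite cstE.
  - by move=> H; apply: ae_true => a Ha; rewrite cstE.
Qed.

Lemma img_endext J I t x e : tame I -> endext J I t -> t ∈ kap M ->
  e ∈ pi (kap M) J (cst t) -> (e ∈ img I x <-> e ∈ img J x).
Proof.
  move=> HI He Ht /piE => /(_ (cst_kap J Ht)) [h [Hh [Hht ->]]].
  have HJI : J ⊆ I by case: He.
  rewrite (imgE _ (tame_sub HJI HI) Hh) -(pi_endext He Ht Hh Hht) imgE //.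
  exact: (FS_mono _ HJI Hh).
Qed.

Lemma img_eq_below I x x' t e : tame I -> t ∈ kap M -> (forall c, c ∈ t -> (c ∈ x <-> c ∈ x')) ->
  e ∈ pi (kap M) I (cst t) -> e ∈ img I x -> e ∈ img I x'.
Proof.
  move=> HI Ht E /piE => /(_ (cst_kap I Ht)) [h [Hh [Hht ->]]]; rewrite !imgE // => H.
  by apply: (ae_mono (ae_and Hht H)) => a Ha [H1 H2]; apply/E => //; move: H1; rewrite cstE.
Qed.

(** The coordinates at [pair d b], for [b] below [r], represent a strictly increasing sequence of
    [r] ordinals below the image of [d]: almost every choice in a later coordinate exceeds the value
    in an earlier one. *)
Lemma pi_generators I d r : tame I -> d ∈ Me M -> r ∈ kap M ->
  (forall b, b ∈ r -> pair d b ∈ I) -> r ⊆ pi (kap M) I (cst d).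
Proof.
  move=> HI Hd Hr HrI; have HrO b : b ∈ r -> pair d b ∈ Om by move=> /HrI; case: HI => H _; apply: H.
  pose (gen := fun b => lam Pi (fun a => ap a (pair d b))).
  have ? : Fun1 gen by rewrite /gen; sd.
  have genE b a : a ∈ Pi -> ap (gen b) a = ap a (pair d b) by move=> Ha; rewrite ap_lam.
  have Hval b a : b ∈ r -> a ∈ Pi -> ap a (pair d b) ∈ d.
  { by move=> Hb Ha; have := Pi_val Ha (HrO _ Hb); rewrite fst_pair. }
  have Hgen b : b ∈ r -> gen b ∈ FS (kap M) I.
  { move=> Hb; apply: (FS_lam (F := sing (pair d b))).
    - by move=> a Ha; apply: (kap_trans (Me_kap Hd)); apply: Hval.
    - by apply: fin_sing; apply: HrO.
    - by move=> x /singE ->; apply: HrI.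
    - by move=> a a' _ _ E; apply: E; apply/singE. }
  have Hro := ord_in kap_ord Hr.
  have Hinc b b' : b ∈ b' -> b' ∈ r -> inW (gen b) (gen b').
  { move=> Hb Hb'; have Hbr := ord_trans Hro Hb' Hb; have HO' := HrO _ Hb'; have HO := HrO _ Hbr.
    have Hlt : lt (pair d b) (pair d b') by right; rewrite !fst_pair !snd_pair.
    have Hne : pair d b <> pair d b' by move=> E; apply: (lt_irr (i := pair d b)); rewrite {2}E.
    apply: (ae_fubini HO').
    - move=> a a' Ha Ha' E; rewrite !genE // !E //; apply/sepE; split=> //; by [right|left].
    - apply: ae_true => a Ha.
      have Hm := Om_measure HO'; have Hv : ap a (pair d b) ∈ fst (pair d b').
      { by rewrite fst_pair; apply: Hval. }
      apply: (um_mono Hm (um_gt Hm Hv)) => c Hc H.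
      by rewrite !genE ?upd_eq ?upd_ne //; apply: upd_Pi. }
  clearbody gen.
  have Hge : forall b, b ∈ r -> b ⊆ pi (kap M) I (gen b).
  { apply: (wf_ind (R := mem)); first exact: wf_mem.
    move=> b Hb IH b' Hb'; have Hbr := ord_trans Hro Hb Hb'.
    apply: (ord_le_lt (pi_ord (Hgen _ Hb)) (IH _ Hbr Hb')); first exact: (ord_in Hro Hbr).
    by apply/piE; [exact: Hgen|exists (gen b'); split; [exact: Hgen|split=> //; exact: Hinc]]. }
  move=> b Hb; have Hdk := cst_kap I (Me_kap Hd).
  apply: (ord_le_lt (pi_ord Hdk) (Hge _ Hb)); first exact: (ord_in Hro Hb).
  apply/piE => //; exists (gen b); split; first exact: Hgen.
  by split=> //; apply: ae_true => a Ha; rewrite genE // cstE //; apply: Hval.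
Qed.
End Tameness.

(** * Images of Sigma-1 definable sets *)

Section Absoluteness.
Context {M : setting}.
Implicit Types (a b c d g h k F I J N S X Y x y : M).

(** A set [W] of witnesses for the unbounded quantifiers is enough. In the ultrapower of any
    transitive [N] above [W] the images of the witnesses are witnesses again, and the bounded matrix
    is handled by [los]. *)
Lemma los_sigma1 (f : formula) : sigma1 f -> forall e : nat -> M, sat e f ->
  exists W : M, forall N, transitive N -> W ⊆ N -> (forall i, e i ∈ N) ->
    forall I, sat (fun i => pi N I (cst (e i))) f.
Proof.
  elim=> {f} [f Hf|f _ IH] e.
  - move=> Hs; exists emp => N HN _ He I.
    apply: (proj2 (los HN Hf (fun i => cst_FS I (He i)))).
    apply: ae_true => a Ha.
    have -> // : (fun i => ap (cst (e i)) a) = e.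
    by apply: functional_extensionality => i; rewrite cstE.
  - move=> /= [w Hs]; have [W HW] := IH _ Hs.
    exists (cup W (sing w)) => N HN HWN He I.
    have Hw : w ∈ N by apply: HWN; apply/cupE; right; apply/singE.
    exists (pi N I (cst w)).
    rewrite (scons_map (fun v => pi N I (cst v))); apply: HW => //.
    + by move=> v Hv; apply: HWN; apply/cupE; left.
    + by case.
Qed.

Section Collapse.
Variables N I : M.
Hypothesis HN : transitive N.
Hypothesis HkN : kap M ⊆ N.
Hypothesis HI : tame I.

Lemma force_kap k : k ∈ FS N I -> inW k (cst (kap M)) ->
  exists k', k' ∈ FS (kap M) I /\ eqW k k'.
Proof.
  move=> Hk Hin.
  have Hc : cst (kap M) ∈ FS (sing (kap M)) I by apply: cst_FS; apply/singE.
  have [|k' [Hk' [Hv E]]] := FS_force (HkN kap_emp) Hk Hc _ Hin.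
  { by move=> a Ha; rewrite cstE //; apply: kap_emp. }
  exists k'; split=> //; move/FSE: Hk' => [Hf HF]; apply/FSE; split=> //.
  by apply: (fn_sub Hf) => a Ha; move: (Hv _ Ha); rewrite cstE.
Qed.

Lemma FS_kap_N g : g ∈ FS (kap M) I -> g ∈ FS N I.
Proof. exact: FS_mono. Qed.

(** Elements of a function into [kap] agree almost everywhere with functions into [kap], so
    enlarging the set to [N] adds nothing below the ordinals represented. *)
Lemma pi_kap_N : forall g, g ∈ FS (kap M) I -> pi N I g = pi (kap M) I g.
Proof.
  apply: (wf_ind (R := inW)); first exact: inW_wf.
  move=> g Hg IH; apply: ext => z; rewrite !piE //; first exact: FS_kap_N.
  split.
  - move=> [k [Hk [Hkg ->]]].
    have Hkk : inW k (cst (kap M)).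
    { apply: (ae_mono Hkg) => a Ha H; rewrite cstE //.
      exact: (kap_trans (FS_val Hg Ha)). }
    have [k' [Hk' E]] := force_kap Hk Hkk; have Hk'g := inW_eql E Hkg.
    exists k'; split=> //; split=> //.
    by rewrite (pi_eqW Hk (FS_kap_N Hk') E); apply: IH.
  - move=> [k [Hk [Hkg ->]]]; exists k; split; first exact: FS_kap_N.
    by split=> //; symmetry; apply: IH.
Qed.

Lemma pi_N_img x : x ∈ N -> x ⊆ kap M -> pi N I (cst x) = img I x.
Proof.
  move=> HxN Hx; apply: ext => z; rewrite piE; first exact: cst_FS.
  split.
  - move=> [k [Hk [Hkx ->]]].
    have Hkk : inW k (cst (kap M)).
    { by apply: (ae_mono Hkx) => a Ha; rewrite !cstE // => H; apply: Hx. }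
    have [k' [Hk' E]] := force_kap Hk Hkk.
    rewrite (pi_eqW Hk (FS_kap_N Hk') E) pi_kap_N // imgE //.
    by apply: (ae_mono (inW_eql E Hkx)) => a Ha; rewrite cstE.
  - rewrite /img -lock => /sepE [_ [k [Hk [<- Hkx]]]]; exists k; split; first exact: FS_kap_N.
    split; last by rewrite pi_kap_N.
    by apply: (ae_mono Hkx) => a Ha; rewrite cstE.
Qed.

Lemma pi_N_kap : kap M ∈ N -> pi N I (cst (kap M)) = kap M.
Proof.
  move=> HkN'; rewrite pi_N_img //; apply: ext => e; split; first exact: img_sub.
  move=> He; have [g [Hg <-]] := pi_onto HI He; apply/imgE => //.
  by apply: ae_true => a Ha; apply: (FS_val Hg).
Qed.

Lemma pi_N_step p : p ∈ N -> (forall i, i ∈ I -> sml p (fst i)) ->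
  (forall q, q ∈ p -> pi N I (cst q) = q) -> pi N I (cst p) = p.
Proof.
  move=> Hp Hsml Hq; apply: ext => z; rewrite piE; first exact: cst_FS.
  split.
  - move=> [k [Hk [Hkp ->]]]; have [a0 [Ha0]] := ae_ne Hkp; rewrite cstE // => Hz.
    have [|k1 [Hk1 [Hv E1]]] := FS_force (HN Hp Hz) Hk (cst_FS I Hp) _ Hkp.
    { by move=> a Ha; rewrite cstE. }
    have [HIO _] := HI.
    (* With [J] empty every coordinate is eliminated, so [k] is equal almost everywhere to a
       constant from [p]. *)
    have [|||k2 [Hk2 E2]] := FS_drop (J := emp) (h := cst p) _ HIO _ _ Hk1 Hv.
    + by move=> i /empE.
    + by move=> a b Ha Hb _; rewrite !cstE.
    + move=> i Hi _; split=> [j /empE //|a Ha]; rewrite cstE //; exact: Hsml.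
    + have /FSE [Hf2 [F [_ [HF Hd]]]] := Hk2.
      have E3 : eqW k (cst (ap k2 a0)).
      { apply: (eqW_trans (eqW_trans E1 E2)); apply: ae_true => a Ha; rewrite cstE //.
        by apply: Hd => // i /HF /empE. }
      have Hqp : ap k2 a0 ∈ p.
      { have [a [Ha [E H]]] := ae_ne (ae_and E3 Hkp).
        by move: H; rewrite E !cstE. }
      have HqN := HN Hp Hqp.
      by rewrite (pi_eqW Hk (cst_FS I HqN) E3) Hq.
  - move=> Hz; exists (cst z); split; first by apply: cst_FS; apply: (HN Hp).
    by split; [exact: inW_cst|rewrite Hq].
Qed.

Lemma pi_N_small t p : transitive t -> p ⊆ t -> p ∈ N -> (forall i, i ∈ I -> sml t (fst i)) ->
  pi N I (cst p) = p.
Proof.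
  move=> Ht Hpt HpN Hsml.
  have Hall : forall q, q ∈ t -> q ∈ N -> pi N I (cst q) = q.
  { apply: (wf_ind (R := mem)); first exact: wf_mem.
    move=> q Hq IH HqN; apply: pi_N_step => //.
    - by move=> i Hi; apply: (sml_sub (Ht _ Hq)); apply: Hsml.
    - by move=> r Hr; apply: IH => //; [exact: (Ht _ Hq)|exact: (HN HqN)]. }
  apply: pi_N_step => //.
  - by move=> i Hi; apply: (sml_sub Hpt); apply: Hsml.
  - by move=> r Hr; apply: Hall; [exact: Hpt|exact: (HN HpN)].
Qed.
End Collapse.

(** The sequence [p] lives outside the model, so a set [B] of the model containing its terms must be
    given before they can be put into a transitive [N]. *)
Lemma sigma1_img (f : formula) (p : nat -> M) (B I x : M) : sigma1 f -> (forall i, p i ∈ B) ->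
  (forall i, p i = kap M \/ exists t, transitive t /\ p i ⊆ t /\
     forall d, d ∈ Me M -> sml t d) ->
  tame I -> x ⊆ kap M -> sat (scons x p) f -> sat (scons (img I x) p) f.
Proof.
  move=> Hf HB Hp HI Hx Hs; have [W HW] := los_sigma1 Hf Hs.
  have [w [Hw _]] := @Om_omega M.
  have [N [HN HN1]] := trcl_ex Hw (cup (cup W B) (upair x (kap M))).
  have HxN : x ∈ N by apply: HN1; apply/cupE; right; apply/upairE; left.
  have HkN : kap M ∈ N by apply: HN1; apply/cupE; right; apply/upairE; right.
  have HpN i : p i ∈ N by apply: HN1; apply/cupE; left; apply/cupE; right.
  have HWN : W ⊆ N by move=> v Hv; apply: HN1; apply/cupE; left; apply/cupE; left.
  have HkN' := HN _ HkN.
  have {}Hs : sat (fun i => pi N I (cst (scons x p i))) f by apply: HW => // -[|i] /=.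
  have E : (fun i => pi N I (cst (scons x p i))) = scons (img I x) p; last by rewrite -E.
  apply: functional_extensionality => -[|i] /=; first exact: pi_N_img.
  case: (Hp i) => [->|[t [Ht [Hpt Hsml]]]]; first exact: pi_N_kap.
  apply: (pi_N_small HN HI Ht) => // j Hj; apply: Hsml; apply: Om_fst.
  by case: HI => HIO _; apply: HIO.
Qed.
End Absoluteness.

(** * Sets moved by all iterations *)

Section Good.
Context {M : setting}.
Implicit Types (a b c d e g h i j k l r t F I J N S X Y x y : M).

Lemma kap_max a b : a ∈ kap M -> b ∈ kap M -> exists m, m ∈ kap M /\ a ⊆ m /\ b ⊆ m.
Proof.
  move=> Ha Hb; case: (ord_total (ord_in kap_ord Ha) (ord_in kap_ord Hb)) => H;
  [exists b|exists a]; do ! split=> //.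
Qed.
Lemma Me_above a b : a ∈ kap M -> b ∈ kap M -> exists d, d ∈ Me M /\ a ∈ d /\ b ∈ d.
Proof.
  move=> Ha Hb; have [m [Hm [H1 H2]]] := kap_max Ha Hb.
  have [d [Hd Hmd]] := Me_cofinal Hm; have Hdo := Me_ord Hd.
  by exists d; split=> //; split; [apply: (ord_le_lt Hdo H1) Hmd|apply: (ord_le_lt Hdo H2) Hmd];
    apply: (ord_in kap_ord).
Qed.
Lemma sml_kap d X : d ∈ Me M -> sml X d -> sml X (kap M).
Proof. by move=> Hd [l [Hl He]]; exists l; split=> //; apply: (kap_trans (Me_kap Hd)). Qed.

Definition bdd (J d : M) : Prop := d ∈ Me M /\ J ⊆ Om /\ (forall i, i ∈ J -> fst i ∈ d) /\
  exists l, l ∈ kap M /\ J ⊆ prod l l.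
#[global] Instance rel_bdd : Rel2 bdd.
Proof. rewrite /bdd; sd. Qed.

(** The index set of the iteration along [J] followed by [r] steps with the measure on [d]. *)
Definition add (J d r : M) : M := locked (cup J (prod (sing d) r)).
#[global] Instance fun_add : Fun3 add.
Proof. rewrite /add; sd. Qed.
Lemma addE J d r i : i ∈ add J d r <-> i ∈ J \/ exists b, b ∈ r /\ i = pair d b.
Proof.
  rewrite /add -lock cupE prodE; split=> -[H|H]; try by left.
  - by right; case: H => x [/singE -> H].
  - by right; exists d; split=> //; apply/singE.
Qed.

Lemma add_Om J d r : bdd J d -> r ∈ kap M -> add J d r ⊆ Om.
Proof.
  move=> [Hd [HJ _]] Hr i /addE [/HJ //|[b [Hb ->]]]; apply/pair_prod; split=> //.
  exact: (kap_trans Hr).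
Qed.
Lemma add_prod J d r l : J ⊆ prod l l -> d ∈ l -> r ⊆ l -> add J d r ⊆ prod l l.
Proof.
  move=> HJ Hd Hr i /addE [/HJ //|[b [Hb ->]]]; apply/pair_prod; split=> //; exact: Hr.
Qed.
Lemma prod_mono a a' b b' : a ⊆ a' -> b ⊆ b' -> prod a b ⊆ prod a' b'.
Proof.
  move=> Ha Hb p /prodE [x [Hx [y [Hy ->]]]]; apply/pair_prod; split; [exact: Ha|exact: Hb].
Qed.
Lemma add_bounded J d r : bdd J d -> r ∈ kap M -> exists l, l ∈ kap M /\ add J d r ⊆ prod l l.
Proof.
  move=> [Hd [HJ [_ [l [Hl HJl]]]]] Hr.
  have [m [Hm [H1 H2]]] := kap_max Hl (kap_succ (Me_kap Hd)).
  have [n [Hn [H3 H4]]] := kap_max Hm Hr.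
  exists n; split=> //; apply: add_prod => //.
  - by move=> i /HJl; apply: prod_mono => v /H1 /H3.
  - by apply: H3; apply: H2; apply/succE; right.
Qed.
Lemma add_tame J d r : bdd J d -> r ∈ kap M -> tame (add J d r).
Proof.
  move=> HJ Hr; have [l [Hl H]] := add_bounded HJ Hr; apply: (tame_bounded Hl) => //.
  exact: add_Om.
Qed.
Lemma add_endext J d r r' : bdd J d -> r' ∈ kap M -> r ⊆ r' -> ordinal r ->
  endext (add J d r) (add J d r') d.
Proof.
  move=> HJ Hr' Hrr' Hro; split; last split.
  - move=> i /addE [Hi|[b [Hb ->]]]; apply/addE; [by left|right].
    by exists b; split=> //; apply: Hrr'.
  - exact: add_Om.
  - move=> i /addE [Hi|[b [Hb ->]]] Hn; first by case: Hn; apply/addE; left.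
    rewrite fst_pair; split=> // j /addE [Hj|[b' [Hb' ->]]]; rewrite /lt !fst_pair ?snd_pair.
    + by left; case: HJ => [_ [_ [HJd _]]]; apply: HJd.
    + right; split=> //; have Hbo := ord_in (ord_in kap_ord Hr') Hb.
      have Hrb : r ⊆ b.
      { by apply/(ord_nmem Hbo Hro) => H; apply: Hn; apply/addE; right; exists b. }
      exact: Hrb.
Qed.
Lemma add_gen J d r : bdd J d -> r ∈ kap M -> r ⊆ pi (kap M) (add J d r) (cst d).
Proof.
  move=> HJ Hr; apply: pi_generators => //; first exact: add_tame.
  - by case: HJ.
  - by move=> b Hb; apply/addE; right; exists b.
Qed.

(* The common limit of the sets [img (add J d r) x] for [r] tending to [kappa];
   it only depends on [x ∩ d]. *)
Definition lim (J d x : M) : M := locked (sep (kap M) (fun e =>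
  exists r, r ∈ kap M /\ e ∈ r /\ e ∈ img (add J d r) x)).
#[global] Instance fun_lim : Fun3 lim.
Proof. rewrite /lim; sd. Qed.
Lemma limE J d x e : e ∈ lim J d x <-> e ∈ kap M /\
  exists r, r ∈ kap M /\ e ∈ r /\ e ∈ img (add J d r) x.
Proof. by rewrite /lim -lock sepE. Qed.

(** The additional steps change nothing below the image of [d], which is at least [r] by
    [add_gen]. *)
Lemma img_add_le J d r r' x e : bdd J d -> r' ∈ kap M -> r ∈ kap M -> r ⊆ r' -> e ∈ r ->
  (e ∈ img (add J d r') x <-> e ∈ img (add J d r) x).
Proof.
  move=> HJ Hr' Hr Hrr' He.
  apply: (img_endext _ (add_tame HJ Hr') (add_endext HJ Hr' Hrr' (ord_in kap_ord Hr))).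
  - by case: HJ => /Me_kap.
  - exact: (add_gen HJ Hr).
Qed.

Lemma lim_agree J d r x e : bdd J d -> r ∈ kap M -> e ∈ r ->
  (e ∈ img (add J d r) x <-> e ∈ lim J d x).
Proof.
  move=> HJ Hr He; rewrite limE; split.
  - by move=> H; split; [exact: (kap_trans Hr)|exists r].
  - move=> [_ [r' [Hr' [He' H]]]].
    case: (ord_total (ord_in kap_ord Hr) (ord_in kap_ord Hr')) => Hs.
    + by apply/(img_add_le x HJ Hr' Hr Hs He).
    + by apply/(img_add_le x HJ Hr Hr' Hs He').
Qed.

(** Below the image of [d], membership in the image of [x] is decided by [x ∩ d], and [e ∈ r] lies
    below that image. *)
Lemma lim_below J d x x' : bdd J d -> (forall c, c ∈ d -> (c ∈ x <-> c ∈ x')) ->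
  lim J d x ⊆ lim J d x'.
Proof.
  move=> HJ E e /limE [He [r [Hr [Her H]]]]; apply/limE; split=> //; exists r; split=> //.
  split=> //; have Hdk : d ∈ kap M by case: HJ => /Me_kap.
  apply: (img_eq_below (add_tame HJ Hr) Hdk E) H; exact: (add_gen HJ Hr).
Qed.

Definition dif (J d x r e : M) : Prop := e ∈ kap M /\
  ~ (e ∈ img (add J d r) x <-> e ∈ lim J d x).
#[global] Instance rel_dif : Rel5 dif.
Proof. rewrite /dif; sd. Qed.
Definition mindif (J d x r e : M) : Prop := dif J d x r e /\
  forall e', e' ∈ e -> ~ dif J d x r e'.
#[global] Instance rel_mindif : Rel5 mindif.
Proof. rewrite /mindif; sd. Qed.
Definition difs (J d x : M) : M := locked (sep (kap M) (fun e =>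
  exists r, r ∈ kap M /\ mindif J d x r e)).
#[global] Instance fun_difs : Fun3 difs.
Proof. rewrite /difs; sd. Qed.
Lemma difsE J d x e : e ∈ difs J d x <-> e ∈ kap M /\ exists r, r ∈ kap M /\ mindif J d x r e.
Proof. by rewrite /difs -lock sepE. Qed.

Lemma dif_ge J d x r e : bdd J d -> r ∈ kap M -> dif J d x r e -> r ⊆ e.
Proof.
  move=> HJ Hr [He Hn]; apply/(ord_nmem (ord_in kap_ord He) (ord_in kap_ord Hr)) => Her.
  by apply: Hn; apply: lim_agree.
Qed.
Lemma mindif_ex J d x r e : dif J d x r e -> exists e', e' ⊆ e /\ mindif J d x r e'.
Proof.
  move=> H; have [He _] := H.
  have [e' [_ [H1 [H2 H3]]]] := least_ex (P := fun e => dif J d x r e) (ord_in kap_ord He) H.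
  by exists e'.
Qed.

Definition good (x : M) : Prop := forall J d, bdd J d -> ~ sml (difs J d x) (kap M).

Lemma bad_unique J d x x' : bdd J d -> x ⊆ kap M -> x' ⊆ kap M ->
  (forall c, c ∈ d -> (c ∈ x <-> c ∈ x')) ->
  sml (difs J d x) (kap M) -> sml (difs J d x') (kap M) -> x = x'.
Proof.
  move=> HJ Hx Hx' E [l1 [Hl1 He1]] [l2 [Hl2 He2]].
  apply: NNPP => Hne.
  have [e0 [He0 Hdiff]] : exists e0, e0 ∈ kap M /\ ~ (e0 ∈ x <-> e0 ∈ x').
  { apply: NNPP => H; apply: Hne; apply: ext => e.
    case: (classic (e ∈ kap M)) => He; last by split=> [/Hx|/Hx'].
    by apply: NNPP => H'; apply: H; exists e. }
  have [Hd [HJO [HJd [l [Hl HJl]]]]] := HJ.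
  have [m1 [Hm1 [H1 H2]]] := kap_max Hl (kap_succ (Me_kap Hd)).
  have [m2 [Hm2 [H3 H4]]] := kap_max Hl1 Hl2.
  have [m3 [Hm3 [H5 H6]]] := kap_max Hm1 Hm2.
  (* A measurable cardinal above [J], [d], the point [e0] where [x] and [x'] differ, and the sizes
     of both sets of first differences. *)
  have [n [Hn [Hmn He0n]]] := Me_above Hm3 He0.
  have Hm := Me_measure Hn; have Hno := Me_ord Hn.
  have Hln : l1 ∈ n /\ l2 ∈ n.
  { by split; apply: (ord_le_lt Hno _ _ Hmn); try exact: (ord_in kap_ord);
    move=> v Hv; apply: H6; [apply: H3|apply: H4]. }
  have Hlim : lim J d x = lim J d x'.
  { by apply: sub_antisym; apply: lim_below => // c Hc; rewrite E. }
  (* The images of [x] and [x'] differ at the image [er] of [e0], while their limits are equal, so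
     one image leaves its limit at [er]. Its first such place is at least [r] and still below
     [n]. *)
  have Hex r : r ∈ n -> exists e, e ∈ n /\ r ⊆ e /\ (e ∈ difs J d x \/ e ∈ difs J d x').
  { move=> Hr; have Hrk := kap_trans (Me_kap Hn) Hr; have Ht := add_tame HJ Hrk.
    pose (er := pi (kap M) (add J d r) (cst e0)).
    have Herk : er ∈ kap M := pi_cst_lt Ht He0.
    have Hern : er ∈ n.
    { have Hro := ord_in Hno Hr; have Hmo := ord_in Hno Hmn.
      have [v [Hv [Hv1 Hv2]]] : exists v, v ∈ n /\ m3 ⊆ v /\ r ⊆ v.
      { case: (ord_total Hmo Hro) => H; [exists r|exists m3]; do ! split=> //. }
      apply: (pi_small Hn Hv (add_Om HJ Hrk)) => //; apply: add_prod => //.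
      - by move=> i /HJl; apply: prod_mono => w /H1 /H5 /Hv1.
      - by apply: Hv1; apply: H5; apply: H2; apply/succE; right. }
    have Hd2 : dif J d x r er \/ dif J d x' r er.
    { apply: NNPP => H; apply: Hdiff.
      rewrite -(img_cst x Ht He0) -(img_cst x' Ht He0) -/er.
      have A1 : er ∈ img (add J d r) x <-> er ∈ lim J d x.
      { by apply: NNPP => H'; apply: H; left. }
      have A2 : er ∈ img (add J d r) x' <-> er ∈ lim J d x'.
      { by apply: NNPP => H'; apply: H; right. }
      by rewrite A1 A2 Hlim. }
    have Hfin x0 : dif J d x0 r er -> exists e, e ∈ n /\ r ⊆ e /\ e ∈ difs J d x0.
    { move=> /mindif_ex [e [Hee He]]; have [Hde _] := He; have [Hek _] := Hde.
      exists e; split; first exact: (ord_le_lt Hno Hee (ord_in kap_ord Hek) Hern).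
      split; first exact: (dif_ge HJ Hrk Hde).
      by apply/difsE; split=> //; exists r. }
    case: Hd2 => /Hfin [e [A1 [A2 A3]]]; exists e; split=> //; split=> //; by [left|right]. }
  (* Each set of first differences has fewer than [n] elements, so by regularity its part below [n]
     is bounded there. This contradicts [Hex] at a common bound. *)
  have Hbd x0 l0 : l0 ∈ n -> emb (difs J d x0) l0 ->
    exists b, b ∈ n /\ forall e, e ∈ n -> e ∈ difs J d x0 -> e ∈ b.
  { move=> Hl0 He; have [||b [Hb Hall]] := um_reg Hm
      (Y := sep (difs J d x0) (fun e => e ∈ n)) (G := fun e => e).
    - exists l0; split=> //; apply: (emb_trans _ He); apply: emb_sub => v /sepE [] //.
    - by move=> e /sepE [].
    - by exists b; split=> // e Hen Hed; apply: Hall; apply/sepE. }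
  have [Hl1n Hl2n] := Hln.
  have [b1 [Hb1 HB1]] := Hbd _ _ Hl1n He1; have [b2 [Hb2 HB2]] := Hbd _ _ Hl2n He2.
  have [b [Hb [Hs1 Hs2]]] : exists b, b ∈ n /\ b1 ⊆ b /\ b2 ⊆ b.
  { case: (ord_total (ord_in Hno Hb1) (ord_in Hno Hb2)) => H; [exists b2|exists b1];
    do ! split=> //. }
  have [e [Hen [Hbe [He|He]]]] := Hex _ Hb.
  - by apply: (@mem_irr _ e); apply: Hbe; apply: Hs1; apply: HB1.
  - by apply: (@mem_irr _ e); apply: Hbe; apply: Hs2; apply: HB2.
Qed.

Lemma good_ex (D : M) : (forall x, x ∈ D -> x ⊆ kap M) -> ~ emb D (kap M) ->
  exists x, x ∈ D /\ good x.
Proof.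
  move=> HD Hn; apply: NNPP => Hno; apply: Hn.
  (* Codes for bad sets: [T a] contains all triples of [J], [d] and [x ∩ d] that are bounded by [a].
     By the strong limit property it is small, and [emb_stratified] bounds the union by [kap]. *)
  pose (T := fun a : M => prod (pow (prod a a)) (prod a (pow a))).
  have HT : Fun1 T by rewrite /T; sd.
  have HTm a b : a ⊆ b -> T a ⊆ T b.
  { move=> H; have Hp s t : s ⊆ t -> pow s ⊆ pow t.
    { by move=> Hst v /powE Hv; apply/powE => w /Hv /Hst. }
    by apply: prod_mono; [apply: Hp; apply: prod_mono|apply: prod_mono => //; apply: Hp]. }
  apply: (@emb_trans _ _ (bigcup (kap M) T)); last first.
  { apply: (emb_stratified (S := T)).
    - exact: kap_card.
    - by move=> a b Ha Hb; apply: HTm; apply: ord_lt_sub => //; apply: (ord_in kap_ord Hb).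
    - move=> a Ha; have [d [Hd Had]] := Me_cofinal Ha; have Hm := Me_measure Hd.
      have Hs := sml_mem Had; apply: (sml_kap Hd); apply: (sml_prod Hm).
      + by apply: (sml_pow Hm); apply: (sml_prod Hm).
      + by apply: (sml_prod Hm) => //; apply: (sml_pow Hm).
    - by move=> t /bigcupE. }
  apply: (emb_rel (R := fun x q => exists J d, bdd J d /\ sml (difs J d x) (kap M) /\
    q = pair J (pair d (sep d (fun c => c ∈ x))))).
  - move=> x Hx.
    have [J [d [HJ Hs]]] : exists J d, bdd J d /\ sml (difs J d x) (kap M).
    { apply: NNPP => H; apply: Hno; exists x; split=> // J d HJ Hs; apply: H; by exists J, d. }
    exists (pair J (pair d (sep d (fun c => c ∈ x)))); split; last by exists J, d.
    have [Hd [HJO [HJd [l [Hl HJl]]]]] := HJ.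
    have [m [Hm [H1 H2]]] := kap_max Hl (kap_succ (Me_kap Hd)).
    apply/bigcupE; exists m; split=> //.
    have Hdm : d ∈ m by apply: H2; apply/succE; right.
    apply/pair_prod; split; last (apply/pair_prod; split=> //).
    + apply/powE => i /HJl; exact: prod_mono.
    + apply/powE => c /sepE [Hc _]; exact: (ord_trans (ord_in kap_ord Hm) Hdm).
  - move=> x x' q Hx Hx' [J [d [HJ [Hs ->]]]] [J' [d' [HJ' [Hs' E]]]].
    move: E => /pair_inj [EJ /pair_inj [Ed Ex]]; subst J' d'.
    apply: (bad_unique HJ) => //; try exact: HD.
    move=> c Hc; have : c ∈ sep d (fun c => c ∈ x) <-> c ∈ sep d (fun c => c ∈ x') by rewrite Ex.
    by rewrite !sepE; tauto.
Qed.
End Good.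

(** * Perfect embeddings from trees *)

Section Perfect.
Context {M : zfc_model}.
Implicit Types (a b d e f g n m o s v y z X Y : M).

(* A map whose value below [th f n] determines, and is determined by, the first
   [n] values of [f], is a perfect embedding. *)
Lemma perfect_of_levels (m k : M) (io : M -> M) (th : M -> M -> M) `{HI : !Fun1 io} :
  ordinal m -> ordinal k ->
  (forall f, is_function f m k -> io f ⊆ k) ->
  (forall f n, is_function f m k -> n ∈ m -> th f n ∈ k) ->
  (forall f b, is_function f m k -> b ∈ k -> exists n, n ∈ m /\ b ⊆ th f n) ->
  (forall f g n, is_function f m k -> is_function g m k -> n ∈ m ->
    (forall i, i ∈ n -> ap f i = ap g i) -> forall e, e ∈ th f n -> (e ∈ io f <-> e ∈ io g)) ->
  (forall f g n, is_function f m k -> is_function g m k -> n ∈ m ->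
    (forall e, e ∈ th f n -> (e ∈ io f <-> e ∈ io g)) -> forall i, i ∈ n -> ap f i = ap g i) ->
  (forall f g, is_function f m k -> is_function g m k -> io f = io g -> f = g) ->
  perfect_embedding m k k (lam (funs m k) io).
Proof.
  move=> Hm Hk Hsub Hthk Hcof Hdet Hrec Hinj.
  pose (i := lam (funs m k) io); rewrite -/i.
  have Hi f : is_function f m k -> ap i f = io f.
  { by move=> Hf; rewrite ap_lam //; apply/funsE. }
  have Hif : is_function i (funs m k) (pow k).
  { by apply: fn_lam => f /funsE Hf; apply/powE; apply: Hsub. }
  clearbody i.
  have Happ f y : app i f y <-> is_function f m k /\ y = io f.
  { rewrite (fn_app Hif) funsE; split=> -[Hf ->]; split=> //; by rewrite Hi. }
  have Hinj' : is_injection i (funs m k) (pow k).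
  { split=> // f g y /Happ [Hf ->] /Happ [Hg E]; exact: Hinj. }
  have HR : is_range i (repl (funs m k) io).
  { move=> y; rewrite replE; split.
    - by move=> [f [/funsE Hf ->]]; exists f; apply/Happ.
    - by move=> [f /Happ [Hf ->]]; exists f; split=> //; apply/funsE. }
  exists (funs m k), (pow k), (repl (funs m k) io).
  split; first by move=> f; rewrite funsE.
  split; first by move=> z; rewrite powE.
  split=> //; split=> //; split; last split.
  - split.
    + split; last by case: Hinj'.
      by apply: (fn_sub Hif) => f /funsE Hf; rewrite Hi //; apply/replE; exists f; rewrite funsE.
    + by move=> y /replE [f [/funsE Hf ->]]; exists f; apply/Happ.
  - move=> o a [o1 [Ho1 Ho]] Ha f /Ha [y [/Ho [Hy1 HyR] /Happ [Hf Ey]]]; subst y.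
    have [b1 [[eta [a1 [Heta [Ha1 Hb1]]]] [Hyb Hbo]]] := Ho1 _ Hy1.
    have [n [Hn Hetan]] := Hcof _ _ Hf Heta.
    have Hnm : n ⊆ m by case: Hm => Htr _; apply: Htr.
    (* The restriction of [f] to a level that determines the image up to [eta]; it generates the
       required basic neighbourhood. *)
    pose (s := lam n (fun x => ap f x)).
    have Hs : is_function s n k by apply: fn_lam => x Hx; apply: (fn_val Hf); apply: Hnm.
    have HsE g : is_function g m k -> (s ⊆ g <-> forall x, x ∈ n -> ap f x = ap g x).
    { move=> Hg; split.
      - move=> Hsg x Hx; have : pair x (ap f x) ∈ g by apply: Hsg; rewrite pair_lam.
        by move/appE/(fn_app Hg) => [].
      - move=> E p /lamE [x [Hx ->]]; apply/appE; rewrite (fn_app Hg) E //; split=> //; exact: Hnm. }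
    clearbody s.
    exists (sep (funs m k) (fun g => s ⊆ g)); split; last split.
    + exists n, s; split=> //; split=> // g; by rewrite sepE funsE.
    + by apply/sepE; rewrite funsE; split=> //; apply/HsE.
    + move=> g /sepE [/funsE Hg /(HsE _ Hg) E]; apply/Ha; exists (io g); split; last by apply/Happ.
      apply/Ho; split; last by apply/replE; exists g; rewrite funsE.
      apply: Hbo; apply/Hb1; split; first exact: Hsub.
      move: Hyb => /Hb1 [_ Hyb] v; rewrite -Hyb; have D := Hdet _ _ _ Hf Hg Hn E v.
      by split=> -[Hv Hve]; split=> //; apply/D => //; apply: Hetan.
  - move=> o b Ho Hb.
    have HoF f : f ∈ o -> is_function f m k.
    { by move/Ho => [c [[xi [s [_ [_ Hc]]]] [Hfc _]]]; move: Hfc => /Hc []. }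
    (* Here [z] agrees with the image of [f] up to some [eta] that is large enough to force
       membership in [o]. The sets near a member of [o] form an open set whose trace on the range is
       the image of [o]. *)
    pose (near := fun z f => exists eta, eta ∈ k /\
      (forall g, is_function g m k -> (forall v, v ∈ eta -> (v ∈ io f <-> v ∈ io g)) -> g ∈ o) /\
      (forall v, v ∈ eta -> (v ∈ z <-> v ∈ io f))).
    have Hnear : Rel2 near by rewrite /near; sd.
    exists (sep (pow k) (fun z => exists f, f ∈ o /\ near z f)); split.
    + move=> z /sepE [/powE Hz [f [Hfo [eta [Heta [Hg Hv]]]]]].
      exists (sep (pow k) (fun z' => forall v, v ∈ eta -> (v ∈ z' <-> v ∈ z))); split; last split.
      * exists eta, (sep eta (fun v => v ∈ z)); split=> //.
        split; first by move=> v /sepE [].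
        move=> z'; rewrite sepE powE; split=> -[Hz' H]; split=> // v.
        -- rewrite sepE; split=> -[A B]; split=> //; by apply/H.
        -- move=> Hve; move: (H v); rewrite sepE; tauto.
      * by apply/sepE; rewrite powE.
      * move=> z' /sepE [Hz' H]; apply/sepE; split=> //; exists f; split=> //.
        exists eta; split=> //; split=> // v Hve; rewrite H //; exact: Hv.
    + move=> y; rewrite Hb sepE; split.
      * move=> [f [Hfo /Happ [Hf ->]]]; split; last by apply/replE; exists f; rewrite funsE.
        split; first by apply/powE; apply: Hsub.
        have [c [[n [s [Hn [Hs Hc]]]] [Hfc Hco]]] := Ho _ Hfo.
        exists f; split=> //; exists (th f n); split; first exact: Hthk.
        split=> // g Hg Hagree; apply: Hco; apply/Hc; split=> //.
        have E := Hrec _ _ _ Hf Hg Hn Hagree.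
        move: Hfc => /Hc [_ Hsf] p Hp; have Hp' := Hsf _ Hp.
        move: Hp; rewrite (fn_eta Hs) => /lamE [x [Hxn Ep]].
        have Hxm : x ∈ m := ord_trans Hm Hn Hxn.
        move: Hp'; rewrite Ep => /appE /(fn_app Hf) [_ ->].
        by apply/appE; rewrite (fn_app Hg) -E.
      * move=> [[_ [f [Hfo [eta [Heta [Hg Hv]]]]]] /replE [g [/funsE Hgf Ey]]]; subst y.
        exists g; split; last by apply/Happ.
        by apply: Hg => // v Hve; symmetry; apply: Hv.
Qed.
End Perfect.

(** * The tree of iterations *)

Section Runs.
Context {M : setting}.
Implicit Types (a b c d e f g h i j k l r t v z F I J N S X Y : M).
Variables x C ch : M.
Hypothesis Hx : x ⊆ kap M.
Hypothesis Hgood : good x.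
Hypothesis HC : is_function C (mu M) (kap M).
Hypothesis HCcof : forall b, b ∈ kap M -> exists n, n ∈ mu M /\ b ∈ ap C n.
Hypothesis Hch : forall s, s ∈ pow (funs (kap M) (kap M)) -> (exists v, v ∈ s) -> ap ch s ∈ s.

Definition dfirst (h n : M) : M := fst (ap h n).
Definition dlength (h n : M) : M := fst (snd (ap h n)).
Definition dlast (h n : M) : M := snd (snd (ap h n)).
#[local] Instance fun_dfirst : Fun2 dfirst. Proof. rewrite /dfirst; sd. Qed.
#[local] Instance fun_dlength : Fun2 dlength. Proof. rewrite /dlength; sd. Qed.
#[local] Instance fun_dlast : Fun2 dlast. Proof. rewrite /dlast; sd. Qed.

Definition stage (h n : M) : M :=
  bigcup n (fun m => prod (sing (dfirst h m)) (dlength h m)).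
#[local] Instance fun_stage : Fun2 stage. Proof. rewrite /stage; sd. Qed.
(** Exceeding [ap C n] makes the chosen cardinals cofinal in [kap]. Exceeding the recorded
    differences protects these from all later iterations. *)
Definition next (h n : M) : M :=
  least (fun d => d ∈ Me M /\ ap C n ∈ d /\ forall m, m ∈ n -> dfirst h m ∈ d /\ dlast h m ∈ d).
#[local] Instance fun_next : Fun2 next. Proof. rewrite /next; sd. Qed.
(** A bijection from [kap] onto the first differences, available because [x] is good. It is chosen
    by a fixed [ch], so runs with the same history use the same one. *)
Definition enum (J d : M) : M := ap ch (sep (funs (kap M) (kap M)) (fun f => bij f (kap M) (difs J d x))).
#[local] Instance fun_enum : Fun2 enum. Proof. rewrite /enum; sd. Qed.
Definition reach (J d e : M) : M := least (fun r => r ∈ kap M /\ mindif J d x r e).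
#[local] Instance fun_reach : Fun3 reach. Proof. rewrite /reach; sd. Qed.
(* Stage [n] of a run records a triple: the cardinal [d] of the measure that is
   used, the number of times it is iterated, and the least element of the
   difference to the limit obtained in this way, which is the [v]-th one. *)
Definition turn (h n v : M) : M :=
  locked (pair (next h n) (pair
    (reach (stage h n) (next h n) (ap (enum (stage h n) (next h n)) v))
    (ap (enum (stage h n) (next h n)) v))).
#[local] Instance fun_turn : Fun3 turn. Proof. rewrite /turn; sd. Qed.
Definition run (f n : M) : M := locked (orec (fun h n => turn h n (ap f n)) n).
#[local] Instance fun_run : Fun2 run. Proof. rewrite /run; sd. Qed.

Lemma runE f n : ordinal n -> run f n = turn (lam n (fun m => run f m)) n (ap f n).
Proof.
  have ? : Fun1 (orec (fun h n => turn h n (ap f n))) by sd.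
  move=> Hn; rewrite {1}/run -lock orecE; first exact: Hn.
  have -> // : lam n (fun m => orec (fun h n => turn h n (ap f n)) m) = lam n (fun m => run f m).
  by apply: lam_ext => m Hm; rewrite /run -lock.
Qed.

Definition dl (f n : M) : M := fst (run f n).
Definition rh (f n : M) : M := fst (snd (run f n)).
Definition es (f n : M) : M := snd (snd (run f n)).
#[local] Instance fun_dl : Fun2 dl. Proof. rewrite /dl; sd. Qed.
#[local] Instance fun_rh : Fun2 rh. Proof. rewrite /rh; sd. Qed.
#[local] Instance fun_es : Fun2 es. Proof. rewrite /es; sd. Qed.
Definition ind (f n : M) : M := bigcup n (fun m => prod (sing (dl f m)) (rh f m)).
#[local] Instance fun_ind : Fun2 ind. Proof. rewrite /ind; sd. Qed.

Lemma indE f n i : i ∈ ind f n <-> exists m b, m ∈ n /\ b ∈ rh f m /\ i = pair (dl f m) b.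
Proof.
  rewrite /ind bigcupE; split.
  - by move=> [m [Hm /prodE [d [/singE -> [b [Hb ->]]]]]]; exists m, b.
  - by move=> [m [b [Hm [Hb ->]]]]; exists m; split=> //; apply/pair_prod; split=> //; apply/singE.
Qed.

Lemma run_unfold f n : ordinal n ->
  dl f n = least (fun d => d ∈ Me M /\ ap C n ∈ d /\ forall m, m ∈ n -> dl f m ∈ d /\ es f m ∈ d) /\
  es f n = ap (enum (ind f n) (dl f n)) (ap f n) /\
  rh f n = reach (ind f n) (dl f n) (es f n).
Proof.
  move=> Hn; pose (h := lam n (fun m => run f m)).
  have Hh m : m ∈ n -> ap h m = run f m by move=> Hm; rewrite ap_lam.
  have E1 : stage h n = ind f n.
  { apply: ext => i; rewrite /stage /ind !bigcupE /dfirst /dlength /dl /rh.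
    by split=> -[m [Hm Hi]]; exists m; split=> //; move: Hi; rewrite Hh. }
  have E2 : next h n = dl f n by rewrite /dl runE // /turn -lock fst_pair.
  have E3 : es f n = ap (enum (ind f n) (dl f n)) (ap f n).
  { by rewrite /es runE // /turn -lock !snd_pair -/h E1 E2. }
  have E4 : rh f n = reach (ind f n) (dl f n) (es f n).
  { by rewrite E3 {1}/rh runE // /turn -lock !snd_pair fst_pair -/h E1 E2. }
  split=> //; rewrite -E2 /next; congr least; apply: functional_extensionality => d.
  apply: propositional_extensionality; rewrite /dfirst /dlast /dl /es.
  by split=> -[A1 [A2 A3]]; split=> //; split=> // m Hm; move: (A3 _ Hm); rewrite Hh.
Qed.

Lemma run_agree f f' n : ordinal n -> (forall m, m ∈ n -> ap f m = ap f' m) ->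
  forall m, m ∈ n -> run f m = run f' m.
Proof.
  move=> Hn E; apply: (wf_ind (R := mem)); first exact: wf_mem.
  move=> m Hm IH; have Hmo := ord_in Hn Hm.
  have El : lam m (fun k => run f k) = lam m (fun k => run f' k).
  { apply: lam_ext => k Hk; apply: (IH _ _ Hk); exact: (ord_trans Hn Hm). }
  by rewrite (runE f Hmo) (runE f' Hmo) (E _ Hm) El.
Qed.

Lemma ind_agree f f' n : ordinal n -> (forall m, m ∈ n -> ap f m = ap f' m) ->
  ind f n = ind f' n.
Proof.
  move=> Hn E; have H := run_agree Hn E; apply: ext => i.
  apply: (iff_trans (indE f n i)); apply: iff_trans (iff_sym (indE f' n i)).
  split=> -[m [b [Hm Hi]]]; exists m, b; (split; first exact: Hm);
  by move: Hi; rewrite /rh /dl (H _ Hm).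
Qed.
Lemma dl_agree f f' n : ordinal n -> (forall m, m ∈ n -> ap f m = ap f' m) ->
  dl f n = dl f' n.
Proof.
  move=> Hn E; have H := run_agree Hn E.
  have [-> _] := run_unfold f Hn; have [-> _] := run_unfold f' Hn.
  congr least; apply: functional_extensionality => d.
  apply: propositional_extensionality; rewrite /dl /es.
  by split=> -[A1 [A2 A3]]; do 2 (split; first by []); move=> m Hm; move: (A3 _ Hm);
    rewrite (H _ Hm).
Qed.

Lemma enum_bij J d : bdd J d -> bij (enum J d) (kap M) (difs J d x).
Proof.
  move=> HJ.
  have Hsub : difs J d x ⊆ kap M by move=> e /difsE [].
  have [f Hf] := subset_card_bij kap_ord Hsub (Hgood HJ).
  have /sepE [_ //] : enum J d ∈ sep (funs (kap M) (kap M)) (fun f => bij f (kap M) (difs J d x)).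
  apply: Hch; first by apply/powE => v /sepE [].
  exists f; apply/sepE; split=> //; apply/funsE; have [[Hff _] _] := Hf.
  by apply: (fn_sub Hff) => v Hv; apply: Hsub; apply: (fn_val Hff).
Qed.

Section Branch.
Variable f : M.
Hypothesis Hf : is_function f (mu M) (kap M).

Definition sound (n : M) : Prop := dl f n ∈ Me M /\ ap C n ∈ dl f n /\
  (forall m, m ∈ n -> dl f m ∈ dl f n /\ es f m ∈ dl f n) /\
  bdd (ind f n) (dl f n) /\ es f n ∈ kap M /\ rh f n ∈ kap M /\
  mindif (ind f n) (dl f n) x (rh f n) (es f n).
#[local] Instance rel_sound : Rel1 sound. Proof. rewrite /sound; sd. Qed.

Lemma run_sound : forall n, n ∈ mu M -> sound n.
Proof.
  apply: (wf_ind (R := mem)); first exact: wf_mem.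
  move=> n Hn IH; have Hno := ord_in mu_ord Hn.
  have IH' m : m ∈ n -> sound m by move=> Hm; apply: IH => //; apply: (ord_trans mu_ord Hn).
  have [E1 [E2 E3]] := run_unfold f Hno.
  (* Stage [n] lies below the cofinality, so everything recorded earlier is bounded below [kap], and
     a next measurable cardinal exists. *)
  have [b1 [Hb1 B1]] : exists b, b ∈ kap M /\ forall m, m ∈ n -> dl f m ∈ b.
  { by apply: mu_bound => // m /IH' [/Me_kap]. }
  have [b2 [Hb2 B2]] : exists b, b ∈ kap M /\ forall m, m ∈ n -> es f m ∈ b.
  { by apply: mu_bound => // m /IH' [_ [_ [_ [_ []]]]]. }
  have [b3 [Hb3 B3]] : exists b, b ∈ kap M /\ forall m, m ∈ n -> rh f m ∈ b.
  { by apply: mu_bound => // m /IH' [_ [_ [_ [_ [_ []]]]]]. }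
  have [b4 [Hb4 [H1 H2]]] := kap_max Hb1 Hb2.
  have [d0 [Hd0 [Hcd0 Hbd0]]] := Me_above (fn_val HC Hn) Hb4.
  have Hd0o := Me_ord Hd0.
  have [||A [_ _]] := least_spec (P := fun d => d ∈ Me M /\ ap C n ∈ d /\
    forall m, m ∈ n -> dl f m ∈ d /\ es f m ∈ d) (a := d0).
  { exact: Hd0o. }
  { split=> //; split=> // m Hm; split; apply: (ord_trans Hd0o Hbd0);
    [apply: H1; exact: B1|apply: H2; exact: B2]. }
  rewrite -E1 in A; have [A1 [A2 A3]] := A.
  have Hbdd : bdd (ind f n) (dl f n).
  { split=> //; split; last split.
    - move=> i /indE [m [b [Hm [Hb ->]]]]; have [Hdm [_ [_ [_ [_ [Hrm _]]]]]] := IH' _ Hm.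
      by apply/pair_prod; split=> //; apply: (kap_trans Hrm).
    - by move=> i /indE [m [b [Hm [Hb ->]]]]; rewrite fst_pair; case: (A3 _ Hm).
    - have [l [Hl [L1 L2]]] := kap_max Hb1 Hb3.
      exists l; split=> // i /indE [m [b [Hm [Hb ->]]]]; apply/pair_prod; split.
      + by apply: L1; apply: B1.
      + by apply: L2; apply: (ord_trans (ord_in kap_ord Hb3) (B3 _ Hm)). }
  have [[Hen _] _] := enum_bij Hbdd.
  have Hes : es f n ∈ difs (ind f n) (dl f n) x by rewrite E2; apply: (fn_val Hen); apply: (fn_val Hf).
  have /difsE [Hesk [r [Hr Hmd]]] := Hes.
  have [[R1 R2] _] := least_spec (P := fun r => r ∈ kap M /\ mindif (ind f n) (dl f n) x r (es f n))
    (ord_in kap_ord Hr) (conj Hr Hmd).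
  rewrite /reach in E3; rewrite -E3 in R1 R2; do 3 (split; first by []).
  by split; [exact: Hbdd|split; [exact: Hesk|]].
Qed.

Lemma dl_Me n : n ∈ mu M -> dl f n ∈ Me M.
Proof. by case/run_sound. Qed.
Lemma dl_mono m n : n ∈ mu M -> m ∈ n -> dl f m ∈ dl f n.
Proof. by move=> /run_sound [_ [_ [H _]]] /H []. Qed.
Lemma dl_le m n : n ∈ mu M -> ordinal m -> m ⊆ n -> dl f m ⊆ dl f n.
Proof.
  move=> Hn Hm Hmn; move/(ord_sub Hm (ord_in mu_ord Hn)): Hmn => [H|-> //].
  apply: ord_lt_sub; [exact: (Me_ord (dl_Me Hn))|exact: dl_mono].
Qed.
Lemma es_dl m n : n ∈ mu M -> m ∈ n -> es f m ∈ dl f n.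
Proof. by move=> /run_sound [_ [_ [H _]]] /H []. Qed.

Lemma ind_Om : ind f (mu M) ⊆ Om.
Proof.
  move=> i /indE [m [b [Hm [Hb ->]]]]; have [Hdm [_ [_ [_ [_ [Hrm _]]]]]] := run_sound Hm.
  by apply/pair_prod; split=> //; apply: (kap_trans Hrm).
Qed.

(** If [c] is below [ap C n], then measures on cardinals at most [c] are used before stage [n] only,
    and fewer than cof(kappa) many iteration lengths are bounded below [kap]. *)
Lemma ind_tame : tame (ind f (mu M)).
Proof.
  split; first exact: ind_Om.
  move=> c Hc; have [n [Hn HcC]] := HCcof Hc; have Hno := ord_in mu_ord Hn.
  have [b [Hb Hall]] : exists b, b ∈ kap M /\ forall m, m ∈ n -> rh f m ∈ b.
  { apply: mu_bound => // m Hm.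
    by have [_ [_ [_ [_ [_ []]]]]] := run_sound (ord_trans mu_ord Hn Hm). }
  exists b; split=> // i /indE [m [v [Hm [Hv ->]]]]; rewrite fst_pair snd_pair => Hdc.
  apply: (ord_trans (ord_in kap_ord Hb) _ Hv); apply: Hall.
  apply: NNPP => /(ord_nmem (ord_in mu_ord Hm) Hno) Hnm.
  have [Hdn [HCn _]] := run_sound Hn.
  apply: (@mem_irr _ c); apply: Hdc; apply: (dl_le Hm Hno Hnm).
  exact: (ord_trans (Me_ord Hdn) HCn).
Qed.

Lemma ind_endext n : n ∈ mu M -> endext (ind f n) (ind f (mu M)) (dl f n).
Proof.
  move=> Hn; have Hno := ord_in mu_ord Hn; split; last split.
  - move=> i /indE [m [b [Hm H]]]; apply/indE; exists m, b; split=> //.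
    exact: (ord_trans mu_ord Hn).
  - exact: ind_Om.
  - move=> i /indE [m [b [Hm [Hb ->]]]] Hni.
    have Hnm : n ⊆ m.
    { apply/(ord_nmem (ord_in mu_ord Hm) Hno) => H; apply: Hni; apply/indE; by exists m, b. }
    rewrite fst_pair; split; last exact: dl_le.
    move=> j /indE [m' [b' [Hm' [_ ->]]]]; left; rewrite !fst_pair; apply: dl_mono => //.
    exact: Hnm.
Qed.

(** The threshold includes [es f n] itself: all later measures live on cardinals above it, so the
    difference recorded at stage [n] survives in the final image. *)
Lemma ind_endext_succ n : n ∈ mu M ->
  endext (add (ind f n) (dl f n) (rh f n)) (ind f (mu M)) (succ (es f n)).
Proof.
  move=> Hn; have Hno := ord_in mu_ord Hn.
  have HA i : i ∈ add (ind f n) (dl f n) (rh f n) <->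
    exists m b, (m ∈ n \/ m = n) /\ b ∈ rh f m /\ i = pair (dl f m) b.
  { rewrite addE indE; split.
    - move=> [[m [b [Hm H]]]|[b H]]; [exists m, b|exists n, b]; split=> //; by [left|right].
    - by move=> [m [b [[Hm|->] H]]]; [left; exists m, b|right; exists b]. }
  split; last split.
  - move=> i /HA [m [b [Hm H]]]; apply/indE; exists m, b; split=> //.
    by case: Hm => [Hm|->] //; apply: (ord_trans mu_ord Hn).
  - exact: ind_Om.
  - move=> i /indE [m [b [Hm [Hb ->]]]] Hni.
    have Hnm : n ∈ m.
    { case: (ord_trich Hno (ord_in mu_ord Hm)) => [//|[E|H]]; case: Hni; apply/HA; exists m, b;
      split=> //; by [right|left]. }
    rewrite fst_pair; split.
    + move=> j /HA [m' [b' [Hm' [_ ->]]]]; left; rewrite !fst_pair; apply: dl_mono => //.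
      by case: Hm' => [H|-> //]; apply: (ord_trans (ord_in mu_ord Hm) Hnm).
    + apply: succ_sub; [exact: (Me_ord (dl_Me Hm))|exact: es_dl].
Qed.

Definition branch : M := img (ind f (mu M)) x.

Lemma branch_stage n e : n ∈ mu M -> e ∈ dl f n -> (e ∈ branch <-> e ∈ img (ind f n) x).
Proof.
  move=> Hn He; have Hdk := Me_kap (dl_Me Hn).
  apply: (img_endext _ ind_tame (ind_endext Hn) Hdk); exact: (pi_ge _ Hdk).
Qed.
Lemma branch_add n e : n ∈ mu M -> e ⊆ es f n -> ordinal e ->
  (e ∈ branch <-> e ∈ img (add (ind f n) (dl f n) (rh f n)) x).
Proof.
  move=> Hn He Heo; have [_ [_ [_ [_ [Hesk _]]]]] := run_sound Hn; have Hsk := kap_succ Hesk.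
  apply: (img_endext _ ind_tame (ind_endext_succ Hn) Hsk); apply: (pi_ge _ Hsk).
  by apply/succE; move/(ord_sub Heo (ord_in kap_ord Hesk)): He.
Qed.
End Branch.

Lemma branch_agree f f' n e : is_function f (mu M) (kap M) -> is_function f' (mu M) (kap M) ->
  n ∈ mu M -> (forall m, m ∈ n -> ap f m = ap f' m) -> e ∈ dl f n ->
  (e ∈ branch f <-> e ∈ branch f').
Proof.
  move=> Hf Hf' Hn E He; have Hno := ord_in mu_ord Hn.
  have E1 := ind_agree Hno E; have E2 := dl_agree Hno E.
  have He' : e ∈ dl f' n by rewrite -E2.
  apply: (iff_trans (branch_stage Hf Hn He)); rewrite E1.
  exact: (iff_sym (branch_stage Hf' Hn He')).
Qed.

(** Up to stage [n] both runs coincide, so both compare with the same limit. At [es f n] the first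
    image has left the limit, while the second one leaves it only later. *)
Lemma branch_differ_lt f f' n : is_function f (mu M) (kap M) -> is_function f' (mu M) (kap M) ->
  n ∈ mu M -> (forall m, m ∈ n -> ap f m = ap f' m) -> es f n ∈ es f' n ->
  ~ (es f n ∈ branch f <-> es f n ∈ branch f').
Proof.
  move=> Hf Hf' Hn E Hlt; have Hno := ord_in mu_ord Hn.
  have [_ [_ [_ [_ [He [_ [[_ Hd] _]]]]]]] := run_sound Hf Hn.
  have [_ [_ [_ [_ [He' [_ [_ Hmin]]]]]]] := run_sound Hf' Hn.
  have Heo := ord_in kap_ord He; have Heo' := ord_in kap_ord He'.
  have E1 := ind_agree Hno E; have E2 := dl_agree Hno E.
  have A1 := branch_add Hf Hn (fun v Hv => Hv) Heo.
  have A2 := branch_add Hf' Hn (ord_lt_sub Heo' Hlt) Heo.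
  rewrite E1 E2 in Hd A1; move=> HH; apply: Hd.
  apply: (iff_trans (iff_sym A1)); apply: (iff_trans HH); apply: (iff_trans A2).
  apply: NNPP => Hn'; exact: (Hmin _ Hlt (conj He Hn')).
Qed.

(** The common enumeration is injective, so different values at [n] record different first
    differences, and the smaller one separates the images. *)
Lemma branch_differ f f' n : is_function f (mu M) (kap M) -> is_function f' (mu M) (kap M) ->
  n ∈ mu M -> (forall m, m ∈ n -> ap f m = ap f' m) -> ap f n <> ap f' n ->
  exists e, e ⊆ es f n /\ ordinal e /\ ~ (e ∈ branch f <-> e ∈ branch f').
Proof.
  move=> Hf Hf' Hn E Hne; have Hno := ord_in mu_ord Hn.
  have [_ [_ [_ [Hb [He _]]]]] := run_sound Hf Hn.
  have [_ [_ [_ [Hb' [He' _]]]]] := run_sound Hf' Hn.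
  have Heo := ord_in kap_ord He; have Heo' := ord_in kap_ord He'.
  have Hees : es f n <> es f' n.
  { have [_ [E1 _]] := run_unfold f Hno; have [_ [E2 _]] := run_unfold f' Hno.
    move=> Ees; apply: Hne; have [[_ Hinj] _] := enum_bij Hb'.
    apply: Hinj; [exact: (fn_val Hf)|exact: (fn_val Hf')|].
    rewrite (ind_agree Hno E) (dl_agree Hno E) in E1.
    exact: (eq_trans (eq_sym E1) (eq_trans Ees E2)). }
  have E' m : m ∈ n -> ap f' m = ap f m by move=> Hm; symmetry; apply: E.
  case: (ord_trich Heo Heo') => [H|[//|H]].
  - exists (es f n); split; first by []. split; [exact: Heo|exact: branch_differ_lt].
  - exists (es f' n); split; first exact: ord_lt_sub.
    split; first exact: Heo'.
    move=> HH; exact: (branch_differ_lt Hf' Hf Hn E' H (iff_sym HH)).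
Qed.

Lemma first_difference f f' n : n ∈ mu M -> ap f n <> ap f' n ->
  exists m, m ∈ mu M /\ m ⊆ n /\ ap f m <> ap f' m /\ forall j, j ∈ m -> ap f j = ap f' j.
Proof.
  move=> Hn Hne; have Hno := ord_in mu_ord Hn.
  have [m [Hm [H1 [H2 H3]]]] := least_ex (P := fun m => ap f m <> ap f' m) Hno Hne.
  exists m; split; first exact: (ord_le_lt mu_ord H2 Hm Hn).
  by split=> //; split=> // j /H3 /NNPP.
Qed.

#[global] Instance fun_branch : Fun1 branch. Proof. rewrite /branch; sd. Qed.

Lemma runs_perfect :
  perfect_embedding (mu M) (kap M) (kap M) (lam (funs (mu M) (kap M)) branch).
Proof.
  (* Level [n] is read off below [dl f n]: this cardinal exceeds every difference recorded before
     stage [n], and the part of the image below it depends only on the earlier stages. *)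
  apply: (perfect_of_levels (th := dl)).
  - exact: mu_ord.
  - exact: kap_ord.
  - by move=> f _; exact: img_sub.
  - by move=> f n Hf Hn; apply: Me_kap; exact: dl_Me.
  - move=> f b Hf Hb; have [n [Hn HbC]] := HCcof Hb; exists n; split; first exact: Hn.
    have [Hd [HCn _]] := run_sound Hf Hn; have Hdo := Me_ord Hd.
    by apply: (ord_lt_sub Hdo); apply: (ord_trans Hdo HCn).
  - by move=> f g n Hf Hg Hn E e He; apply: (branch_agree Hf Hg Hn E).
  - move=> f g n Hf Hg Hn E i Hi; apply: NNPP => Hne.
    have Him := ord_trans mu_ord Hn Hi.
    have [m [Hm [Hmi [Hd Hag]]]] := first_difference Him Hne.
    have [e [He [Heo Hdiff]]] := branch_differ Hf Hg Hm Hag Hd.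
    apply: Hdiff; apply: E; have Hdlo := Me_ord (dl_Me Hf Hn).
    apply: (ord_le_lt Hdlo He Heo); apply: (es_dl Hf Hn).
    exact: (ord_le_lt (ord_in mu_ord Hn) Hmi (ord_in mu_ord Hm) Hi).
  - move=> f g Hf Hg E; apply: (fn_ext Hf Hg) => n Hn; apply: NNPP => Hne.
    have [m [Hm [_ [Hd Hag]]]] := first_difference Hn Hne.
    have [e [_ [_ Hdiff]]] := branch_differ Hf Hg Hm Hag Hd.
    exact: (Hdiff (eq_ind _ (fun v => e ∈ branch f <-> e ∈ v) (iff_refl _) _ E)).
Qed.
End Runs.

(** * The theorem *)

Lemma perfect_ex {M : setting} (D : M) : (forall x, x ∈ D -> x ⊆ kap M) -> ~ emb D (kap M) ->
  (forall I x, tame I -> x ∈ D -> img I x ∈ D) ->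
  exists io, perfect_embedding (mu M) (kap M) (kap M) io /\
    forall R, is_range io R -> R ⊆ D.
Proof.
  move=> HD Hn Himg; have [x [HxD Hgood]] := good_ex HD Hn.
  have [C [HC HCcof]] := @mu_cofinal M.
  have [ch Hch] := choice_fn (pow (funs (kap M) (kap M))).
  exists (lam (funs (mu M) (kap M)) (branch x C ch)); split; first exact: runs_perfect.
  move=> R HR y /HR [f /appE]; rewrite pair_lam => -[/funsE Hf ->].
  apply: Himg => //; exact: (ind_tame Hgood HC HCcof Hch Hf).
Qed.

Section LimitOfMeasurables.
Context {M : zfc_model}.
Variable k : M.
Hypothesis Hk : limit_of_measurables k.

(** The whole sequence of parameters need not be bounded below [k], but finitely many terms are; the
    induction on [n] takes place outside the model. *)
Lemma params_bound (p : nat -> M) (n : nat) : (forall i, in_H k (p i) \/ p i = k) ->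
  exists d B, d ∈ k /\ forall i, i < n -> p i ∈ B /\
    (p i = k \/ exists t, transitive t /\ p i ⊆ t /\ exists l, l ⊆ d /\ emb t l).
Proof.
  move=> Hp; have Hko : ordinal k by case: (limit_cardinal Hk).
  elim: n => [|n [d [B [Hd HB]]]].
  - have [_ [Hne _]] := Hk; exists emp, emp; split; last by lia.
    apply: ord_emp_mem => //; apply: NNPP => H; apply: Hne => z Hz; apply: H; by exists z.
  - have [d' [Hd' [Hdd' Hnew]]] : exists d', d' ∈ k /\ d ⊆ d' /\
      (p n = k \/ exists t, transitive t /\ p n ⊆ t /\ exists l, l ⊆ d' /\ emb t l).
    { case: (Hp n) => [[t [[Ht1 [Ht2 _]] [l [[_ /equiE [f Hf]] Hl]]]]|E].
      - have [d' [Hd' [H1 H2]]] : exists d', d' ∈ k /\ d ⊆ d' /\ l ⊆ d'.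
        { case: (ord_total (ord_in Hko Hd) (ord_in Hko Hl)) => H; [exists l|exists d];
          do ! split=> //. }
        exists d'; split=> //; split=> //; right; exists t; split=> //; split=> //.
        by exists l; split=> //; apply: (bij_emb Hf).
      - by exists d; split=> //; split=> //; left. }
    exists d', (cup B (sing (p n))); split=> // i Hi.
    case: (Nat.eq_dec i n) => [->|Hne]; first by split=> //; apply/cupE; right; apply/singE.
    have [|HBi Hpi] := HB i; first by lia.
    split; first by apply/cupE; left.
    case: Hpi => [E|[t [Ht1 [Ht2 [l [Hl1 Hl2]]]]]]; [by left|right].
    exists t; split=> //; split=> //; exists l; split=> // v /Hl1; exact: Hdd'.
Qed.

(** Of two successive candidates at most one equals [m]. *)
Lemma measurables_above (m d a : M) : d ∈ k -> a ∈ k ->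
  exists e, e ∈ k /\ measurable e /\ d ∈ e /\ e <> m /\ a ∈ e.
Proof.
  move=> Hd Ha; have Hko : ordinal k by case: (limit_cardinal Hk).
  have [_ [_ Hlim]] := Hk.
  have [b [Hb [H1 H2]]] : exists b, b ∈ k /\ d ⊆ b /\ a ⊆ b.
  { case: (ord_total (ord_in Hko Hd) (ord_in Hko Ha)) => H; [exists a|exists d];
    do ! split=> //. }
  have Hcase e : e ∈ k -> b ∈ e -> d ∈ e /\ a ∈ e.
  { move=> He Hbe; have Heo := ord_in Hko He.
    by split; [apply: (ord_le_lt Heo H1)|apply: (ord_le_lt Heo H2)] => //; apply: (ord_in Hko). }
  have [e [He [Hbe Hme]]] := Hlim _ Hb; have [e' [He' [Hee' Hme']]] := Hlim _ He.
  have Heo' := ord_in Hko He'.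
  case: (classic (e = m)) => [E|Hne].
  - have [A B] := Hcase _ He' (ord_trans Heo' Hee' Hbe).
    exists e'; do ! split=> //; by move=> E'; subst e e'; apply: (mem_irr Hee').
  - by have [A B] := Hcase _ He Hbe; exists e.
Qed.
End LimitOfMeasurables.

Lemma perfect_subset_property (M : zfc_model) (k m D : M) :
  limit_of_measurables k -> is_cofinality k m -> (forall x, x ∈ D -> x ⊆ k) ->
  sigma1_definable (fun p => in_H k p \/ p = k) (fun x => x ∈ D) -> card_gt D k ->
  exists io, perfect_embedding m k k io /\ forall R, is_range io R -> R ⊆ D.
Proof.
  move=> Hk Hm HD [f [p [Hf [Hp HDf]]]] Hcard.
  have [n Hn] := @sat_fv M f.
  have [d0 [B [Hd0 HB]]] := params_bound Hk n Hp.
  pose (Ms := sep k (fun d => measurable d /\ d0 ∈ d /\ d <> m)).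
  have HMs d : d ∈ Ms <-> d ∈ k /\ measurable d /\ d0 ∈ d /\ d <> m by rewrite sepE.
  clearbody Ms.
  have Hu d : d ∈ Ms -> exists u, u ∈ pow (pow k) /\ measure d u.
  { move=> /HMs [Hd [/measurableE [u Hu] _]]; exists u; split=> //.
    have [_ [_ [[Hsub _] _]]] := Hu; have Hko : ordinal k by case: (limit_cardinal Hk).
    apply/powE => v /Hsub Hv; apply/powE => w /Hv Hw; exact: (ord_trans Hko Hd). }
  have [ul [_ Hul]] := choice_rel (R := fun d u => measure d u) Hu.
  have HMk d : d ∈ Ms -> d ∈ k by move=> /HMs [].
  have HMm d : d ∈ Ms -> d <> m by move=> /HMs [_ [_ []]].
  have HMc a : a ∈ k -> exists d, d ∈ Ms /\ a ∈ d.
  { move=> Ha; have [e [He1 [He2 [He3 [He4 He5]]]]] := measurables_above Hk m Hd0 Ha.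
    by exists e; split=> //; apply/HMs. }
  pose (S := @Setting M k m Ms ul Hk Hm HMk HMm Hul HMc).
  have Hnemb : ~ emb D k.
  { move=> He; have [l [[Hl /equiE [g Hg]] Hkl]] := Hcard.
    have [g' Hg'] := bij_sym Hg; apply: (card_no_emb Hl Hkl).
    exact: (emb_trans (bij_emb Hg') He). }
  apply: (@perfect_ex S D) => // I x HI HxD.
  (* Variables from [n] on do not occur in [f]. Their parameters are replaced by [k], which every
     iteration fixes, so that all terms of the sequence satisfy the bound. *)
  pose (q := fun i => if Nat.ltb i n then p i else k).
  have Hqs z : sat (scons z q) f <-> sat (scons z p) f.
  { apply: Hn => -[//|i] Hi /=; rewrite /q; have -> // : Nat.ltb i n = true.
    apply/Nat.ltb_lt; lia. }
  apply/HDf; apply/Hqs.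
  apply: (@sigma1_img S f q (cup B (sing k)) I x Hf) => //.
  - move=> i; rewrite /q; case E : (Nat.ltb i n).
    + by apply/cupE; left; case: (HB i); first exact/Nat.ltb_lt.
    + by apply/cupE; right; apply/singE.
  - move=> i; rewrite /q; case E : (Nat.ltb i n); last by left.
    have [|_ [->|[t [Ht1 [Ht2 [l [Hl1 Hl2]]]]]]] := HB i; [exact/Nat.ltb_lt|by left|right].
    exists t; split=> //; split=> // d /HMs [_ [_ [Hd _]]].
    exists d0; split=> //; exact: (emb_trans Hl2 (emb_sub Hl1)).
  - exact: HD.
  - by apply/Hqs; apply/HDf.
Qed.

Theorem theorem1p1 (M : set_structure) (HM : ZFC M) (kappa mu D : M)
  (Hkappa : limit_of_measurables kappa)
  (Hmu : is_cofinality kappa mu)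
  (HDsub : forall x, x ∈ D -> x ⊆ kappa)
  (HDdef : sigma1_definable (fun p => in_H kappa p \/ p = kappa)
             (fun x => x ∈ D))
  (HDcard : card_gt D kappa) :
  exists iota : M,
    perfect_embedding mu kappa kappa iota /\
    (forall R, is_range iota R -> R ⊆ D).
Proof.
  exact: (@perfect_subset_property (ZFCModel HM) kappa mu D).
Qed.
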